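(* Let $\mathcal{K}_{\mathbb{P}}$ be the (Fraïssé) category whose single object is $\mathrm{Lsc}([0,1],\overline{\mathbb{N}})$ and whose morphisms are the order-embeddings $\alpha\colon\mathrm{Lsc}([0,1],\overline{\mathbb{N}})\to\mathrm{Lsc}([0,1],\overline{\mathbb{N}})$ such that $\alpha(1)=1$, where $1$ denotes the constant function $1$. Then the Fraïssé limit of $\mathcal{K}_{\mathbb{P}}$ is $\mathrm{Lsc}(\mathbb{P},\overline{\mathbb{N}})$, where $\mathbb{P}$ is the pseudo-arc.
   Context: **$\mathrm{Cu}$-semigroups.** For $x,y$ in a partially ordered set, $x\ll y$ means: for every increasing sequence $(z_n)_n$ having a supremum with $y\le\sup_n z_n$, there is $n$ with $x\le z_n$. A $\mathrm{Cu}$-semigroup is a positively ordered (commutative) monoid $S$ such that (O1) every increasing sequence has a supremum; (O2) every element is the supremum of a $\ll$-increasing sequence; (O3) $x'\ll x$ and $y'\ll y$ imply $x'+y'\ll x+y$; (O4) $\sup_n(x_n+y_n)=\sup_n x_n+\sup_n y_n$ for increasing sequences. A $\mathrm{Cu}$-morphism is a monoid morphism preserving the order, the relation $\ll$, and suprema of increasing sequences. $\mathrm{Cu}$ denotes the resulting category; it has inductive limits. An order-embedding between $\mathrm{Cu}$-semigroups always means a $\mathrm{Cu}$-morphism $\alpha$ such that $\alpha(x)\le\alpha(y)$ implies $x\le y$. $S$ is countably-based if there is a countable subset $B\subseteq S$ such that every element of $S$ is the supremum of a $\ll$-increasing sequence in $B$. With $\overline{\mathbb{N}}=\{0,1,2,\ldots,\infty\}$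 and $X$ a compact metric space, $\mathrm{Lsc}(X,\overline{\mathbb{N}})$ is the monoid of lower-semicontinuous functions $X\to\overline{\mathbb{N}}$ with pointwise order and addition; it is a $\mathrm{Cu}$-semigroup. **Pseudo-arc.** $\mathbb{P}$ is the unique (up to homeomorphism) nondegenerate hereditarily indecomposable arc-like (chainable) continuum. **Finite-set comparison.** For $\mathrm{Cu}$-morphisms $\alpha,\beta\colon S\to T$ and a finite set $F\subseteq S$, write $\alpha\simeq_F\beta$ if $\alpha(x')\le\beta(x)$ and $\beta(x')\le\alpha(x)$ for all $x',x\in F$ with $x'\ll x$. **Fraïssé limit.** An inductive sequence $(S_i,\sigma_{i,j})_{i\in\mathbb{N}}$ in a subcategory $\mathfrak{c}\subseteq\mathrm{Cu}$ is a Fraïssé sequence if every $S_i$ is countably-based and, for every $i$, every finite $F\subseteq S_i$ and every $\mathfrak{c}$-morphism $\alpha\colon S_i\to C$, there are $j\ge i$ and a $\mathfrak{c}$-morphism $\beta_F\colon C\to S_j$ with $\beta_F\circ\alpha\simeq_F\sigma_{i,j}$. The category $\mathcal{K}_{\mathbb{P}}$ is a Fraïssé category, so it has a Fraïssé sequence; the Fraïssé limit is the $\mathrm{Cu}$-limit of any Fraïssé sequence (unique up to isomorphism). *)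

(* Defs.v *)
From HB Require Import structures.
From mathcomp Require Import all_boot all_order all_algebra.
From mathcomp Require Import all_classical all_reals all_analysis.
From mathcomp Require Import lra.

Set Implicit Arguments.
Unset Strict Implicit.
Unset Printing Implicit Defensive.

Import Order.TTheory GRing.Theory Num.Theory.
Import numFieldNormedType.Exports.

Local Open Scope classical_set_scope.
Local Open Scope ring_scope.

Definition way_below d (S : porderType d) (x y : S) : Prop :=
  forall z : nat -> S, nondecreasing_seq z ->
  forall s, isLub (range z) s -> (y <= s)%O -> exists n, (x <= z n)%O.

Notation "x '\ll' y" := (way_below x y) (at level 70, no associativity).

Fact cu_display : Order.disp_t. Proof. exact: Order.Disp tt tt. Qed.

(* The monoid operations are part of the mixin, instead of being inherited from
   [nmodType], because MathComp already fixes [porderZmodType] as the join of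
   the order and of the additive structures, and this cannot be refined. *)
HB.mixin Record isCuSemigroup S & Order.POrder cu_display S := {
  cu_zero : S;
  cu_add : S -> S -> S;
  cu_addA : associative cu_add;
  cu_addC : commutative cu_add;
  cu_add0 : left_id cu_zero cu_add;
  cu_ge0 : forall x, (cu_zero <= x)%O;
  cu_leD : forall x y x' y',
    (x <= y -> x' <= y' -> cu_add x x' <= cu_add y y')%O;
  cu_O1 : forall z : nat -> S, nondecreasing_seq z ->
    exists s, isLub (range z) s;
  cu_O2 : forall x, exists z : nat -> S,
    (forall n, z n \ll z n.+1) /\ isLub (range z) x;
  cu_O3 : forall x' x y' y, x' \ll x -> y' \ll y ->
    cu_add x' y' \ll cu_add x y;
  cu_O4 : forall (x y : nat -> S) s t,
    nondecreasing_seq x -> nondecreasing_seq y ->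
    isLub (range x) s -> isLub (range y) t ->
    isLub (range (fun n => cu_add (x n) (y n))) (cu_add s t)
}.

#[short(type="cuType")]
HB.structure Definition CuSemigroup :=
  { S of isCuSemigroup S & Order.POrder cu_display S }.

Declare Scope cu_scope.
Delimit Scope cu_scope with Cu.
Notation "0" := (@cu_zero _) : cu_scope.
Notation "x + y" := (cu_add x y) : cu_scope.

Definition cu_morphism (S T : cuType) (f : S -> T) : Prop :=
  [/\ f 0%Cu = 0%Cu /\ {morph f : x y / (x + y)%Cu},
      {homo f : x y / (x <= y)%O},
      {homo f : x y / x \ll y} &
      forall (z : nat -> S) s, nondecreasing_seq z ->
        isLub (range z) s -> isLub (range (f \o z)) (f s)].

Definition order_embedding (S T : cuType) (f : S -> T) : Prop :=
  cu_morphism f /\ forall x y, (f x <= f y -> x <= y)%O.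

Definition countably_based (S : cuType) : Prop :=
  exists B : set S, countable B /\
    forall x, exists z : nat -> S,
      [/\ forall n, B (z n), forall n, z n \ll z n.+1 & isLub (range z) x].

Definition fin_compare (S T : cuType) (F : set S) (f g : S -> T) : Prop :=
  forall x' x, F x' -> F x -> x' \ll x ->
    (f x' <= g x)%O /\ (g x' <= f x)%O.

Lemma cu_morphism_id (S : cuType) : cu_morphism (@id S).
Proof. by split=> //; split. Qed.

Lemma cu_morphism_comp (S T U : cuType) (g : T -> U) (f : S -> T) :
  cu_morphism g -> cu_morphism f -> cu_morphism (g \o f).
Proof.
move=> [[g0 gD] gle gll gsup] [[f0 fD] fle fll fsup]; split.
- by split=> [|x y] /=; rewrite ?f0 ?fD.
- by move=> x y /fle/gle.
- by move=> x y /fll/gll.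
- move=> z s zle zs; apply: (gsup (f \o z)); last exact: fsup.
  by move=> m n /zle/fle.
Qed.

Lemma order_embedding_comp (S T U : cuType) (g : T -> U) (f : S -> T) :
  order_embedding g -> order_embedding f -> order_embedding (g \o f).
Proof.
move=> [gm ge] [fm fe]; split; first exact: cu_morphism_comp.
by move=> x y /ge/fe.
Qed.

(* A (not necessarily full) subcategory of Cu, given by an indexing type of
   objects and by the Cu-morphisms which it retains between them. *)
Record subcategory := Subcategory {
  ob :> Type;
  ob_cu : ob -> cuType;
  hom : forall a b : ob, (ob_cu a -> ob_cu b) -> Prop;
  hom_cu : forall a b (f : ob_cu a -> ob_cu b), hom f -> cu_morphism f;
  hom_id : forall a, hom (@id (ob_cu a));
  hom_comp : forall a b c (g : ob_cu b -> ob_cu c) (f : ob_cu a -> ob_cu b),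
    hom g -> hom f -> hom (g \o f)
}.

Record ind_seq (C : subcategory) := IndSeq {
  seq_ob : nat -> C;
  seq_map : forall i j, (i <= j)%N -> ob_cu (seq_ob i) -> ob_cu (seq_ob j);
  seq_hom : forall i j (ij : (i <= j)%N), hom (seq_map ij);
  seq_id : forall i (ii : (i <= i)%N) x, seq_map ii x = x;
  seq_comp : forall i j k (ij : (i <= j)%N) (jk : (j <= k)%N) (ik : (i <= k)%N),
    forall x, seq_map jk (seq_map ij x) = seq_map ik x
}.

Definition cocone (C : subcategory) (S : ind_seq C) (T : cuType)
    (phi : forall i, ob_cu (seq_ob S i) -> T) : Prop :=
  (forall i, cu_morphism (phi i)) /\
  forall i j (ij : (i <= j)%N) x, phi j (seq_map ij x) = phi i x.

(* The limit is taken in Cu, not in the subcategory. *)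
Definition is_cu_limit (C : subcategory) (S : ind_seq C) (L : cuType) : Prop :=
  exists tau : forall i, ob_cu (seq_ob S i) -> L,
    cocone tau /\
    forall (T : cuType) (phi : forall i, ob_cu (seq_ob S i) -> T), cocone phi ->
      exists! psi : L -> T,
        cu_morphism psi /\ forall i x, psi (tau i x) = phi i x.

Definition fraisse_seq (C : subcategory) (S : ind_seq C) : Prop :=
  (forall i, countably_based (ob_cu (seq_ob S i))) /\
  forall i (F : set (ob_cu (seq_ob S i))), finite_set F ->
  forall (c : C) (alpha : ob_cu (seq_ob S i) -> ob_cu c), hom alpha ->
  exists j (ij : (i <= j)%N) (beta : ob_cu c -> ob_cu (seq_ob S j)),
    hom beta /\ fin_compare F (beta \o alpha) (seq_map ij).

(* "The" Fraisse limit presupposes that a Fraisse sequence exists, hence the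
   first conjunct: the second one alone would hold vacuously without it. *)
Definition is_fraisse_limit (C : subcategory) (L : cuType) : Prop :=
  (exists S : ind_seq C, fraisse_seq S) /\
  forall S : ind_seq C, fraisse_seq S -> is_cu_limit S L.

Section ExtendedNat.
Context {R : realType}.
Local Open Scope ereal_scope.
Implicit Types (a b : \bar R) (N : nat).

(* {0, 1, ..., oo} sits inside \bar R so that the library's
   [lower_semicontinuous], which is for functions to \bar R, applies. *)
Definition extnat : set (\bar R) :=
  [set a | a = +oo \/ exists n : nat, a = n%:R%:E].

Lemma exists_nat_gt (r : R) : exists n : nat, (r < n%:R)%R.
Proof.
exists (Num.bound `|r|); apply: le_lt_trans (ler_norm r) _.
exact: archi_boundP.
Qed.

Lemma extnat_nat N : extnat N%:R%:E.
Proof. by right; exists N. Qed.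

Lemma extnat_ge0 a : extnat a -> 0 <= a.
Proof. by move=> [->|[n ->]] //; rewrite lee_fin ler0n. Qed.

Lemma extnatD a b : extnat a -> extnat b -> extnat (a + b).
Proof.
move=> [->|[n ->]]; last move=> [->|[m ->]].
- by move=> /extnat_ge0 b0; left; rewrite addye// gt_eqF// (lt_le_trans _ b0).
- by left.
- by right; exists (n + m)%N; rewrite natrD.
Qed.

Lemma extnat_succ a N : extnat a -> N%:R%:E < a -> N.+1%:R%:E <= a.
Proof.
by move=> [->|[n ->]]; rewrite ?leey// lte_fin lee_fin ltr_nat ler_nat.
Qed.

Lemma extnat_leP a b : extnat a ->
  (forall N, N%:R%:E <= a -> N%:R%:E <= b) -> a <= b.
Proof.
move=> [->|[n ->]]; last exact.
move=> H; rewrite leye_eq; apply/eqP/eqyP => r r0.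
have [n rn] := exists_nat_gt r.
apply: le_trans (H n _); last by rewrite leey.
by rewrite lee_fin ltW.
Qed.

Lemma extnat_split a b N : extnat a -> extnat b -> N%:R%:E <= a + b ->
  exists n m : nat, [/\ n%:R%:E <= a, m%:R%:E <= b & (N <= n + m)%N].
Proof.
move=> ha hb; case: (ha) => [->|[n ->]].
  by move=> _; exists N, 0%N; split; rewrite ?leey ?addn0// extnat_ge0.
case: (hb) => [->|[m ->]].
  by move=> _; exists 0%N, N; split; rewrite ?leey// lee_fin ler0n.
by rewrite -EFinD lee_fin -natrD ler_nat => h; exists n, m; rewrite !lexx.
Qed.

Lemma extnat_sup_ge (A : set (\bar R)) N : A `<=` extnat -> A !=set0 ->
  N%:R%:E <= ereal_sup A -> exists2 a, A a & N%:R%:E <= a.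
Proof.
move=> An [a0 Aa0]; case: N => [_|N hN].
  by exists a0 => //; exact/extnat_ge0/An.
have : N%:R%:E < ereal_sup A.
  by apply: lt_le_trans hN; rewrite lte_fin ltr_nat.
by move=> /ereal_sup_gt[a Aa Na]; exists a => //; apply: extnat_succ (An _ Aa) Na.
Qed.

Lemma extnat_sup (A : set (\bar R)) : A `<=` extnat -> A !=set0 ->
  extnat (ereal_sup A).
Proof.
move=> An A0.
have [H|/existsNP[N0 HN0]] := pselect (forall N, N%:R%:E <= ereal_sup A).
  left; apply/eqP; rewrite -leye_eq; apply: extnat_leP; first by left.
  by move=> N _; exact: H.
have sup0 : 0%:R%:E <= ereal_sup A.
  case: A0 => a Aa; apply: le_trans (ereal_sup_ubound Aa).
  exact/extnat_ge0/An.
have [n [hn hnS]] : exists n : nat,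
    n%:R%:E <= ereal_sup A /\ ~ n.+1%:R%:E <= ereal_sup A.
  apply: contrapT => H; apply: HN0; elim: N0 => // n IH.
  by apply: contrapT => hS; apply: H; exists n.
right; exists n; apply/eqP; rewrite eq_le hn andbT.
apply: ge_ereal_sup => a Aa; rewrite leNgt; apply/negP => na; apply: hnS.
exact: le_trans (extnat_succ (An _ Aa) na) (ereal_sup_ubound Aa).
Qed.

End ExtendedNat.

Section LscFun.
Context {R : realType} (X : pseudoMetricType R).

Record lsc_fun := LscFun {
  lsc_val :> X -> \bar R;
  lsc_valP : `[< lower_semicontinuous lsc_val /\ forall x, extnat (lsc_val x) >]
}.

HB.instance Definition _ := [isSub for lsc_val].
HB.instance Definition _ := [Choice of lsc_fun by <:].

Local Open Scope ereal_scope.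
Implicit Types (f g h : lsc_fun) (u : X -> \bar R) (N : nat).

Lemma lsc_extnat f x : extnat (f x).
Proof. by have /asboolP[] := lsc_valP f. Qed.

Lemma lsc_near f N x : N%:R%:E <= f x -> \forall y \near x, N%:R%:E <= f y.
Proof.
case: N => [_|N hN].
  by apply: nearW => y; exact/extnat_ge0/lsc_extnat.
have /asboolP[+ _] := lsc_valP f.
move=> /(_ x N%:R) []; first by apply: lt_le_trans hN; rewrite lte_fin ltr_nat.
by move=> V xV fV; apply: filterS xV => y /fV /(extnat_succ (lsc_extnat f y)).
Qed.

Lemma lsc_make_subproof u : (forall x, extnat (u x)) ->
  (forall N x, N%:R%:E <= u x -> \forall y \near x, N%:R%:E <= u y) ->
  `[< lower_semicontinuous u /\ forall x, extnat (u x) >].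
Proof.
move=> un ul; apply/asboolP; split => // x a aux.
suff [N [aN Nu]] : exists N : nat, a%:E < N%:R%:E /\ N%:R%:E <= u x.
  exists [set y | N%:R%:E <= u y]; first exact: ul.
  by move=> y /=; exact: lt_le_trans.
case: (un x) aux => [->|[n ->]] an; last by exists n.
have {an} [n an] := exists_nat_gt a.
by exists n; split; rewrite ?leey ?lte_fin.
Qed.

Definition lsc_make u un ul : lsc_fun := LscFun (@lsc_make_subproof u un ul).

Lemma lsc_eqP f g : f =1 g -> f = g.
Proof. by move=> fg; apply: val_inj; apply/funext. Qed.

Let cst_near (k : nat) N (x : X) : N%:R%:E <= (k%:R%:E : \bar R) ->
  \forall y \near x, N%:R%:E <= (k%:R%:E : \bar R).
Proof. by move=> ?; apply: nearW. Qed.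

Definition lsc_cst (k : nat) : lsc_fun :=
  lsc_make (fun=> extnat_nat k) (@cst_near k).

Let add_near f g N x : N%:R%:E <= f x + g x ->
  \forall y \near x, N%:R%:E <= f y + g y.
Proof.
move=> /(extnat_split (lsc_extnat f x) (lsc_extnat g x)) [n [m [nf mg Nnm]]].
near=> y; apply: (@le_trans _ _ (n%:R%:E + m%:R%:E)).
  by rewrite -EFinD -natrD lee_fin ler_nat.
by apply: leeD; near: y; exact: lsc_near.
Unshelve. all: by end_near. Qed.

Definition lsc_add f g : lsc_fun :=
  lsc_make (fun x => extnatD (lsc_extnat f x) (lsc_extnat g x)) (@add_near f g).

Lemma lsc_addA : associative lsc_add.
Proof. by move=> f g h; apply: lsc_eqP => x /=; rewrite addeA. Qed.

Lemma lsc_addC : commutative lsc_add.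
Proof. by move=> f g; apply: lsc_eqP => x /=; rewrite addeC. Qed.

Lemma lsc_add0 : left_id (lsc_cst 0) lsc_add.
Proof. by move=> f; apply: lsc_eqP => x /=; rewrite add0e. Qed.

Definition lsc_le f g : bool := `[< forall x, f x <= g x >].

Let lsc_le_refl : reflexive lsc_le.
Proof. by move=> f; apply/asboolP => x. Qed.

Let lsc_le_anti : antisymmetric lsc_le.
Proof.
move=> f g /andP[/asboolP fg /asboolP gf]; apply: lsc_eqP => x.
by apply/eqP; rewrite eq_le fg gf.
Qed.

Let lsc_le_trans : transitive lsc_le.
Proof.
move=> g f h /asboolP fg /asboolP gh; apply/asboolP => x.
exact: le_trans (fg x) (gh x).
Qed.

HB.instance Definition _ := Order.Le_isPOrder.Build cu_display lsc_fun
  lsc_le_refl lsc_le_anti lsc_le_trans.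

Lemma lsc_leP f g : (f <= g)%O <-> forall x, f x <= g x.
Proof. by split=> [/asboolP|?]; [|apply/asboolP]. Qed.

Section Sup.
Variable z : nat -> lsc_fun.

Let zx (x : X) : set (\bar R) := range (fun n => z n x).

Let zx_extnat x : zx x `<=` extnat.
Proof. by move=> _ [n _ <-]; exact: lsc_extnat. Qed.

Let zx_neq0 x : zx x !=set0.
Proof. by exists (z 0%N x), 0%N. Qed.

Lemma lsc_sup_ge N x : N%:R%:E <= ereal_sup (zx x) ->
  exists n, N%:R%:E <= z n x.
Proof.
by move=> /(extnat_sup_ge (@zx_extnat x) (zx_neq0 x)) [_ [n _ <-]]; exists n.
Qed.

Let sup_near N x : N%:R%:E <= ereal_sup (zx x) ->
  \forall y \near x, N%:R%:E <= ereal_sup (zx y).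
Proof.
move=> /lsc_sup_ge[n /lsc_near]; apply: filterS => y h.
by apply: le_trans h (ereal_sup_ubound _); exists n.
Qed.

Definition lsc_sup : lsc_fun :=
  lsc_make (fun x => extnat_sup (@zx_extnat x) (zx_neq0 x)) sup_near.

Lemma lsc_sup_isLub : isLub (range z) lsc_sup.
Proof.
split=> [_ [n _ <-]|g ub].
  by apply/lsc_leP => x; apply: ereal_sup_ubound; exists n.
apply/lsc_leP => x; apply: ge_ereal_sup => _ [n _ <-].
by have /lsc_leP := ub (z n) (ex_intro2 _ _ n I erefl); exact.
Qed.

Lemma lsc_lubE s : isLub (range z) s -> s = lsc_sup.
Proof.
move=> [ub lub]; have [ub' lub'] := lsc_sup_isLub.
by apply/le_anti; rewrite lub// lub'.
Qed.

Lemma lsc_lub_ge s N x : isLub (range z) s -> N%:R%:E <= s x ->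
  exists n, N%:R%:E <= z n x.
Proof. by move=> /lsc_lubE-> /lsc_sup_ge. Qed.

Lemma isLub_lsc s : (forall n, (z n <= s)%O) ->
  (forall N x, N%:R%:E <= s x -> exists n, N%:R%:E <= z n x) ->
  isLub (range z) s.
Proof.
move=> zs H; split=> [_ [n _ <-]|g ub]; first exact: zs.
apply/lsc_leP => x; apply: extnat_leP (lsc_extnat s x) _ => N /H [n Nz].
apply: le_trans Nz _.
by have /lsc_leP := ub (z n) (ex_intro2 _ _ n I erefl); exact.
Qed.

End Sup.

Definition lsc_local_below f g : Prop := forall x, exists N : nat,
  (\forall y \near x, f y <= N%:R%:E) /\ N%:R%:E <= g x.

Lemma lsc_local_way_below f g : compact [set: X] -> lsc_local_below f g ->
  f \ll g.
Proof.
move=> /compact_near_coveringP cX fg z zle s zs /lsc_leP gs.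
have : \forall n \near \oo, [set: X] `<=` (fun x => f x <= z n x).
  apply: cX => x _; have [N [fN Ng]] := fg x.
  have [n /lsc_near nz] := lsc_lub_ge zs (le_trans Ng (gs x)).
  exists ([set y | f y <= N%:R%:E] `&` [set y | N%:R%:E <= z n y],
          [set m | (n <= m)%N]).
    by split; [exact: filterI|exact: nbhs_infty_ge].
  move=> [y m] /= [[fy zy]] nm.
  apply: le_trans fy (le_trans zy _).
  by have /lsc_leP := zle _ _ nm; exact.
by move=> [n _ /(_ n (leqnn n)) h]; exists n; apply/lsc_leP => x; exact: h.
Qed.

Section Approximation.
Variable f : lsc_fun.

Let ap_pred (n : nat) (x : X) (k : nat) : Prop :=
  (k <= n)%N /\ exists2 e : R, (n.+1%:R^-1 < e)%R &
    forall y, ball x e y -> k%:R%:E <= f y.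

Let ap_set n x : set (\bar R) := [set k%:R%:E | k in ap_pred n x].

Let ap_set_extnat n x : ap_set n x `<=` extnat.
Proof. by move=> _ [k _ <-]; exact: extnat_nat. Qed.

Let ap_set_neq0 n x : ap_set n x !=set0.
Proof.
exists 0%:R%:E, 0%N => //; split=> //; exists (n.+1%:R^-1 + 1)%R.
  by rewrite ltrDl.
by move=> y _; exact/extnat_ge0/lsc_extnat.
Qed.

Let apP n x N : N%:R%:E <= ereal_sup (ap_set n x) <-> ap_pred n x N.
Proof.
split=> [/(extnat_sup_ge (@ap_set_extnat n x) (ap_set_neq0 n x))|h]; last first.
  by apply: ereal_sup_ubound; exists N.
move=> [_ [k [kn [e ne fe]] <-]]; rewrite lee_fin ler_nat => Nk.
split; first exact: leq_trans kn.
exists e => // y /fe; apply: le_trans.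
by rewrite lee_fin ler_nat.
Qed.

Let ap_near n N x : N%:R%:E <= ereal_sup (ap_set n x) ->
  \forall y \near x, N%:R%:E <= ereal_sup (ap_set n y).
Proof.
move=> /apP[Nn [e ne fe]]; pose d := ((e - n.+1%:R^-1) / 2)%R.
have d0 : (0 < d)%R by rewrite divr_gt0// subr_gt0.
near=> y; apply/apP; split=> //; exists (e - d)%R.
  by move: ne; rewrite /d; move: (n.+1%:R^-1)%R => a; lra.
move=> w yw; apply: fe; rewrite -[e](subrKC d).
apply: ball_triangle yw; near: y; exact: nbhsx_ballx.
Unshelve. all: by end_near. Qed.

Let ap n : lsc_fun :=
  lsc_make (fun x => extnat_sup (@ap_set_extnat n x) (ap_set_neq0 n x))
           (@ap_near n).

Lemma lsc_approx : exists z : nat -> lsc_fun,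
  (forall n, lsc_local_below (z n) (z n.+1)) /\ isLub (range z) f.
Proof.
exists ap; split=> [n x|]; last first.
  apply: isLub_lsc => [n|N x].
    apply/lsc_leP => x; apply: extnat_leP (lsc_extnat _ _) _ => N.
    move=> /apP[_ [e ne]]; apply.
    by apply: ballxx; apply: le_lt_trans ne.
  move=> /lsc_near/nbhs_ballP[e /= e0 fe].
  have [m em] := exists_nat_gt (e^-1)%R.
  pose k := maxn N m.
  exists k; apply/apP; split; first exact: leq_maxl.
  exists e => // ; rewrite invf_plt ?posrE//.
  by apply: lt_le_trans em _; rewrite ler_nat (leq_trans (leq_maxr N _))// ltnW.
have [N hN] : exists N : nat, ap n.+1 x = N%:R%:E.
  case: (lsc_extnat (ap n.+1) x) => [oo|//].
  have : n.+2%:R%:E <= ap n.+1 x by rewrite oo leey.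
  by move=> /apP[]; rewrite ltnn.
exists N; split; last by rewrite hN.
pose d := (n.+1%:R^-1 - n.+2%:R^-1 : R)%R.
have d0 : (0 < d)%R by rewrite subr_gt0 ltf_pV2 ?posrE// ltr_nat.
rewrite -hN; near=> y.
apply: extnat_leP (lsc_extnat _ _) _ => k /apP[kn [e ne fe]].
apply/apP; split; first exact: leqW.
exists (e - d)%R.
  by move: ne; rewrite /d; move: (n.+1%:R^-1)%R (n.+2%:R^-1)%R => a b; lra.
move=> w xw; apply: fe; rewrite -[e](subrKC d).
apply: ball_triangle xw; near: y.
apply: filterS (nbhsx_ballx x d d0) => y; exact: ball_sym.
Unshelve. all: by end_near. Qed.

End Approximation.

Lemma way_below_lsc_local f g : f \ll g -> lsc_local_below f g.
Proof.
move=> fg; have [z [zz zg]] := lsc_approx g.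
have zmono : nondecreasing_seq z.
  apply/nondecreasing_seqP => n; apply/lsc_leP => x.
  have [N [/nbhs_singleton zN]] := zz n x; exact: le_trans.
have [n /lsc_leP fz] := fg _ zmono _ zg (lexx _).
move=> x; have [N [zN Nz]] := zz n x; exists N; split.
  by apply: filterS zN => y; apply: le_trans.
apply: le_trans Nz _.
by have /lsc_leP := zg.1 (z n.+1) (ex_intro2 _ _ n.+1 I erefl); exact.
Qed.

Lemma lsc_ge0 f : (lsc_cst 0 <= f)%O.
Proof. by apply/lsc_leP => x; exact/extnat_ge0/lsc_extnat. Qed.

Lemma lsc_leD (f g f' g' : lsc_fun) : 
  (f <= g -> f' <= g' -> lsc_add f f' <= lsc_add g g')%O.
Proof.
by move=> /lsc_leP h /lsc_leP h'; apply/lsc_leP => x; apply: leeD.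
Qed.

Lemma lsc_O1 (z : nat -> lsc_fun) : nondecreasing_seq z ->
  exists s, isLub (range z) s.
Proof. by move=> _; exists (lsc_sup z); exact: lsc_sup_isLub. Qed.

Lemma lsc_O2 f : compact [set: X] -> exists z : nat -> lsc_fun,
  (forall n, z n \ll z n.+1) /\ isLub (range z) f.
Proof.
move=> cX; have [z [zz zf]] := lsc_approx f; exists z; split=> // n.
exact: lsc_local_way_below.
Qed.

Lemma lsc_O3 (f' f g' g : lsc_fun) : compact [set: X] ->
  f' \ll f -> g' \ll g -> lsc_add f' g' \ll lsc_add f g.
Proof.
move=> cX /way_below_lsc_local hf /way_below_lsc_local hg.
apply: lsc_local_way_below => // x.
have [N [fN Nf]] := hf x; have [M [gM Mg]] := hg x.
exists (N + M)%N; rewrite natrD EFinD; split; last exact: leeD.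
by near=> y; apply: leeD; near: y.
Unshelve. all: by end_near. Qed.

Lemma lsc_O4 (f g : nat -> lsc_fun) (s t : lsc_fun) :
  nondecreasing_seq f -> nondecreasing_seq g ->
  isLub (range f) s -> isLub (range g) t ->
  isLub (range (fun n => lsc_add (f n) (g n))) (lsc_add s t).
Proof.
move=> fm gm fs gt; apply: isLub_lsc => [n|N x].
  by apply: lsc_leD; [apply: fs.1|apply: gt.1]; exists n.
move=> /(extnat_split (lsc_extnat s x) (lsc_extnat t x)) [k [l [ks lt kl]]].
have [n kn] := lsc_lub_ge fs ks; have [m lm] := lsc_lub_ge gt lt.
exists (maxn n m); apply: (@le_trans _ _ (k%:R%:E + l%:R%:E)).
  by rewrite -EFinD -natrD lee_fin ler_nat.
apply: leeD.
  by apply: le_trans kn _; have /lsc_leP := fm _ _ (leq_maxl n m); exact.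
by apply: le_trans lm _; have /lsc_leP := gm _ _ (leq_maxr n m); exact.
Qed.

End LscFun.

(* [Lsc cX] is Lsc(X, {0, 1, ..., oo}) for X compact, [cX] being the proof of
   compactness on which axioms (O2) and (O3) rely. *)
Definition Lsc (R : realType) (X : pseudoMetricType R)
  (cX : compact [set: X]) : Type := lsc_fun X.

HB.instance Definition _ (R : realType) (X : pseudoMetricType R)
  (cX : compact [set: X]) := Order.POrder.on (Lsc cX).
HB.instance Definition _ (R : realType) (X : pseudoMetricType R)
    (cX : compact [set: X]) :=
  isCuSemigroup.Build (Lsc cX)
    (@lsc_addA _ X) (@lsc_addC _ X) (@lsc_add0 _ X) (@lsc_ge0 _ X) (@lsc_leD _ X) (@lsc_O1 _ X)
    (fun f => lsc_O2 f cX) (fun f' f g' g => @lsc_O3 _ X f' f g' g cX)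
    (@lsc_O4 _ X).

Section KP.
Variable R : realType.

Definition unit_interval : pseudoMetricType R := set_type (`[0, 1] : set R).

Lemma unit_interval_compact : compact [set: unit_interval].
Proof.
move=> F PF _; pose G : set_system R := [set A | F (set_val @^-1` A)].
have PG : ProperFilter G.
  split; first by rewrite /G /= preimage_set0; exact: filter_not_empty.
  split; first exact: filterT.
  - by move=> A B; exact: filterI.
  - by move=> A B AB; apply: filterS => x; exact: AB.
have GI : G `[0, 1]%classic.
  rewrite /G /=; apply: (@filterS _ F _ setT); last exact: filterT.
  by move=> x _; exact: (@set_valP _ `[0, 1]%classic x).
have [p [Ip Gp]] := @segment_compact R 0 1 G PG GI.
exists (exist _ p (mem_set Ip)); split => // A B FA [_ [[C oC <-]] Cp CB].
have GA : G (set_val @` A).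
  by rewrite /G /=; apply: (@filterS _ F _ A) => // x Ax; exists x.
have [|_ [[x Ax <-] Cx]] := Gp _ C GA; first exact: open_nbhs_nbhs.
by exists x; split => //; apply: CB.
Qed.

Definition LscI : cuType := Lsc unit_interval_compact.

Definition LscI1 : LscI := lsc_cst unit_interval 1.

Definition KP_hom (f : LscI -> LscI) : Prop :=
  order_embedding f /\ f LscI1 = LscI1.

Lemma KP_hom_cu f : KP_hom f -> cu_morphism f.
Proof. by case=> [[]]. Qed.

Lemma KP_hom_id : KP_hom id.
Proof. by do 2?split => //; exact: cu_morphism_id. Qed.

Lemma KP_hom_comp g f : KP_hom g -> KP_hom f -> KP_hom (g \o f).
Proof.
move=> [ge g1] [fe f1]; split; first exact: order_embedding_comp.
by rewrite /= f1.
Qed.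

Definition KP : subcategory := @Subcategory unit (fun=> LscI)
  (fun _ _ => KP_hom) (fun _ _ => KP_hom_cu) (fun=> KP_hom_id)
  (fun _ _ _ => KP_hom_comp).

End KP.

Section PseudoArc.
Context {R : realType} (X : metricType R).

Definition subcontinuum (A : set X) : Prop :=
  [/\ A !=set0, compact A & connected A].

Definition indecomposable (A : set X) : Prop :=
  forall B C, subcontinuum B -> subcontinuum C -> B `|` C = A -> B = A \/ C = A.

Definition hereditarily_indecomposable : Prop :=
  forall A, subcontinuum A -> indecomposable A.

(* Links of a chain meet exactly when their indices differ by at most one; in
   particular (i = j) they are nonempty. *)
Definition chain (n : nat) (U : 'I_n -> set X) : Prop :=
  forall i j, (U i `&` U j !=set0) <-> (i <= j.+1)%N /\ (j <= i.+1)%N.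

Definition chainable : Prop :=
  forall e : R, 0 < e -> exists (n : nat) (U : 'I_n -> set X),
    [/\ forall i, open (U i), \bigcup_i U i = setT, chain U &
        forall i x y, U i x -> U i y -> mdist x y < e].

Record pseudo_arc : Prop := PseudoArc {
  pseudo_arc_compact : compact [set: X];
  pseudo_arc_connected : connected [set: X];
  pseudo_arc_nondegenerate : exists x y : X, x <> y;
  pseudo_arc_indecomposable : hereditarily_indecomposable;
  pseudo_arc_chainable : chainable
}.

End PseudoArc.

(* Main.v *)
Require Import Defs.
From mathcomp Require Import all_boot all_order all_algebra.
From mathcomp Require Import all_classical all_reals all_analysis.
From mathcomp Require Import lra ring zify.

(* A unital Cu-morphism Lsc([0,1]) -> Lsc(X) is the pullback along a continuous
   map X -> [0,1], and it is an order-embedding exactly when the map is onto; the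
   finite-set comparison is uniform closeness of the maps. So the statement is
   about continuous surjections, and it reduces to a lifting property of P: for
   surjections r : P -> [0,1] and h : [0,1] -> [0,1] and e > 0 there is a
   surjection q : P -> [0,1] with |h o q - r| <= e.
   The lifting property holds because P is hereditarily indecomposable. If a < b,
   then P is a union of closed sets X0, X1, X2 containing {r <= a} in X0 and
   {r >= b} in X2, with X0, X2 disjoint, r close to b on X0 n X1 and close to a on
   X1 n X2; otherwise two components would overlap in a decomposable continuum.
   Hence r lifts through a fold of the interval, and, removing from a path the
   zigzags between successive turning points that are nearest to each other, every
   path is reached from a monotone one by such folds.
   As P is chainable, it has surjections onto [0,1] with arbitrarily small fibres.
   Lifting these along a Fraisse sequence and passing to the limit of the resulting
   approximately compatible maps gives compatible surjections that separate the
   points of P, whence Lsc(P) is the limit. The same construction, with bonding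
   maps obtained by factoring through small fibres, yields a Fraisse sequence. *)

Set Implicit Arguments.
Unset Strict Implicit.
Unset Printing Implicit Defensive.

Import Order.TTheory GRing.Theory Num.Theory.
Import numFieldNormedType.Exports.

Local Open Scope classical_set_scope.
Local Open Scope ring_scope.

(** * Quasi-components of compact spaces *)

(** The lift must be onto, but nothing forces a map that follows a path to reach the ends of the
    interval. So the path in the domain of [h] is a detour. It starts at a point over 0 and stops at
    a point over 1, so that its image under [h] runs between extreme values, as the removal of
    zigzags demands; on the way it visits 0 and 1 themselves. Removing zigzags also needs successive
    nodes a definite distance apart, whereas a fine subdivision brings them close together; an
    alternating perturbation on an enlarged scale reconciles the two. Small fibres cannot be
    prescribed directly along a given Fraisse sequence. Instead a map [r] with small fibres is
    lifted through an interval map [h], and the closeness of [h o q] to [r] makes the fibres of [q]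
    small as well. Exact compatibility is reached only in the limit, so each correction must stay
    small under all earlier composites; equicontinuity of these composites provides this. *)

Lemma disj_absurd T (A B : set T) x : A `&` B = set0 -> A x -> B x -> False.
Proof. by move=> AB Ax Bx; have : (A `&` B) x by []; rewrite AB. Qed.

Section QuasiComponents.
Variable T : topologicalType.
Implicit Types (A C D E F G K W : set T) (Q : set (set T)).

Lemma compact_directed_bigcap K Q : compact K -> Q !=set0 ->
  (forall D, Q D -> closed D) ->
  (forall D E, Q D -> Q E -> exists2 F, Q F & F `<=` D `&` E) ->
  (forall D, Q D -> K `&` D !=set0) ->
  exists2 p, K p & forall D, Q D -> D p.
Proof.
move=> cK [D0 QD0] Qcl Qdir QK.
pose FF := filter_from Q (fun D => K `&` D).
have PF : ProperFilter FF.
  apply: filter_from_proper; last by move=> D /QK.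
  apply: filter_from_filter; first by exists D0.
  move=> D E QD QE; have [F QF FDE] := Qdir _ _ QD QE.
  by exists F => // x [Kx /FDE[Dx Ex]].
have [|p [Kp clp]] := cK FF PF; first by exists D0 => // x [].
exists p => // D QD; have /closure_id -> := Qcl _ QD; move=> U Up.
have : FF D by exists D => // x [].
by move=> /clp /(_ Up).
Qed.

(** Clopenness relative to [K] is encoded as a partition of [K] into two closed sets of the ambient
    space, which avoids the subspace topology. *)
Definition clopen_in K D :=
  closed D /\ exists E, [/\ closed E, D `|` E = K & D `&` E = set0].

Lemma clopen_inI K D E : clopen_in K D -> clopen_in K E ->
  clopen_in K (D `&` E).
Proof.
move=> [cD [D' [cD' DK D0]]] [cE [E' [cE' EK E0]]]; split; first exact: closedI.
exists (D' `|` E'); split; first exact: closedU.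
- apply/seteqP; split=> x; last first.
    move=> Kx; have : (D `|` D') x by rewrite DK.
    have : (E `|` E') x by rewrite EK.
    by case=> ?; case=> ?; [left|right; left|right; right|right; left].
  move=> [[Dx _]|[]]; first by rewrite -DK; left.
    by rewrite -DK; right.
  by rewrite -EK; right.
- rewrite -subset0; move=> x [[Dx Ex] []] h.
    by rewrite -D0; split.
  by rewrite -E0; split.
Qed.

Lemma clopen_inT K : closed K -> clopen_in K K.
Proof.
move=> cK; split=> //; exists set0; split; first exact: closed0.
  by rewrite setU0.
by rewrite setI0.
Qed.

Hypothesis Thaus : hausdorff_space T.
Hypothesis Tcpt : compact [set: T].

Lemma closed_cpt A : closed A -> compact A.
Proof. by move=> cA; apply: (subclosed_compact cA Tcpt). Qed.

Lemma closed_shrink A B : closed A -> closed B -> A `&` B = set0 ->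
  exists W C, [/\ open W, closed C, A `<=` W, W `<=` C & C `&` B = set0].
Proof.
move=> cA cB AB.
have [] := @compact_normal T Thaus Tcpt A cA (~` B).
  apply/set_nbhsP; exists (~` B); split=> //; first exact: closed_openC.
  by move=> x Ax Bx; exact: (disj_absurd AB Ax Bx).
move=> V /set_nbhsP[W [oW AW WV]] clV.
exists W, (closure V); split=> //; first exact: closed_closure.
  by move=> x /WV; exact: subset_closure.
by rewrite -subset0; move=> x [/clV].
Qed.

(** In a compact Hausdorff space quasi-components are connected, so [C] is the intersection of all
    relatively clopen sets around [p]. If it missed [A], compactness would give one clopen set
    around [p] missing [A], and its complement would contain [A] but not [p]. *)
Lemma continuum_of_clopen K A p : closed K -> closed A -> K p -> A `<=` K ->
  (forall E, clopen_in K E -> A `<=` E -> E p) ->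
  exists C, [/\ C `<=` K, closed C, connected C, C p & C `&` A !=set0].
Proof.
move=> cK cA Kp AK pA.
pose Q := [set D | clopen_in K D /\ D p].
have Q0 : Q !=set0 by exists K; split=> //; exact: clopen_inT.
have Qcl D : Q D -> closed D by move=> [[]].
have Qdir D E : Q D -> Q E -> exists2 F, Q F & F `<=` D `&` E.
  move=> [QD Dp] [QE Ep]; exists (D `&` E) => //; split=> //.
  exact: clopen_inI.
pose C := \bigcap_(D in Q) D.
have cC : closed C by apply: closed_bigI.
exists C; split=> //.
- by apply: bigcap_inf; split=> //; exact: clopen_inT.
(* Fatten [F] to an open [W] with a closed envelope [B] that misses [G]. By compactness some clopen
   [D] around [p] avoids [B \ W], so [D] cut by [B] equals [D] cut by [W] and is again clopen; it
   contains [C] and misses [G]. *)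
- have key F G : closed F -> closed G -> F `&` G = set0 -> F `|` G = C ->
      F p -> G = set0.
    move=> cF cG FG FGC Fp.
    have [W [B [oW cB FO OB BG]]] := closed_shrink cF cG FG.
    have [D QD DB] : exists2 D, Q D & D `&` (B `\` W) = set0.
      apply: contrapT => H.
      have cBO : closed (B `\` W) by apply: closedI => //; exact: open_closedC.
      have [|q [Bq Oq] qQ] :=
          compact_directed_bigcap (closed_cpt cBO) Q0 Qcl Qdir.
        move=> D QD; rewrite setIC; apply/set0P/eqP => D0; apply: H.
        by exists D.
      have : C q by move=> D; exact: qQ.
      rewrite -FGC => -[/FO//|Gq].
      by have := disj_absurd BG Bq Gq.
    have QDB : Q (D `&` B).
      have [[cD [E [cE DE DE0]]] Dp] := QD.
      split; last by split=> //; apply/OB/FO.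
      split; first exact: closedI.
      exists (E `|` D `&` ~` W); split.
      + by apply: closedU => //; apply: closedI => //; exact: open_closedC.
      + apply/seteqP; split=> x; rewrite -DE.
          by move=> [[Dx _]|[Ex|[Dx _]]]; [left|right|left].
        move=> [Dx|Ex]; last by right; left.
        by have [Ox|Ox] := pselect (W x); [left; split=> //; exact: OB|right; right].
      + rewrite -subset0; move=> x [[Dx Bx] [Ex|[_ Ox]]].
          by rewrite -DE0.
        by rewrite -DB; split.
    rewrite -subset0; move=> x Gx; rewrite -BG; split=> //.
    have Cx : C x by rewrite -FGC; right.
    by have [] := Cx _ QDB.
  move=> B [b Bb] [W oW BO] [Z cZ BZ].
  have cB : closed B by rewrite BZ; exact: closedI.
  have cCO : closed (C `\` W) by apply: closedI => //; exact: open_closedC.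
  have B1 : B `&` (C `\` W) = set0.
    by rewrite -subset0 BO; move=> x [[_ Ox] [_ /(_ Ox)]].
  have B2 : B `|` C `\` W = C by rewrite BO setDE -setIUr setUv setIT.
  have Cp : C p by move=> D [].
  have : (B `|` C `\` W) p by rewrite B2.
  move=> [Bp|Op].
    by rewrite -B2 (key _ _ cB cCO B1 B2 Bp) setU0.
  have := key _ _ cCO cB; rewrite setIC setUC => /(_ B1 B2 Op) B0.
  by move: Bb; rewrite B0.
- by move=> D [].
- have cAc := closed_cpt cA.
  have [|q Aq qQ] := compact_directed_bigcap cAc Q0 Qcl Qdir; last first.
    by exists q; split=> // D; exact: qQ.
  move=> D [[cD [E [cE DE DE0]]] Dp]; apply/set0P/eqP => AD0.
  have : E p.
    apply: pA.
      by split=> //; exists D; split=> //; rewrite 1?setUC 1?setIC.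
    move=> a Aa; have := AK _ Aa; rewrite -DE => -[Da|//].
    by have := disj_absurd AD0 Aa Da.
  move=> Ep.
  exact: (disj_absurd DE0 Dp Ep).
Qed.

End QuasiComponents.

(** * Chains following a path in a hereditarily indecomposable space *)

Section Crooked.
Context {R : realType} (X : metricType R).
Hypothesis Xcpt : compact [set: X].
Hypothesis XHI : @hereditarily_indecomposable R X.
Variable f : X -> R.
Hypothesis fcont : continuous f.
Implicit Types (Y C D E : set X) (a b : R).

Lemma closed_le_fun a : closed [set x | f x <= a].
Proof.
by apply: (closed_comp (D:=[set y | y <= a])) => [x _|]; [exact: fcont|exact: closed_le].
Qed.

Lemma closed_ge_fun a : closed [set x | a <= f x].
Proof.
by apply: (closed_comp (D:=[set y | a <= y])) => [x _|]; [exact: fcont|exact: closed_ge].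
Qed.

(* A continuum in {f <= b'} through {f <= a} and a continuum in {a' <= f}
   through {b <= f} cannot meet: their union would be decomposable. *)
Lemma crooked_clopen Y a a' b' b : closed Y -> a < a' -> b' < b ->
  exists C D, [/\ clopen_in (Y `&` [set x | f x <= b']) C,
    clopen_in (Y `&` [set x | a' <= f x]) D,
    Y `&` [set x | f x <= a] `&` [set x | f x <= b'] `<=` C,
    Y `&` [set x | b <= f x] `&` [set x | a' <= f x] `<=` D & C `&` D = set0].
Proof.
move=> cY aa' b'b; apply: contrapT => H.
set KC := Y `&` [set x | f x <= b'].
set KD := Y `&` [set x | a' <= f x].
set A := Y `&` [set x | f x <= a] `&` [set x | f x <= b'].
set B := Y `&` [set x | b <= f x] `&` [set x | a' <= f x].
have cKC : closed KC by apply: closedI => //; exact: closed_le_fun.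
have cKD : closed KD by apply: closedI => //; exact: closed_ge_fun.
have cA : closed A by apply: closedI; [apply: closedI|] => //; exact: closed_le_fun.
have cB : closed B by apply: closedI; [apply: closedI|] => //; exact: closed_ge_fun.
have AK : A `<=` KC by move=> x [[]].
have BK : B `<=` KD by move=> x [[]].
pose QC C := clopen_in KC C /\ A `<=` C.
pose QD D := clopen_in KD D /\ B `<=` D.
pose Q := [set E | exists C D, [/\ QC C, QD D & E = C `&` D]].
have QCT : QC KC by split=> //; exact: clopen_inT.
have QDT : QD KD by split=> //; exact: clopen_inT.
(* If no disjoint pair exists, the intersections of the candidates for [C] and [D] are nonempty and
   directed. A common point [p] cannot be separated from [A] inside [KC] nor from [B] inside [KD],
   so it lies in both of the overlapping continua. *)
have [| | | |p _ pQ] := @compact_directed_bigcap X setT Q Xcpt.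
- by exists (KC `&` KD), KC, KD.
- by move=> E [C [D [[[cC _] _] [[cD _] _] ->]]]; exact: closedI.
- move=> _ _ [C [D [[CK AC] [DK BD] ->]]] [C' [D' [[CK' AC'] [DK' BD'] ->]]].
  exists ((C `&` C') `&` (D `&` D')).
    exists (C `&` C'), (D `&` D'); split=> //; split.
    + exact: clopen_inI.
    + by move=> x Ax; split; [exact: AC|exact: AC'].
    + exact: clopen_inI.
    + by move=> x Bx; split; [exact: BD|exact: BD'].
  by move=> x [[? ?] [? ?]].
- move=> _ [C [D [[CK AC] [DK BD] ->]]]; rewrite setTI.
  by apply/set0P/eqP => CD; apply: H; exists C, D; split.
have pK : KC p /\ KD p by apply: (pQ (KC `&` KD)); exists KC, KD.
have [|C [CK cC Cc Cp [x [Cx Ax]]]] :=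
    @continuum_of_clopen X (@metric_hausdorff _ X) Xcpt KC A p cKC cA pK.1 AK.
  move=> E EK AE.
  by have [] : (E `&` KD) p by apply: (pQ (E `&` KD)); exists E, KD.
have [|D [DK cD Dc Dp [y [Dy By]]]] :=
    @continuum_of_clopen X (@metric_hausdorff _ X) Xcpt KD B p cKD cB pK.2 BK.
  move=> E EK AE.
  by have [] : (KC `&` E) p by apply: (pQ (KC `&` E)); exists KC, E.
have sC : subcontinuum C by split=> //; [exists p|exact: closed_cpt].
have sD : subcontinuum D by split=> //; [exists p|exact: closed_cpt].
have sCD : subcontinuum (C `|` D).
  split; [by exists p; left|by apply: closed_cpt => //; exact: closedU|].
  by apply: connectedU => //; exists p.
have [CE|DE] := XHI sCD sC sD erefl.
  have /CK[_ /=] : C y by rewrite CE; right.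
  by have [[_ /= by_] _] := By; move: by_ b'b; lra.
have /DK[_ /=] : D x by rewrite DE; left.
by have [[_ /= xa] _] := Ax; move: xa aa'; lra.
Qed.

(** [X0] and [X2] are disjoint closed fattenings of the clopen sets [C] and [D], and [X1] is what
    remains outside their open cores. A point of [X0] and [X1] lies in the collar around [C], which
    misses both [C] and its complement in [{f <= b'}]; hence [f] exceeds [b'] there. The collar
    around [D] is treated in the same way. *)
Lemma crooked_split Y a a' b' b : closed Y -> a < a' -> a' <= b' -> b' < b ->
  exists X0 X1 X2, [/\ [/\ closed X0, closed X1 & closed X2],
    X0 `|` X1 `|` X2 = Y,
    [/\ Y `&` [set x | f x <= a] `<=` X0, Y `&` [set x | b <= f x] `<=` X2 &
       X0 `&` X2 = set0],
    X0 `&` X1 `<=` [set x | b' < f x] & X1 `&` X2 `<=` [set x | f x < a']].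
Proof.
move=> cY aa' ab b'b.
have [C [D [[cC [C' [cC' CK C0]]] [cD [D' [cD' DK D0]]] AC BD CD]]] :=
  crooked_clopen cY aa' b'b.
have Xh := @metric_hausdorff _ X.
have [|||U0 [Z0 [oU cZ CU UZ ZC']]] := @closed_shrink X Xh Xcpt C (C' `|` D).

- by [].
- exact: closedU.
- by rewrite setIUr C0 CD setU0.
have [|||U2 [Z2 [oU2 cZ2 DU2 UZ2 ZD']]] := @closed_shrink X Xh Xcpt D (D' `|` Z0).

- by [].
- exact: closedU.
- rewrite setIUr D0 set0U -subset0; move=> x [Dx Zx].
  by apply: (disj_absurd ZC' Zx); right.
exists (Y `&` Z0), (Y `\` (U0 `|` U2)), (Y `&` Z2); split.
- split; [exact: closedI| |exact: closedI].
  by apply: closedI => //; apply: open_closedC; exact: openU.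
- apply/seteqP; split=> x; first by move=> [[[]|[]]|[]].
  move=> Yx; have [U0x|U0x] := pselect (U0 x).
    by left; left; split=> //; exact: UZ.
  have [U2x|U2x] := pselect (U2 x); first by right; split=> //; exact: UZ2.
  by left; right; split=> // -[].
- split.
  + move=> x [Yx /= xa]; split=> //; apply/UZ/CU/AC; split; first by split.
    by move=> /=; lra.
  + move=> x [Yx /= xb]; split=> //; apply/UZ2/DU2/BD; split; first by split.
    by move=> /=; lra.
  + rewrite -subset0; move=> x [[_ Z0x] [_ Z2x]].
    by apply: (disj_absurd ZD' Z2x); right.
- move=> x [[Yx Zx] [_ Ux]] /=; rewrite ltNge; apply/negP => xb.
  have : (C `|` C') x by rewrite CK.
  move=> [/CU ?|C'x]; first by apply: Ux; left.
  by apply: (disj_absurd ZC' Zx); left.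
- move=> x [[_ Ux] [Yx Zx]] /=; rewrite ltNge; apply/negP => xb.
  have : (D `|` D') x by rewrite DK.
  move=> [/DU2 ?|C'x]; first by apply: Ux; right.
  by apply: (disj_absurd ZD' Zx); left.
Qed.

End Crooked.

(** * Chains of closed links along a path, and their splicing *)

Section LinkChains.
Context {R : realType} (X : metricType R).
Variable f : X -> R.
Implicit Types (Y : set X) (L Z : nat -> set X) (v w : nat -> R) (e d : R).

Definition between (p q e t : R) : Prop :=
  (p - e < t /\ t < q + e) \/ (q - e < t /\ t < p + e).

(* Along the link L i the function f runs from v i to v i.+1. The last two
   clauses let a chain be inserted in place of a single link. *)
Record link_chain Y (k : nat) v e d L : Prop := LinkChain {
  link_closed : forall i, (i < k)%N -> closed (L i);
  link_sub : forall i, (i < k)%N -> L i `<=` Y;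
  link_cover : forall x, Y x -> exists2 i, (i < k)%N & L i x;
  link_disjoint : forall i j x, (i.+1 < j)%N -> (j < k)%N -> L i x -> ~ L j x;
  link_node : forall i x, (i.+1 < k)%N -> L i x -> L i.+1 x ->
    `|f x - v i.+1| < e;
  link_between : forall i x, (i < k)%N -> L i x -> between (v i) (v i.+1) e (f x);
  link_first : forall x, Y x -> `|f x - v 0%N| <= d ->
    L 0%N x /\ forall i, (0 < i < k)%N -> ~ L i x;
  link_last : forall x, Y x -> `|f x - v k| <= d ->
    L k.-1 x /\ forall i, (i < k.-1)%N -> ~ L i x
}.

(** One link becomes [n], hence the index shift by [n.-1]. The previous link meets [L i] only where
    [f] is within [e / 2] of the starting node, and the end clauses of [Z], with the same margin
    [e / 2], put such points in the first link of [Z] alone; likewise at the other end. This is why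
    the outer chain needs the finer precision [e / 2]. *)
Lemma link_chain_splice Y k n i v' v e d L Z : (i < k)%N -> (0 < n)%N -> 
  0 < e -> d <= e / 2 ->
  (forall j, (j <= i)%N -> v j = v' j) ->
  (forall j, (i < j <= k)%N -> v (j + n.-1)%N = v' j) ->
  link_chain Y k v' (e / 2) d L ->
  link_chain (L i) n (fun j => v (i + j)%N) e (e / 2) Z ->
  exists L', link_chain Y (k + n.-1) v e d L'.
Proof.
move=> ik n0 e0 de vlo vhi [Lc Ls Lcov Ld Ln Lb Lf Ll] [Zc Zs Zcov Zd Zn Zb Zf Zl].
have vi : v i = v' i by apply: vlo.
have vin : v (i + n)%N = v' i.+1.
  by rewrite -vhi; [congr (v _); lia|lia].
pose L' j := if (j < i)%N then L j else
  if (j < i + n)%N then Z (j - i)%N else L (j - n.-1)%N.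
have lo j : (j < i)%N -> L' j = L j by move=> h; rewrite /L' h.
have mid j : (j < n)%N -> L' (i + j)%N = Z j.
  move=> h; rewrite /L' ltnNge leq_addr/= ltn_add2l h; congr Z; lia.
have hi j : (i < j)%N -> L' (j + n.-1)%N = L j.
  move=> h; rewrite /L'; case: ifPn => [|_]; first lia.
  by case: ifPn => [|_]; [lia|congr L; lia].
have cases j : (j < k + n.-1)%N -> [\/ (j < i)%N,
    exists2 m, (m < n)%N & j = (i + m)%N |
    exists2 m, (i < m < k)%N & j = (m + n.-1)%N].
  move=> jk; have [ji|ij] := ltnP j i; first by constructor 1.
  have [jn|nj] := ltnP j (i + n).
    by constructor 2; exists (j - i)%N; lia.
  by constructor 3; exists (j - n.-1)%N; lia.
exists L'; split.
- move=> j /cases[ji|[m mn ->]|[m /andP[im mk] ->]].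
  + by rewrite lo//; apply: Lc; lia.
  + by rewrite mid//; exact: Zc.
  + by rewrite hi//; exact: Lc.
- move=> j /cases[ji|[m mn ->]|[m /andP[im mk] ->]].
  + by rewrite lo//; apply: Ls; lia.
  + by rewrite mid//; apply: subset_trans (Zs _ mn) _; exact: Ls.
  + by rewrite hi//; exact: Ls.
- move=> x /Lcov[j jk Ljx]; have [ji|ij|ji] := ltngtP j i.
  + by exists j; [lia|rewrite lo].
  + by exists (j + n.-1)%N; [lia|rewrite hi].
  + move: Ljx; rewrite ji => /Zcov[m mn Zmx].
    by exists (i + m)%N; [lia|rewrite mid].
- move=> j j' x jj' j'k; have jk : (j < k + n.-1)%N by lia.
  case: (cases _ jk) (cases _ j'k) =>
    [ji|[m mn jE]|[m /andP[im mk] jE]] [j'i|[m' m'n j'E]|[m' /andP[im' m'k] j'E]];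
    try lia; rewrite ?jE ?j'E.
  + by rewrite !lo//; apply: Ld => //; lia.
  + rewrite lo// mid// => Lx Zx; have Lix := Zs _ m'n _ Zx.
    have [ji1|ji1] := ltnP j.+1 i; first exact: (Ld _ _ _ ji1 ik Lx Lix).
    have ji2 : i = j.+1 by lia.
    have := Ln j x; rewrite -ji2 => /(_ ik Lx Lix) fx.
    have [|_ Zx'] := Zf x Lix; first by rewrite addn0 vi; move: fx; lra.
    by apply: (Zx' m') => //; lia.
  + by rewrite lo// hi//; apply: Ld; lia.
  + by rewrite !mid//; apply: Zd; lia.
  + rewrite mid// hi// => Zx Lx; have Lix := Zs _ mn _ Zx.
    have [ji1|ji1] := ltnP i.+1 m'; first exact: (Ld _ _ _ ji1 m'k Lix Lx).
    have ji2 : m' = i.+1 by lia.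
    have := Ln i x; rewrite -ji2 => /(_ m'k Lix Lx) fx.
    have [|_ Zx'] := Zl x Lix; first by rewrite vin -ji2; move: fx; lra.
    by apply: (Zx' m) => //; lia.
  + by rewrite !hi//; apply: Ld; lia.
- move=> j x j'k; have jk : (j < k + n.-1)%N by lia.
  case: (cases _ jk) (cases _ j'k) =>
    [ji|[m mn jE]|[m /andP[im mk] jE]] [j'i|[m' m'n j'E]|[m' /andP[im' m'k] j'E]];
    try lia.
  + rewrite !lo// => Lx L'x; rewrite vlo; last lia.
    have := Ln _ _ (ltn_trans j'i ik) Lx L'x; lra.
  + have m0 : m' = 0%N by lia.
    rewrite j'E m0 lo// mid// => Lx /(Zs _ n0) L'x; rewrite addn0 vi.
    have ji1 : i = j.+1 by lia.
    by move: L'x; rewrite ji1 => L'x; have := Ln _ _ _ Lx L'x; rewrite -ji1 => /(_ ik); lra.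
  + have m0 : m' = m.+1 by lia.
    rewrite j'E m0 jE !mid//; last lia.
    by move=> Zx Z'x; apply: Zn => //; lia.
  + have m0 : m' = i.+1 by lia.
    rewrite j'E jE mid// hi// => /(Zs _ mn) Lx L'x.
    have -> : (m' + n.-1 = i + n)%N by lia.
    rewrite vin; move: L'x; rewrite m0 => L'x; have := Ln _ _ _ Lx L'x.
    by rewrite -m0 => /(_ m'k); lra.
  + have m0 : m' = m.+1 by lia.
    rewrite j'E jE !hi// => Lx; rewrite m0 => L'x.
    have -> : (m.+1 + n.-1)%N = (m' + n.-1)%N by lia.
    rewrite vhi; last lia.
    by have := Ln _ _ _ Lx L'x; rewrite -m0 => /(_ m'k); lra.
- have weak p q t : between p q (e / 2) t -> between p q e t.
    by move=> [] []; [left|right]; split; lra.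
  move=> j x /cases[ji|[m mn ->]|[m /andP[im mk] ->]].
  + rewrite lo// => Lx; rewrite !vlo//; last lia.
    by apply/weak/Lb => //; lia.
  + by rewrite mid// -addnS; exact: Zb.
  + rewrite hi// -addSn !vhi; [|lia|lia].
    by move=> Lx; apply/weak/Lb.
- move=> x Yx; rewrite vlo// => fx; have [Lx L'x] := Lf x Yx fx.
  have [i0|i0] := posnP i.
    have Lix : L i x by rewrite i0.
    have [Zx Z'x] : Z 0%N x /\ forall j, (0 < j < n)%N -> ~ Z j x.
      by apply: Zf => //; rewrite addn0 vi i0; move: fx; lra.
    split; first by rewrite -[0%N]addn0 -{1}i0 mid.
    move=> j /andP[j0] /cases[ji|[m mn jE]|[m /andP[im mk] jE]]; first lia.
      by rewrite jE mid//; apply: Z'x; lia.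
    by rewrite jE hi//; apply: L'x; lia.
  split; first by rewrite lo.
  move=> j /andP[j0] /cases[ji|[m mn jE]|[m /andP[im mk] jE]].
  + by rewrite lo//; apply: L'x; lia.
  + rewrite jE mid// => /(Zs _ mn); apply: L'x; lia.
  + by rewrite jE hi//; apply: L'x; lia.
- move=> x Yx; rewrite vhi; last lia.
  move=> fx; have [Lx L'x] := Ll x Yx fx.
  have [ki|ki] := eqVneq k i.+1.
    have Lix : L i x by move: Lx; rewrite ki.
    have [Zx Z'x] : Z n.-1 x /\ forall j, (j < n.-1)%N -> ~ Z j x.
      by apply: Zl => //; rewrite vin -ki; move: fx; lra.
    split.
      have -> : (k + n.-1).-1 = (i + n.-1)%N by lia.
      by rewrite mid//; lia.
    move=> j jk; have /cases[ji|[m mn jE]|[m /andP[im mk] jE]] : (j < k + n.-1)%N by lia.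
    + by rewrite lo//; apply: L'x; lia.
    + by rewrite jE mid//; apply: Z'x; lia.
    + lia.
  split.
    have -> : (k + n.-1).-1 = (k.-1 + n.-1)%N by lia.
    by rewrite hi//; lia.
  move=> j jk; have /cases[ji|[m mn jE]|[m /andP[im mk] jE]] : (j < k + n.-1)%N by lia.
  + by rewrite lo//; apply: L'x; lia.
  + rewrite jE mid// => /(Zs _ mn); apply: L'x; lia.
  + by rewrite jE hi//; apply: L'x; lia.
Qed.

End LinkChains.

(** * Paths with separated nodes: where a node or a zigzag can be removed *)

Lemma norm_cases (R : realType) (x : R) :
  (0 <= x /\ `|x| = x) \/ (x <= 0 /\ `|x| = - x).
Proof.
by case: (leP 0 x) => h; [left; rewrite ger0_norm|right; rewrite ler0_norm// ltW].
Qed.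

Definition monotone3 (R : realType) (p q r : R) :=
  (p + 1 <= q /\ q + 1 <= r) \/ (q + 1 <= p /\ r + 1 <= q).

(** The middle stroke from [q] back to [r] stays within the range from [p] to [s], so deleting [q]
    and [r] leaves a single stroke covering the other three. *)
Definition zigzag4 (R : realType) (p q r s : R) :=
  [/\ p <= r, r + 1 <= q & q <= s] \/ [/\ r <= p, q + 1 <= r & s <= q].

(** Without a monotone triple the three strokes alternate in direction. As the middle one is no
    longer than the first, a last stroke at least as long as the middle one completes a zigzag. *)
Lemma gap_decreases (R : realType) (p q r s : R) :
  1 <= `|q - p| -> 1 <= `|r - q| -> 1 <= `|s - r| -> `|r - q| <= `|q - p| ->
  [\/ monotone3 p q r, monotone3 q r s, zigzag4 p q r s | `|s - r| < `|r - q| ].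
Proof.
rewrite /monotone3 /zigzag4.
case: (norm_cases (q - p)) => -[? ->]; case: (norm_cases (r - q)) => -[? ->];
  case: (norm_cases (s - r)) => -[? ->] ? ? ? ?.
- by constructor 1; left; lra.
- by constructor 1; left; lra.
- have [|?] := ltP (s - r) (- (r - q)); first by constructor 4.
  by constructor 3; left; split; lra.
- by constructor 2; right; lra.
- by constructor 2; left; lra.
- have [|?] := ltP (- (s - r)) (r - q); first by constructor 4.
  by constructor 3; right; split; lra.
- by constructor 1; right; lra.
- by constructor 1; right; lra.
Qed.

(* Otherwise the gaps of v would strictly decrease after the first one, which
   contradicts that v k is the maximum. *)
Lemma reducible_spot (R : realType) (k : nat) (v : nat -> R) : (1 < k)%N ->
  (forall i, (i <= k)%N -> v 0%N <= v i /\ v i <= v k) ->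
  (forall i, (i < k)%N -> 1 <= `|v i.+1 - v i|) ->
  (exists2 i, (i.+1 < k)%N & monotone3 (v i) (v i.+1) (v i.+2)) \/
  (exists2 i, (i.+2 < k)%N & zigzag4 (v i) (v i.+1) (v i.+2) (v i.+3)).
Proof.
move=> k1 vk gap; apply: contrapT => /not_orP[no3 no4].
have nmono i : (i.+1 < k)%N -> ~ monotone3 (v i) (v i.+1) (v i.+2).
  by move=> ik h; apply: no3; exists i.
have nzig i : (i.+2 < k)%N -> ~ zigzag4 (v i) (v i.+1) (v i.+2) (v i.+3).
  by move=> ik h; apply: no4; exists i.
have turn (p q r : R) : p <= q -> 1 <= `|q - p| -> 1 <= `|r - q| -> q <= r -> monotone3 p q r.
  by move=> pq + + qr; rewrite !ger0_norm ?subr_ge0// => ? ?; left; lra.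
(* The base case uses that [v 0] is the minimum: the path first rises, and if it then falls, it
   cannot fall further than it rose. *)
have dec i : (i.+1 < k)%N -> `|v i.+2 - v i.+1| <= `|v i.+1 - v i|.
  elim: i => [|i IH] ik.
    have [b1 _] := vk 1%N (ltnW ik); have [b2 _] := vk 2%N ik.
    have [qr|rq] := leP (v 1%N) (v 2%N).
      by have := nmono _ ik (turn _ _ _ b1 (gap _ (ltnW ik)) (gap _ ik) qr).
    by rewrite ltr0_norm ?subr_lt0// ger0_norm ?subr_ge0//; lra.
  have ik1 := ltnW ik; have ik2 := ltnW ik1.
  have := gap_decreases (gap _ ik2) (gap _ ik1) (gap _ ik) (IH ik1).
  by case=> [/(nmono _ ik1)|/(nmono _ ik)|/(nzig _ ik)|/ltW].
have [k3|k3] := ltnP 2 k; last first.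
  have kE : k = 2%N by lia.
  subst k; have [b _] := vk 1%N isT; have [_ c] := vk 1%N isT.
  by have := nmono 0%N isT (turn _ _ _ b (gap 0%N isT) (gap 1%N isT) c).
have [m kE] : exists m, k = m.+3 by exists (k - 3)%N; lia.
subst k; have l2 := ltnSn m.+2; have l1 := ltnW l2; have l0 := ltnW l1.
have [_ c1] := vk m.+1 l0; have [_ c2] := vk m.+2 l1.
have := gap_decreases (gap _ l0) (gap _ l1) (gap _ l2) (dec _ l1).
case=> [/(nmono _ l1)|/(nmono _ l2)|/(nzig _ l2)|] //.
have [qr|rq] := leP (v m.+1) (v m.+2).
  by have := nmono _ l2 (turn _ _ _ qr (gap _ l1) (gap _ l2) c2).
by rewrite [in X in _ < X]ltr0_norm ?subr_lt0// ger0_norm ?subr_ge0//; lra.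
Qed.

(** * Chains along an arbitrary path with extreme ends *)

Section Pattern.
Context {R : realType} (X : metricType R).
Hypothesis Xcpt : compact [set: X].
Hypothesis XHI : @hereditarily_indecomposable R X.
Variable f : X -> R.
Hypothesis fcont : continuous f.
Implicit Types (Y : set X) (L Z : nat -> set X) (v w : nat -> R) (e d : R).

(** No indecomposability is involved: the two links are the parts of [Y] on either side of the level
    [v 1], which is at distance at least 1 from both end nodes. *)
Lemma link_chain_monotone Y v e : closed Y -> 0 < e <= 1/4 ->
  (forall x, Y x -> between (v 0%N) (v 2%N) (e / 2) (f x)) ->
  (v 0%N + 1 <= v 1%N /\ v 1%N + 1 <= v 2%N) \/
  (v 1%N + 1 <= v 0%N /\ v 2%N + 1 <= v 1%N) ->
  exists Z, link_chain f Y 2 v e (e / 2) Z.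
Proof.
move=> cY e0 Yb vv.
wlog Hv : v Yb vv / v 0%N + 1 <= v 1%N /\ v 1%N + 1 <= v 2%N.
  move=> H; case: vv => vv; first by apply: H => //; left.
  pose Z i := Y `&` (if i is 0%N then [set x | v 1%N <= f x] else [set x | f x <= v 1%N]).
  exists Z; split.
  - by move=> [|i] _; apply: closedI => //; [exact: closed_ge_fun|exact: closed_le_fun].
  - by move=> i _ x [].
  - move=> x Yx; have [?|?] := leP (v 1%N) (f x); first by exists 0%N.
    by exists 1%N => //; split=> //=; apply: ltW.
  - by move=> i j x ? ?; lia.
  - move=> [|i] x // _ [_ /= h1] [_ /= h2]; rewrite ltr_norml; lra.
  - by move=> [|[|i]] x // _ [/Yb []] [? ?] /= ?; rewrite /between; lra.
  - move=> x Yx; rewrite ler_norml => fx; split; first by split=> //=; lra.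
    move=> [|[|i]] // _ [_ /= ?]; lra.
  - move=> x Yx; rewrite ler_norml => fx; split; first by split=> //=; lra.
    move=> [|[|i]] // _ [_ /= ?]; lra.
pose Z i := Y `&` (if i is 0%N then [set x | f x <= v 1%N] else [set x | v 1%N <= f x]).
exists Z; split.
- by move=> [|i] _; apply: closedI => //; [exact: closed_le_fun|exact: closed_ge_fun].
- by move=> i _ x [].
- move=> x Yx; have [?|?] := leP (v 1%N) (f x); first by exists 1%N.
  by exists 0%N => //; split=> //=; apply: ltW.
- by move=> i j x ? ?; lia.
- move=> [|i] x // _ [_ /= h1] [_ /= h2]; rewrite ltr_norml; lra.
- by move=> [|[|i]] x // _ [/Yb []] [? ?] /= ?; rewrite /between; lra.
- move=> x Yx; rewrite ler_norml => fx; split; first by split=> //=; lra.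
  move=> [|[|i]] // _ [_ /= ?]; lra.
- move=> x Yx; rewrite ler_norml => fx; split; first by split=> //=; lra.
  move=> [|[|i]] // _ [_ /= ?]; lra.
Qed.

(** With [a < b] the two turning values, [crooked_split] is applied slightly inside [[a, b]]: [X0]
    and [X1] meet only near [b], and [X1] and [X2] only near [a], as the three strokes require. The
    inner margin [e / 2] yields the end clauses. A descending zigzag is the same partition read
    backwards. *)
Lemma link_chain_zigzag Y v e : closed Y -> 0 < e <= 1/4 ->
  (forall x, Y x -> between (v 0%N) (v 3%N) (e / 2) (f x)) ->
  [/\ v 0%N <= v 2%N, v 2%N + 1 <= v 1%N & v 1%N <= v 3%N] \/
  [/\ v 2%N <= v 0%N, v 1%N + 1 <= v 2%N & v 3%N <= v 1%N] ->
  exists Z, link_chain f Y 3 v e (e / 2) Z.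
Proof.
move=> cY e0 Yb vv.
have [a [b [ab vab]]] : exists a b, a + 1 <= b /\
    ([/\ v 0%N <= a, b <= v 3%N, a = v 2%N & b = v 1%N] \/
     [/\ b <= v 0%N, v 3%N <= a, a = v 1%N & b = v 2%N]).
  by case: vv => -[? ? ?]; [exists (v 2%N), (v 1%N)|exists (v 1%N), (v 2%N)];
    split=> //; [left|right].
have [|||X0 [X1 [X2 [[c0 c1 c2] XY [A0 B2 X02] X01 X12]]]] :=
  @crooked_split R X Xcpt XHI f fcont Y (a + e/2) (a + e) (b - e) (b - e / 2) cY.
- lra.
- lra.
- lra.
have XY' x : (X0 x \/ X1 x) \/ X2 x -> Y x by rewrite -XY.
have A0' x : Y x -> f x <= a + e/2 -> X0 x by move=> ? ?; apply: A0.
have B2' x : Y x -> b - e/2 <= f x -> X2 x by move=> ? ?; apply: B2.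
have X02' x : X0 x -> ~ X2 x by move=> h0 h2; exact: (disj_absurd X02 h0 h2).
have X01' x : X0 x -> X1 x -> b - e < f x by move=> ? ?; apply: X01.
have X12' x : X1 x -> X2 x -> f x < a + e by move=> ? ?; apply: X12.
have f0 x : X0 x -> f x < b - e/2.
  move=> X0x; rewrite ltNge; apply/negP => /B2' h; apply: (X02' x) => //.
  by apply: h; apply: XY'; left; left.
have f2 x : X2 x -> a + e/2 < f x.
  move=> X2x; rewrite ltNge; apply/negP => /A0' h; apply: (X02' x) => //.
  by apply: h; apply: XY'; right.
have f1 x : X1 x -> a + e/2 < f x /\ f x < b - e / 2.
  move=> X1x; have Yx : Y x by apply: XY'; left; right.
  split; rewrite ltNge; apply/negP => h.
    by have := X01' _ (A0' _ Yx h) X1x; lra.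
  by have := X12' _ X1x (B2' _ Yx h); lra.
have XYc x : Y x -> [\/ X0 x, X1 x | X2 x].
  by rewrite -XY => -[[]|]; [constructor 1|constructor 2|constructor 3].
case: vab => -[v02 v13 aE bE].
- exists (fun i => match i with 0%N => X0 | 1%N => X1 | _ => X2 end); split.
  + by move=> [|[|i]].
  + by move=> [|[|i]] _ x h; apply: XY'; [left; left|left; right|right].
  + by move=> x /XYc[]; [exists 0%N|exists 1%N|exists 2%N].
  + by move=> [|i] [|[|[|j]]] x //= ij j3; try lia; exact: X02'.
  + move=> [|[|i]] x // _.
      by move=> h h'; rewrite ltr_norml; have := X01' _ h h'; have := f0 _ h; lra.
    by move=> h h'; rewrite ltr_norml; have := X12' _ h h'; have := f2 _ h'; lra.
  + move=> [|[|[|i]]] x // _ h.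
    - by have := f0 _ h; have := Yb x (XY' x (or_introl (or_introl h))); rewrite /between; lra.
    - by have := f1 _ h; have := Yb x (XY' x (or_introl (or_intror h))); rewrite /between; lra.
    - by have := f2 _ h; have := Yb x (XY' x (or_intror h)); rewrite /between; lra.
  + move=> x Yx; rewrite ler_norml => fx; have X0x : X0 x by apply: A0' => //; lra.
    split=> // -[|[|[|i]]] // _ h; first by have := X01' _ X0x h; lra.
    exact: (X02' x).
  + move=> x Yx; rewrite ler_norml => fx; have X2x : X2 x by apply: B2' => //; lra.
    split=> // -[|[|[|i]]] // _ h; first exact: (X02' x).
    by have := X12' _ h X2x; lra.
- exists (fun i => match i with 0%N => X2 | 1%N => X1 | _ => X0 end); split.
  + by move=> [|[|i]].
  + by move=> [|[|i]] _ x h; apply: XY'; [right|left; right|left; left].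
  + by move=> x /XYc[]; [exists 2%N|exists 1%N|exists 0%N].
  + by move=> [|i] [|[|[|j]]] x //= ij j3; try lia; move=> h h'; exact: (X02' x).
  + move=> [|[|i]] x // _.
      by move=> h h'; rewrite ltr_norml; have := X12' _ h' h; have := f2 _ h; lra.
    by move=> h h'; rewrite ltr_norml; have := X01' _ h' h; have := f0 _ h'; lra.
  + move=> [|[|[|i]]] x // _ h.
    - by have := f2 _ h; have := Yb x (XY' x (or_intror h)); rewrite /between; lra.
    - by have := f1 _ h; have := Yb x (XY' x (or_introl (or_intror h))); rewrite /between; lra.
    - by have := f0 _ h; have := Yb x (XY' x (or_introl (or_introl h))); rewrite /between; lra.
  + move=> x Yx; rewrite ler_norml => fx; have X2x : X2 x by apply: B2' => //; lra.
    split=> // -[|[|[|i]]] // _ h; first by have := X12' _ h X2x; lra.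
    exact: (X02' x).
  + move=> x Yx; rewrite ler_norml => fx; have X0x : X0 x by apply: A0' => //; lra.
    split=> // -[|[|[|i]]] // _ h; first exact: (X02' x).
    by have := X01' _ X0x h; lra.
Qed.

(** Induction on the number of strokes. At a reducible spot the interior nodes are deleted, the
    shorter path is followed with precision [e / 2], and the link that arises from the deletion is
    subdivided again. A single stroke is followed by the whole space. *)
Lemma link_chain_exists (k : nat) v e : (0 < k)%N ->
  (forall i, (i <= k)%N -> v 0%N <= v i /\ v i <= v k) ->
  (forall i, (i < k)%N -> 1 <= `|v i.+1 - v i|) ->
  (forall x, v 0%N <= f x /\ f x <= v k) -> 0 < e <= 1/4 ->
  exists L, link_chain f setT k v e 0 L.
Proof.
elim/ltn_ind: k v e => k IH v e k0 vk gap fv e0.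
have [k1|k1] := ltnP 1 k; last first.
  have kE : k = 1%N by lia.
  subst k; exists (fun=> setT); split=> //.
  - by move=> x _; exists 0%N.
  - by move=> i j x ij j0; lia.
  - move=> [|//] x _ _; left; have := fv x; lra.
  - by move=> x _ _; split=> // -[].
have reduce n i : (1 < n)%N -> (i + n <= k)%N -> 1 <= `|v (i + n)%N - v i| ->
    (forall Y, closed Y -> (forall x, Y x -> between (v i) (v (i + n)%N) (e / 2) (f x)) ->
      exists Z, link_chain f Y n (fun j => v (i + j)%N) e (e / 2) Z) ->
    exists L, link_chain f setT k v e 0 L.
  move=> n1 ink gapn HZ.
  pose v' j := if (j <= i)%N then v j else v (j + n.-1)%N.
  have v'lo j : (j <= i)%N -> v' j = v j by move=> h; rewrite /v' h.
  have v'hi j : (i < j)%N -> v' j = v (j + n.-1)%N by move=> h; rewrite /v' leqNgt h.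
  pose k' := (k - n.-1)%N.
  have v'k : v' k' = v k by rewrite v'hi; [congr v|]; rewrite /k'; lia.
  have v'0 : v' 0%N = v 0%N by rewrite v'lo.
  have k'k : (k' < k)%N by rewrite /k'; lia.
  have [|||||L HL] := IH k' k'k v' (e / 2).
  - by rewrite /k'; lia.
  - move=> j jk'; rewrite v'0 v'k; have [ji|ij] := leqP j i.
      by rewrite v'lo//; apply: vk; rewrite /k' in jk'; lia.
    by rewrite v'hi//; apply: vk; rewrite /k' in jk'; lia.
  - move=> j jk'; rewrite /k' in jk'; have [ji|ij|ji] := ltngtP j i.
    + by rewrite !v'lo//; [apply: gap; lia|lia].
    + by rewrite !v'hi//; [rewrite addSn; apply: gap; lia|lia].
    + rewrite ji (v'lo i)// v'hi//.
      by have -> : (i.+1 + n.-1 = i + n)%N by lia.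
  - by move=> x; rewrite v'0 v'k.
  - lra.
  have ik' : (i < k')%N by rewrite /k'; lia.
  have cL : closed (L i) by apply: (link_closed HL).
  have [|Z HZi] := HZ (L i) cL.
    move=> x Lx; have := link_between HL ik' Lx.
    by rewrite v'lo// v'hi//; have -> : (i.+1 + n.-1 = i + n)%N by lia.
  have <- : (k' + n.-1 = k)%N by rewrite /k'; lia.
  apply: (link_chain_splice ik' _ _ _ _ _ HL HZi); [lia|lra|lra| |].
    by move=> j ji; rewrite v'lo.
  by move=> j /andP[ij _]; rewrite v'hi.
have [[i ik vi]|[i ik vi]] := reducible_spot k1 vk gap.
- apply: (reduce 2 i) => //; [lia| |].
    by rewrite addn2 ler_normr; apply/orP; case: vi => -[? ?]; [left|right]; lra.
  move=> Y cY HY; apply: link_chain_monotone => //; first by rewrite addn0.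
  by rewrite addn0 addn1 addn2.
- apply: (reduce 3 i) => //; [lia| |].
    rewrite addn3.
    by rewrite ler_normr; apply/orP; case: vi => -[? ? ?]; [left|right]; lra.
  move=> Y cY HY; apply: link_chain_zigzag => //; first by rewrite addn0.
  by rewrite addn0 addn1 addn2 addn3.
Qed.

End Pattern.

(** * Maps onto the unit interval *)

Section UnitInterval.
Variable R : realType.
Local Notation I := (unit_interval R).

Definition uval (t : I) : R := @set_val R `[0, 1]%classic t.

Lemma uval01 (t : I) : 0 <= uval t /\ uval t <= 1.
Proof. by have := @set_valP R `[0, 1]%classic t; rewrite /= in_itv/= => /andP[]. Qed.

Lemma uval_inj : injective uval.
Proof. exact: val_inj. Qed.

Lemma uval_continuous : continuous uval.
Proof. exact: initial_continuous. Qed.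

Definition uclamp (r : R) : I.
Proof.
exists (Num.max 0 (Num.min 1 r)); apply/mem_set => /=.
by rewrite in_itv/=; apply/andP; split; rewrite ?le_max ?ge_max ?lexx ?ler01 ?ge_min ?lexx.
Defined.

Lemma uval_uclamp r : uval (uclamp r) = Num.max 0 (Num.min 1 r).
Proof. by []. Qed.

Lemma uclampK r : 0 <= r <= 1 -> uval (uclamp r) = r.
Proof. by move=> /andP[r0 r1]; rewrite uval_uclamp min_r// max_r. Qed.

Lemma uvalK t : uclamp (uval t) = t.
Proof. by have [? ?] := uval01 t; apply: uval_inj; rewrite uclampK//; apply/andP. Qed.

Lemma uclamp_dist r s : 0 <= s <= 1 -> `|uval (uclamp r) - s| <= `|r - s|.
Proof.
move=> /andP[s0 s1]; rewrite uval_uclamp ler_norml.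
have := ler_norm (r - s); have := ler_norm (s - r); rewrite (distrC s r).
move: `|r - s| => d; rewrite /Num.max /Num.min.
by case: ifPn => [?|]; case: ifPn; rewrite -?leNgt; lra.
Qed.

Lemma continuous_into_unit (T : topologicalType) (f : T -> I) :
  continuous (fun x => uval (f x)) -> continuous f.
Proof. exact: continuous_comp_initial. Qed.

Lemma uval_comp_continuous (T : topologicalType) (r : T -> I) :
  continuous r -> continuous (fun x => uval (r x)).
Proof. by move=> cr x; apply: continuous_comp; [exact: cr|exact: uval_continuous]. Qed.

Lemma uclamp_continuous : continuous uclamp.
Proof.
apply: continuous_into_unit => r; apply: continuous_max; first exact: cst_continuous.
by apply: continuous_min; [exact: cst_continuous|exact: id].
Qed.

Lemma unit_ballE (s t : I) e : ball s e t <-> `|uval s - uval t| < e.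
Proof. by rewrite -[ball s e t]/(ball (uval s) e (uval t)). Qed.

Lemma unit_connected : connected [set: I].
Proof.
have -> : [set: I] = uclamp @` `[0, 1].
  apply/seteqP; split=> // t _; exists (uval t); last exact: uvalK.
  by have [? ?] := uval01 t; rewrite /= in_itv/=; apply/andP.
apply: connected_continuous_connected; first exact: segment_connected.
by apply: continuous_subspaceT; exact: uclamp_continuous.
Qed.

Lemma connected_IVT (T : topologicalType) (h : T -> R) a b v :
  connected [set: T] -> continuous h -> h a <= v -> v <= h b ->
  exists x, h x = v.
Proof.
move=> cT ch av vb.
have : connected (h @` setT).
  by apply: connected_continuous_connected => //; exact: continuous_subspaceT.
move=> /connected_intervalP itv.
have [|x _ <-] := itv (h a) (h b) (ex_intro2 _ _ a Logic.I erefl) (ex_intro2 _ _ b Logic.I erefl) v.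
  by rewrite av vb.
by exists x.
Qed.

Lemma continuous_norm_sub (T : topologicalType) (f g : T -> R) :
  continuous f -> continuous g -> continuous (fun x => `|f x - g x|).
Proof. by move=> cf cg x; apply: cvg_norm; apply: cvgB; [exact: cf|exact: cg]. Qed.

(** Each point has a neighbourhood on which either [G < eta] or [F] is bounded away from 0. On a
    product, with [F] a distance, this becomes the uniform continuity statements [fiber_unif] and
    [mdist_unif]. *)
Lemma compact_unif (T : topologicalType) (F G : T -> R) eta :
  compact [set: T] -> continuous F -> continuous G ->
  (forall x, F x <= 0 -> G x < eta) ->
  exists2 kappa, 0 < kappa & forall x, F x < kappa -> G x < eta.
Proof.
move=> /compact_near_coveringP cT cF cG FG.
have : \forall n \near \oo, [set: T] `<=` (fun x => F x < n.+1%:R^-1 -> G x < eta).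
  apply: cT => x _; have [Fx|Fx] := leP (F x) 0.
    have Gx : \forall y \near x, G y < eta.
      apply: (cG x [set t | t < eta]); apply: open_nbhs_nbhs.
      by split; [exact: open_lt|exact: FG].
    exists ([set y | G y < eta], setT) => //=; first by split=> //; exact: filterT.
    by move=> [y n] /= [].
  have Fy : \forall y \near x, F x / 2 < F y.
    apply: (cF x [set t | F x / 2 < t]); apply: open_nbhs_nbhs; split.
      exact: open_gt.
    by move=> /=; lra.
  exists ([set y | F x / 2 < F y], [set n | n.+1%:R^-1 < F x / 2]) => /=.
    split=> //; have F2 : 0 < F x / 2 by lra.
    exact: (near_infty_natSinv_lt (PosNum F2)).
  by move=> [y n] [/= h1 h2] h3; have := lt_trans h1 (lt_trans h3 h2); rewrite ltxx.
move=> [n _ /(_ n (leqnn n)) h]; exists n.+1%:R^-1; first by rewrite invr_gt0.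
by move=> x; apply: h.
Qed.

Definition csurj (T : topologicalType) (q : T -> I) :=
  continuous q /\ forall t, exists x, q x = t.

Lemma csurj_id : csurj (@id I).
Proof. by split=> [t|t]; [exact: id|exists t]. Qed.

Lemma csurj_comp (T : topologicalType) (q : T -> I) (g : I -> I) :
  csurj g -> csurj q -> csurj (g \o q).
Proof.
move=> [cg sg] [cq sq]; split; first by move=> x; apply: continuous_comp; [exact: cq|exact: cg].
by move=> t; have [s <-] := sg t; have [x <-] := sq s; exists x.
Qed.

Lemma fiber_unif (T : topologicalType) (q : T -> I) (G : T * T -> R) eta :
  compact [set: T] -> continuous q -> continuous G ->
  (forall x y, q x = q y -> G (x, y) < eta) ->
  exists2 kappa, 0 < kappa &
    forall x y, `|uval (q x) - uval (q y)| < kappa -> G (x, y) < eta.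
Proof.
move=> cT cq cG qG.
have cTT : compact [set: T * T] by rewrite -setXTT; exact: compact_setX.
have cqv : continuous (fun x => uval (q x)).
  by move=> x; apply: continuous_comp; [exact: cq|exact: uval_continuous].
have cF : continuous (fun z : T * T => `|uval (q z.1) - uval (q z.2)|).
  apply: continuous_norm_sub => z.
    by apply: (continuous_comp (g := fun x => uval (q x))); [exact: cvg_fst|exact: cqv].
  by apply: (continuous_comp (g := fun x => uval (q x))); [exact: cvg_snd|exact: cqv].
have [|k k0 H] := compact_unif (eta := eta) cTT cF cG.
  move=> [x y] /= xy; apply/qG/uval_inj/eqP; rewrite -subr_eq0 -normr_eq0.
  by rewrite eq_le xy normr_ge0.
by exists k => // x y; exact: (H (x, y)).
Qed.

Lemma continuous_pair_sub (T : topologicalType) (h : T -> R) :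
  continuous h -> continuous (fun z : T * T => `|h z.1 - h z.2|).
Proof.
move=> ch; apply: continuous_norm_sub => z.
  by apply: continuous_comp; [exact: cvg_fst|exact: ch].
by apply: continuous_comp; [exact: cvg_snd|exact: ch].
Qed.

Lemma unit_unif_continuous (g : I -> R) e : continuous g -> 0 < e ->
  exists2 d, 0 < d & forall s t, `|uval s - uval t| < d -> `|g s - g t| < e.
Proof.
move=> cg e0; have [||s t st|d d0 H] := @fiber_unif _ id
  (fun z => `|g z.1 - g z.2|) e (@unit_interval_compact R).
- by move=> ?; exact: id.
- exact: continuous_pair_sub.
- by rewrite /= st subrr normr0.
- by exists d.
Qed.

(* q is h followed by the affine map carrying [e, 1 - e] onto [0, 1], clamped. *)
Lemma near_surjective (T : topologicalType) (h : T -> R) e x0 x1 :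
  connected [set: T] -> continuous h -> 0 < e <= 1/4 ->
  h x0 <= e -> 1 - e <= h x1 ->
  exists2 q : T -> I, csurj q &
    forall x s, 0 <= s <= 1 -> `|h x - s| <= e -> `|uval (q x) - s| <= 4 * e.
Proof.
move=> cT ch e0 hx0 hx1; have d0 : 0 < 1 - 2 * e by lra.
pose k x := (h x - e) / (1 - 2 * e).
have ck : continuous k by move=> x; apply: cvgMl; apply: cvgB; [exact: ch|exact: cvg_cst].
exists (fun x => uclamp (k x)).
  split; first by move=> x; apply: continuous_comp; [exact: ck|exact: uclamp_continuous].
  move=> t; have [t0 t1] := uval01 t.
  have [||x kx] := @connected_IVT T k x0 x1 (uval t) cT ck.
  - rewrite /k ler_pdivrMr//.
    by have : 0 <= uval t * (1 - 2 * e) by [rewrite mulr_ge0// ltW]; lra.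
  - rewrite /k ler_pdivlMr//.
    by have : uval t * (1 - 2 * e) <= 1 - 2 * e by [rewrite ger_pMl]; lra.
  - by exists x; rewrite kx uvalK.
move=> x s /andP[s0 s1] hs; apply: le_trans (uclamp_dist _ _) _; first by rewrite s0.
(* The numerator is at most [2 * e] and the denominator at least 1/2, whence the factor 4. *)
have -> : k x - s = ((h x - s) - e * (1 - 2 * s)) / (1 - 2 * e).
  rewrite /k; have d1 : 1 - 2 * e != 0 by rewrite gt_eqF.
  by field.
rewrite normrM normfV (gtr0_norm d0) ler_pdivrMr//.
apply: le_trans (ler_normB _ _) _.
have : `|e * (1 - 2 * s)| <= e.
  by rewrite normrM gtr0_norm; [rewrite ger_pMr; [rewrite ler_norml|]|]; lra.
have : 4 * e * (1 - 2 * e) >= 2 * e by nra.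
lra.
Qed.

End UnitInterval.

(** * Partitions of unity and the map of a chain into the line *)

Section MetricMaps.
Context {R : realType} (X : metricType R).
Local Notation I := (unit_interval R).
Implicit Types (U : set X) (x y : X).

Lemma lipschitz_continuous (h : X -> R) K : 0 < K ->
  (forall x y, h x <= h y + K * mdist x y) -> continuous h.
Proof.
move=> K0 hL x; apply/cvgrPdist_lt => e e0.
have eK : 0 < e / K by rewrite divr_gt0.
near=> y.
have xy : mdist x y < e / K.
  have : ball x (e / K) y by near: y; exact: nbhsx_ballx.
  by rewrite ballEmdist.
have Kxy : K * mdist x y < e by rewrite -ltr_pdivlMl// mulrC.
rewrite ltr_norml; have := hL x y; have := hL y x; rewrite (metric_sym y x); lra.
Unshelve. all: by end_near. Qed.

Lemma mdist_continuous : continuous (fun z : X * X => mdist z.1 z.2).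
Proof.
move=> [x y]; apply/cvgrPdist_lt => e e0 /=.
have e2 : 0 < e / 2 by lra.
exists (ball x (e / 2), ball y (e / 2)) => /=; first by split; exact: nbhsx_ballx.
move=> [x' y'] /= []; rewrite !ballEmdist/= => xx' yy'.
have h1 := metric_triangle x x' y; have h2 := metric_triangle x' y' y.
have h3 := metric_triangle x' x y'; have h4 := metric_triangle x y y'.
rewrite (metric_sym y' y) in h2; rewrite (metric_sym x' x) in h3.
rewrite ltr_norml; lra.
Qed.

(** The distance to the complement of [U], capped at 1 so that the infimum also makes sense when [U]
    is the whole space. *)
Definition depth U x : R :=
  inf [set r | r = 1 \/ exists2 y, ~ U y & r = mdist x y].

Lemma depth_lb U x : has_lbound [set r | r = 1 \/ exists2 y, ~ U y & r = mdist x y].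
Proof. by exists 0 => r [->//|[y _ ->]]; exact: mdist_ge0. Qed.

Lemma depth_ge0 U x : 0 <= depth U x.
Proof.
apply: lb_le_inf; first by exists 1; left.
by move=> r [->//|[y _ ->]]; exact: mdist_ge0.
Qed.

Lemma depth_out U x : ~ U x -> depth U x = 0.
Proof.
move=> Ux; apply/eqP; rewrite eq_le depth_ge0 andbT.
apply: ge_inf; first exact: depth_lb.
by right; exists x => //; rewrite mdistxx.
Qed.

Lemma depth_gt0 U x : open U -> U x -> 0 < depth U x.
Proof.
move=> oU Ux; have /nbhs_ballP[e /= e0 eU] := open_nbhs_nbhs (conj oU Ux).
apply: (@lt_le_trans _ _ (Num.min 1 e)); first by rewrite lt_min ltr01 e0.
apply: lb_le_inf; first by exists 1; left.
move=> r [->|[y Uy ->]]; first by rewrite ge_min lexx.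
rewrite ge_min; apply/orP; right; rewrite leNgt; apply/negP => xy.
by apply: Uy; apply: eU; rewrite ballEmdist.
Qed.

Lemma depth_continuous U : continuous (depth U).
Proof.
apply: (@lipschitz_continuous _ 1) => // x y; rewrite mul1r -lerBlDr.
apply: lb_le_inf; first by exists 1; left.
move=> r [->|[z Uz ->]]; rewrite lerBlDr.
  apply: (@le_trans _ _ 1); first by apply: ge_inf; [exact: depth_lb|left].
  by rewrite lerDl mdist_ge0.
apply: (@le_trans _ _ (mdist x z)).
  by apply: ge_inf; [exact: depth_lb|right; exists z].
by rewrite addrC; exact: metric_triangle.
Qed.

Lemma partition_of_unity n (U : nat -> set X) :
  (forall i, (i < n)%N -> open (U i)) ->
  (forall x, exists2 i, (i < n)%N & U i x) ->
  exists phi : nat -> X -> R, [/\ forall i, continuous (phi i),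
    forall i x, 0 <= phi i x, forall i x, ~ U i x -> phi i x = 0,
    forall i x, (i < n)%N -> U i x -> 0 < phi i x &
    forall x, \sum_(i < n) phi i x = 1].
Proof.
move=> oU cU; pose S x := \sum_(i < n) depth (U i) x.
have S0 x : 0 < S x.
  have [i ni Uix] := cU x; rewrite /S (bigD1 (Ordinal ni))//=.
  apply: ltr_wpDr; first by apply: sumr_ge0 => j _; exact: depth_ge0.
  by apply: depth_gt0 => //; exact: oU.
have cS : continuous S.
  move=> x; apply: (cvg_big add_continuous) => i _; exact: depth_continuous.
exists (fun i x => depth (U i) x / S x); split.
- move=> i x; apply: cvgM; first exact: depth_continuous.
  apply: cvgV; [by rewrite gt_eqF|exact: cS].
- by move=> i x; rewrite divr_ge0 ?depth_ge0// ltW.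
- by move=> i x Ux; rewrite depth_out// mul0r.
- by move=> i x ni Ux; rewrite divr_gt0//; apply: depth_gt0 => //; exact: oU.
- by move=> x; rewrite -mulr_suml -/(S x) mulfV// gt_eqF.
Qed.

(** [h x] is a convex combination of those [y i] whose [U i] contains [x], so a bound common to
    these values passes to it. *)
Lemma blend n (U : nat -> set X) (y : nat -> R) :
  (forall i, (i < n)%N -> open (U i)) ->
  (forall x, exists2 i, (i < n)%N & U i x) ->
  exists2 h : X -> R, continuous h & forall x z c,
    (forall i, (i < n)%N -> U i x -> `|y i - z| <= c) -> `|h x - z| <= c.
Proof.
move=> oU cU; have [phi [cphi phi0 phiU _ phi1]] := partition_of_unity oU cU.
exists (fun x => \sum_(i < n) y i * phi i x).
  move=> x; apply: (cvg_big add_continuous) => i _.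
  by apply: cvgM; [exact: cvg_cst|exact: cphi].
move=> x z c H; have -> : z = \sum_(i < n) z * phi i x by rewrite -mulr_sumr phi1 mulr1.
rewrite -sumrB; apply: le_trans (ler_norm_sum _ _ _) _.
rewrite -[leRHS]mulr1 -(phi1 x) mulr_sumr; apply: ler_sum => i _.
rewrite -mulrBl normrM (ger0_norm (phi0 _ _)).
have [Ux|Ux] := pselect (U i x); last by rewrite phiU// !mulr0.
by apply: ler_wpM2r => //; exact: H.
Qed.

(** [h] averages link indices. If [i] is the least index of a link containing [x], only [i] and
    [i + 1] enter the average and [i] has positive weight, so [i <= h x < i + 1]: the integer part
    of [h x] names a link containing [x]. *)
Lemma chain_map n (U : 'I_n -> set X) : (forall i, open (U i)) ->
  \bigcup_i U i = setT -> chain U ->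
  exists2 h : X -> R, continuous h &
    forall x y, h x = h y -> exists i, U i x /\ U i y.
Proof.
move=> oU cU chU.
pose V (i : nat) : set X := if insub i is Some j then U j else set0.
have VE (i : 'I_n) : V i = U i by rewrite /V valK.
have VE' i (ni : (i < n)%N) : V i = U (Ordinal ni) by rewrite -VE.
have oV i : (i < n)%N -> open (V i) by move=> ni; rewrite VE'.
have cV x : exists2 i, (i < n)%N & V i x.
  have : (\bigcup_i U i) x by rewrite cU.
  by move=> [i _ Uix]; exists i; rewrite ?VE.
have [phi [cphi phi0 phiV phiV0 phi1]] := partition_of_unity oV cV.
pose h x := \sum_(i < n) i%:R * phi i x.
exists h.
  move=> x; apply: (cvg_big add_continuous) => i _.
  by apply: cvgM; [exact: cvg_cst|exact: cphi].
have key x : exists2 i : 'I_n, U i x & i%:R <= h x < i%:R + 1.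
  have ex : exists i, `[< (i < n)%N /\ V i x >].
    by have [i ni Vi] := cV x; exists i; apply/asboolP.
  case: (ex_minnP ex) => i /asboolP[ni Vi] imin.
  exists (Ordinal ni) => /=; first by rewrite -VE'.
  have ij (j : 'I_n) : V j x -> (i <= j <= i.+1)%N.
    move=> Vj; apply/andP; split; first by apply: imin; apply/asboolP.
    have := (chU (Ordinal ni) j).1; rewrite -VE' -VE => -[|//].
    by exists x.
  have i1 : i%:R = \sum_(j < n) i%:R * phi j x by rewrite -mulr_sumr phi1 mulr1.
  have i2 : i%:R + 1 = \sum_(j < n) (i%:R + 1) * phi j x by rewrite -mulr_sumr phi1 mulr1.
  apply/andP; split.
    rewrite [leLHS]i1; apply: ler_sum => j _.
    have [Vj|Vj] := pselect (V j x); last by rewrite phiV// !mulr0.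
    by apply: ler_wpM2r => //; rewrite ler_nat; have /andP[] := ij _ Vj.
  rewrite [ltRHS]i2 /h (bigD1 (Ordinal ni))//= [ltRHS](bigD1 (Ordinal ni))//=.
  apply: ltr_leD; first by rewrite ltr_pM2r ?ltrDl//; exact: phiV0.
  apply: ler_sum => j _.
  have [Vj|Vj] := pselect (V j x); last by rewrite phiV// !mulr0.
  apply: ler_wpM2r => //; rewrite natr1; have /andP[_] := ij _ Vj.
  by rewrite -(ler_nat R) -natr1.
move=> x y hxy; have [i Ux /andP[ix xi]] := key x; have [j Uy /andP[jy yj]] := key y.
have ij : (i < j.+1)%N by rewrite -(ltr_nat R) -natr1; lra.
have ji : (j < i.+1)%N by rewrite -(ltr_nat R) -natr1; lra.
have ijE : i = j by apply/val_inj => /=; lia.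
by exists j; split=> //; rewrite -ijE.
Qed.

End MetricMaps.

(* The path from s down to 0, up to 1 and down to t, for u in [0, 3]. *)
Definition detour (R : realType) (s t u : R) : R :=
  if u <= 1 then Num.max (s - u) 0 else if u <= 2 then u - 1 else Num.max (3 - u) t.

Lemma detour_lipschitz (R : realType) (s t u w : R) : 0 <= s <= 1 -> 0 <= t <= 1 ->
  `|detour s t u - detour s t w| <= `|u - w|.
Proof.
move=> s01 t01; wlog uw : u w / u <= w.
  move=> H; case: (leP u w) => [|/ltW] uw; first exact: H.
  by rewrite distrC (distrC u); exact: H.
rewrite (distrC u) (ger0_norm (x := w - u)) ?subr_ge0// ler_norml.
rewrite /detour /Num.max.
by case: ifPn; case: ifPn; case: ifPn; rewrite -?leNgt -?ltNge; do ?[case: ifPn];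
  rewrite -?leNgt -?ltNge; lra.
Qed.

Lemma detour01 (R : realType) (s t u : R) : 0 <= s <= 1 -> 0 <= t <= 1 -> 0 <= u <= 3 ->
  0 <= detour s t u <= 1.
Proof.
rewrite /detour /Num.max => s01 t01 u03.
by do ?[case: ifPn]; rewrite -?leNgt -?ltNge; lra.
Qed.

(** * Lifting a surjection through a surjection of the interval *)

Section Lifting.
Context {R : realType} (X : metricType R).
Hypothesis Xcpt : compact [set: X].
Hypothesis Xcon : connected [set: X].
Hypothesis XHI : @hereditarily_indecomposable R X.
Local Notation I := (unit_interval R).

Local Ltac goal_lra := clear -X Xcpt Xcon XHI; lra.

(* The nodes w i / e -/+ 1, with alternating signs, are at least 1 apart, and
   their first and last ones are extreme. *)
Lemma node_chain (r : X -> R) (k : nat) (w : nat -> R) e :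
  continuous r -> (forall x, 0 <= r x <= 1) -> 0 < e -> odd k ->
  w 0%N = 0 -> w k = 1 -> (forall i, 0 <= w i <= 1) ->
  (forall i, (i < k)%N -> `|w i.+1 - w i| < e) ->
  exists Z : nat -> set X, [/\ forall i, (i < k)%N -> closed (Z i),
    forall x, exists2 i, (i < k)%N & Z i x,
    forall i j x, (i.+1 < j)%N -> (j < k)%N -> Z i x -> ~ Z j x,
    (forall x, r x = 0 -> Z 0%N x) /\ (forall x, r x = 1 -> Z k.-1 x) &
    forall i x, (i < k)%N -> Z i x -> `|r x - w i| <= 6 * e].
Proof.
move=> cr r01 e0 oddk w0 wk w01 wstep.
pose M := e^-1; have M0 : 0 < M by rewrite invr_gt0.
have Me : M * e = 1 by rewrite mulVf// gt_eqF.
(* One step changes [M * w] by less than 1 and the sign flip contributes 2, so the gaps lie between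
   1 and 3. Since [k] is odd, the last node is [M + 1], and [f] rescales [r] from [[0, 1]] to the
   range from [v 0] to [v k]. *)
pose v i := M * w i - (-1) ^+ i.
pose f x := (M + 2) * r x - 1.
have sgn i : (-1) ^+ i = 1 :> R \/ (-1) ^+ i = -1 :> R.
  by rewrite -signr_odd; case: (odd i); [right|left].
have v0 : v 0%N = -1 by rewrite /v w0 mulr0 expr0 sub0r.
have vk : v k = M + 1 by rewrite /v wk mulr1 -signr_odd oddk expr1 opprK.
have vbound i : v 0%N <= v i /\ v i <= v k.
  have : 0 <= M * w i <= M.
    by have /andP[? ?] := w01 i; rewrite mulr_ge0 ?ger_pMr// ltW.
  by rewrite v0 vk /v; move: (M * w i) => a; case: (sgn i) => ->; lra.
have fbound x : v 0%N <= f x /\ f x <= v k.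
  have : 0 <= (M + 2) * r x <= M + 2.
    by have /andP[? ?] := r01 x; rewrite mulr_ge0 ?ger_pMr//; lra.
  by rewrite v0 vk /f; move: ((M + 2) * r x) => a; lra.
have vstep i : (i < k)%N -> 1 <= `|v i.+1 - v i| <= 3.
  move=> /wstep; rewrite -(ltr_pM2l M0) Me -{1}(gtr0_norm M0) -normrM mulrBr.
  rewrite /v exprS; move: (M * w i.+1) (M * w i) => a b.
  rewrite ltr_norml; have := sgn i; move: ((-1) ^+ i) => s; clear -X Xcpt Xcon XHI.
  case=> -> ab.
    by case: (norm_cases (a - -1 * 1 - (b - 1))) => -[? ->]; lra.
  by case: (norm_cases (a - -1 * -1 - (b - -1))) => -[? ->]; lra.
have cf : continuous f.
  by move=> x; apply: cvgB; [apply: cvgMr; exact: cr|exact: cvg_cst].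
have k0 : (0 < k)%N by case: (k) oddk.
have [||//||Z HZ] := @link_chain_exists R X Xcpt XHI f cf k v (1/4) k0.
- by move=> i _; exact: vbound.
- by move=> i /vstep/andP[].
- by lra.
exists Z; split.
- exact: link_closed HZ.
- by move=> x; exact: (link_cover HZ).
- exact: link_disjoint HZ.
- split=> x rx.
    by have [] := link_first HZ (x := x) Logic.I; rewrite // v0 /f rx mulr0 sub0r subrr normr0.
  have [] := link_last HZ (x := x) Logic.I; last by [].
  by rewrite vk /f rx mulr1 (_ : _ - _ = 0) ?normr0//; goal_lra.
(* [f x] is within 3 + 1/4 of [v i], while [f] and [v] differ from [M * r] and [M * w] by at most 1
   each; the sum stays below 6. *)
- move=> i x ik Zx; rewrite -(ler_pM2l M0) mulrCA Me mulr1 -{1}(gtr0_norm M0) -normrM mulrBr.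
  have := link_between HZ ik Zx; have := vstep i ik; have := r01 x.
  rewrite /f /between [v i]/v (mulrDl M 2); have := sgn i.
  move: ((-1) ^+ i) (v i.+1) (M * w i) (M * r x) (r x) => s a b m t; clear -X Xcpt Xcon XHI.
  case=> -> t01.
    by case: (norm_cases (a - (b - 1))) => -[? ->]; rewrite ler_norml; lra.
  by case: (norm_cases (a - (b - -1))) => -[? ->]; rewrite ler_norml; lra.
Qed.

(** The links are closed, so the open cover to blend over is dual: [U i] is the complement of all
    links not adjacent to [i]. A point of [Z i] then lies in [U j] only for [j] equal or adjacent to
    [i]. *)
Lemma chain_blend (k : nat) (Z : nat -> set X) (y : nat -> R) :
  (forall i, (i < k)%N -> closed (Z i)) ->
  (forall x, exists2 i, (i < k)%N & Z i x) ->
  (forall i j x, (i.+1 < j)%N -> (j < k)%N -> Z i x -> ~ Z j x) ->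
  exists2 h : X -> R, continuous h & forall i x c, (i < k)%N -> Z i x ->
    (forall j, (i <= j.+1)%N -> (j <= i.+1)%N -> `|y j - y i| <= c) ->
    `|h x - y i| <= c.
Proof.
move=> cZ covZ disZ; pose far i j := ((i.+1 < j) || (j.+1 < i))%N.
pose U i := ~` \bigcup_(j in [set j | (j < k)%N && far i j]) Z j.
have oU i : (i < k)%N -> open (U i).
  move=> ik; apply: closed_openC; apply: closed_bigcup.
    by apply: (sub_finite_set _ (finite_II k)) => j /= /andP[].
  by move=> j /= /andP[jk _]; exact: cZ.
have cU x : exists2 i, (i < k)%N & U i x.
  have [i ik Zx] := covZ x; exists i => // -[j /= /andP[jk /orP[ij|ji]] Zjx].
    exact: (disZ _ _ _ ij jk Zx Zjx).
  exact: (disZ _ _ _ ji ik Zjx Zx).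
have [h ch Hh] := blend y oU cU.
exists h => // i x c ik Zx Hy; apply: Hh => j jk Ux.
suff /andP[ij ji] : ((i <= j.+1) && (j <= i.+1))%N by exact: Hy.
apply: contra_notT Ux; rewrite negb_and -!ltnNge => hj.
by exists i => //=; rewrite ik.
Qed.

(** A chain for [r] along [w], the image under [h] of the detour [y], is blended with the values of
    [y] themselves. On the link [i] the blend is close to [y i], hence its image under [h] is close
    to [w i], hence to [r]. *)
Lemma csurj_lift (r : X -> I) (h : I -> I) e : csurj r -> csurj h -> 0 < e ->
  exists2 q : X -> I, csurj q & forall x, `|uval (h (q x)) - uval (r x)| <= e.
Proof.
(* Six of the seven shares go to the error [6 * (e / 7)] of [node_chain], the last one to the
   modulus of [h]. *)
move=> [cr sr] [ch sh] e0; have e7 : 0 < e / 7 by lra.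
have [d d0 hd] := unit_unif_continuous (uval_comp_continuous ch) e7.
have [s0 hs0] := sh (uclamp 0); have [t0 ht0] := sh (uclamp 1).
have s01 := uval01 s0; have t01 := uval01 t0; move: s01 t01 => /andP s01 /andP t01.
have [n nd] := exists_nat_gt (8 / d + 8).
have d8 : 0 < 8 / d by rewrite divr_gt0.
(* Each of the three legs of the detour takes [L] steps of length [1 / L]. [L] is odd so that [k] is
   odd. The choice of [n] gives [8 * c < d], the final distance of [q] from [y], and [8 * c <= 1],
   which [near_surjective] needs. *)
pose L := n.*2.+1; pose k := (3 * L)%N.
have Lk : (L < k)%N by rewrite /k mulSn -[ltnLHS]addn0 ltn_add2l.
have LLk : (L.*2 < k)%N.
  by rewrite /k -addnn mulSn mul2n -addnn ltn_add2l -[ltnLHS]addn0 ltn_add2l.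
have k0 : (0 < k)%N by exact: leq_ltn_trans Lk.
have kL : k%:R = 3 * L%:R :> R by rewrite natrM.
have LL : (L.*2)%:R = 2 * L%:R :> R by rewrite -mul2n natrM.
have nL : n%:R <= L%:R :> R by rewrite ler_nat /L -addnn leqW// leq_addr.
have L8 : 8 < L%:R :> R.
  by apply: lt_le_trans nL; apply: lt_trans nd; rewrite ltrDr.
have oddk : odd k by rewrite /k /L oddM /= odd_double.
pose c : R := L%:R^-1.
have Lc : L%:R * c = 1 by rewrite mulfV// pnatr_eq0.
have c0 : 0 < c by rewrite invr_gt0.
have c8 : 8 * c < d.
  have : 8 < L%:R * d.
    rewrite -ltr_pdivrMr//; apply: lt_le_trans nL; apply: lt_trans nd.
    by rewrite ltrDl.
  by rewrite -(ltr_pM2r c0) (mulrAC L%:R) Lc mul1r.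
have c8' : 8 * c <= 1.
  by have : 8 * c <= L%:R * c; [rewrite ler_pM2r// ltW|rewrite Lc].
pose y (i : nat) := detour (uval s0) (uval t0) (i%:R * c).
have yL i j : `|y i - y j| <= `|i%:R - j%:R| * c.
  apply: le_trans (detour_lipschitz _ _ s01 t01) _.
  by rewrite -mulrBl normrM (gtr0_norm c0).
have y01 i : (i <= k)%N -> 0 <= y i <= 1.
  move=> ik; apply: detour01 => //; apply/andP; split; first by rewrite mulr_ge0// ltW.
  have -> : 3 = k%:R * c by rewrite kL -mulrA Lc mulr1.
  by rewrite ler_pM2r// ler_nat.
have near1 i j : (i <= j.+1)%N -> (j <= i.+1)%N -> `|i%:R - j%:R| <= 1 :> R.
  rewrite -(ler_nat R) -[(j <= _)%N](ler_nat R) -!natr1 ler_norml; goal_lra.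
have y_near i j : `|i%:R - j%:R| <= 1 :> R -> `|y i - y j| <= c.
  by move=> ij; apply: le_trans (yL i j) _; rewrite ler_piMl// ltW.
pose w i := uval (h (uclamp (y i))).
have ya : y L = 0 by rewrite /y Lc /detour lexx max_r// subr_le0; case/andP: s01.
have yb : y L.*2 = 1.
  rewrite /y LL -mulrA Lc mulr1 /detour lexx ifN; first by goal_lra.
  by rewrite -ltNge ltr1n.
have w0 : w 0%N = 0.
  rewrite /w /y mul0r /detour ler01 subr0 max_l; last by case/andP: s01.
  by rewrite uvalK hs0 uclampK// lexx ler01.
have wk : w k = 1.
  rewrite /w /y kL -mulrA Lc mulr1 /detour.
  rewrite ifN -?ltNge ?ltr1n// ifN -?ltNge ?ltr_nat// subrr max_r; last by case/andP: t01.
  by rewrite uvalK ht0 uclampK// lexx ler01.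
have w01 i : 0 <= w i <= 1 by apply/andP; exact: uval01.
have wd i : (i < k)%N -> `|w i.+1 - w i| < e / 7.
  move=> ik; apply: hd; rewrite !uclampK ?y01// 1?ltnW//.
  apply: le_lt_trans (y_near i.+1 i _) _; first by apply: near1 => //; rewrite leqW.
  by move: c8 c0; goal_lra.
have r01 x : 0 <= uval (r x) <= 1 by apply/andP; exact: uval01.
have [Z [cZ covZ disZ [Z0 Zk] Zw]] :=
  node_chain (uval_comp_continuous cr) r01 e7 oddk w0 wk w01 wd.
have [b cb Hb] := chain_blend y cZ covZ disZ.
(* [p] records the position along the path. It is near 0 over [r = 0] and near [k] over [r = 1], so
   by connectedness the space follows the whole path, including the nodes [L] and [2 * L], where the
   detour is at 0 and at 1. *)
have [p cp Hp] := chain_blend (fun i => i%:R) cZ covZ disZ.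
have bZ i x : (i < k)%N -> Z i x -> `|b x - y i| <= c.
  by move=> ik Zx; apply: Hb => // j ij ji; apply: y_near; exact: near1.
have pZ i x : (i < k)%N -> Z i x -> `|p x - i%:R| <= 1.
  by move=> ik Zx; apply: Hp => // j ij ji; exact: near1.
have [x0 rx0] := sr (uclamp 0); have [x1 rx1] := sr (uclamp 1).
have px0 : p x0 <= 1.
  have := pZ 0%N x0 k0; rewrite subr0 ler_norml => /(_ _)/andP[|//].
  by apply: Z0; rewrite rx0 uclampK// lexx ler01.
have px1 : k%:R - 2 <= p x1.
  have := pZ k.-1 x1; rewrite ltn_predL => /(_ k0) h1.
  have : `|p x1 - k.-1%:R| <= 1 by apply: h1; apply: Zk; rewrite rx1 uclampK// lexx ler01.
  by rewrite -[in k%:R](prednK k0) -natr1 ler_norml; goal_lra.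
have bnear (i : nat) : 1 <= i%:R :> R -> i%:R <= k%:R - 2 :> R ->
    exists x, `|b x - y i| <= 2 * c.
  move=> i1 ik; have [||x px] := @connected_IVT R X p x0 x1 i%:R Xcon cp.
  - exact: le_trans px0 _.
  - exact: le_trans px1.
  exists x; have [j jk Zx] := covZ x.
  have := pZ _ _ jk Zx; rewrite px distrC => ji.
  have := bZ _ _ jk Zx; have := y_near _ _ ji; have := ler_distD (y j) (b x) (y i).
  by goal_lra.
have [|| xa] := bnear L; [by move: L8; goal_lra|by rewrite kL; move: L8; goal_lra|].
rewrite ya subr0 ler_norml => /andP[_ bxa].
have [|| xb] := bnear L.*2; [by rewrite LL; move: L8; goal_lra|
  by rewrite LL kL; move: L8; goal_lra|].
rewrite yb ler_norml => /andP[bxb _].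
have [|||q qs qH] := @near_surjective R X b (2 * c) xa xb Xcon cb.
- by move: c0 c8'; goal_lra.
- exact: bxa.
- by move: bxb; goal_lra.
exists q => // x; have [i ik Zx] := covZ x.
have qy : `|uval (q x) - y i| <= 4 * (2 * c).
  apply: qH; first by apply: y01; exact: ltnW.
  by apply: le_trans (bZ _ _ ik Zx) _; move: c0; goal_lra.
have hq : `|uval (h (q x)) - w i| < e / 7.
  by apply: hd; rewrite uclampK ?y01 1?ltnW//; move: qy c8; goal_lra.
have := Zw _ _ ik Zx; have := ler_distD (w i) (uval (h (q x))) (uval (r x)).
by rewrite (distrC (w i)); move: hq; goal_lra.
Qed.

End Lifting.

Lemma compact_attains (R : realType) (T : topologicalType) (h : T -> R) (x0 : T) :
  compact [set: T] -> continuous h ->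
  exists a b, forall x, h a <= h x /\ h x <= h b.
Proof.
move=> cT ch; have ch' : {within [set: T], continuous h} by exact: continuous_subspaceT.
have T0 : [set: T] !=set0 by exists x0.
have [a _ ha] := compact_EVT_min T0 cT ch'.
have [b _ hb] := compact_EVT_max T0 cT ch'.
by exists a, b => x; rewrite ha ?hb ?inE.
Qed.

(** * Surjections with small fibres, and factoring through them *)

Section EtaMaps.
Context {R : realType} (X : metricType R).
Hypothesis Xcpt : compact [set: X].
Hypothesis Xcon : connected [set: X].
Local Notation I := (unit_interval R).

Definition eta_map (q : X -> I) (eta : R) :=
  forall x y, q x = q y -> mdist x y < eta.

Lemma eta_map_exists eta : chainable X -> (exists x y : X, x <> y) -> 0 < eta ->
  exists2 q, csurj q & eta_map q eta.
Proof.
move=> chX [x0 [y0 xy0]] eta0.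
have d0 : 0 < mdist x0 y0 by rewrite mdist_gt0; exact/eqP.
(* A mesh below the distance of two given points prevents the chain map from being constant, so that
   it can be rescaled onto the interval. *)
have [|n [U [oU cU chU mU]]] := chX (Num.min eta (mdist x0 y0)).
  by rewrite lt_min eta0.
have [h ch hU] := chain_map oU cU chU.
have hd x y : h x = h y -> mdist x y < eta /\ mdist x y < mdist x0 y0.
  by move=> /hU[i [Ux Uy]]; have := mU i x y Ux Uy; rewrite lt_min => /andP.
have [a [b hab]] := compact_attains x0 Xcpt ch.
have ab : 0 < h b - h a.
  rewrite subr_gt0 ltNge; apply/negP => ba.
  have : h x0 = h y0 by have := hab x0; have := hab y0; lra.
  by move=> /hd[_]; rewrite ltxx.
pose k x := (h x - h a) / (h b - h a).
have ck : continuous k by move=> x; apply: cvgMl; apply: cvgB; [exact: ch|exact: cvg_cst].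
have k01 x : 0 <= k x <= 1.
  have [? ?] := hab x.
  by rewrite /k divr_ge0 ?ler_pdivrMr ?(ltW ab)//; lra.
exists (fun x => uclamp (k x)).
  split; first by move=> x; apply: continuous_comp; [exact: ck|exact: uclamp_continuous].
  move=> t; have [t0 t1] := uval01 t.
  have [||x kx] := @connected_IVT R X k a b (uval t) Xcon ck.
  - by rewrite /k subrr mul0r.
  - by rewrite /k mulfV// gt_eqF.
  - by exists x; rewrite kx uvalK.
move=> x y /(congr1 (@uval R)); rewrite !uclampK// /k => /mulIf.
rewrite invr_eq0 gt_eqF// => /(_ isT) hxy; have : h x = h y by lra.
by move=> /hd[].
Qed.

Lemma mdist_unif (h : X -> R) e : continuous h -> 0 < e ->
  exists2 d, 0 < d & forall x y, mdist x y < d -> `|h x - h y| < e.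
Proof.
move=> ch e0.
have cTT : compact [set: X * X] by rewrite -setXTT; exact: compact_setX.
have [|d d0 H] := compact_unif (eta := e) cTT (@mdist_continuous R X) (continuous_pair_sub ch).
  move=> [x y] /= xy; have -> : x = y.
    by apply: mdist_positivity; apply/eqP; rewrite eq_le xy mdist_ge0.
  by rewrite subrr normr0.
by exists d => // x y; exact: (H (x, y)).
Qed.

Lemma eta_map_unif (q : X -> I) eta : continuous q -> eta_map q eta ->
  exists2 kappa, 0 < kappa &
    forall x y, `|uval (q x) - uval (q y)| < kappa -> mdist x y < eta.
Proof. by move=> cq; exact: (fiber_unif Xcpt cq (@mdist_continuous R X)). Qed.

(* u is close to the inf-convolution t |-> inf_x (h x + |p x - t| / k). *)
Lemma csurj_factor (p h : X -> I) e : csurj p -> csurj h -> 0 < e <= 1/4 ->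
  (forall x y, p x = p y -> `|uval (h x) - uval (h y)| < e) ->
  exists2 u, csurj u & forall x, `|uval (u (p x)) - uval (h x)| <= 4 * e.
Proof.
move=> [cp sp] [ch sh] e0 ph.
have [k k0 kH] := fiber_unif Xcpt cp (continuous_pair_sub (uval_comp_continuous ch)) ph.
pose F (t : I) := [set r | exists x, r = uval (h x) + k^-1 * `|uval (p x) - uval t| ].
have k1 : 0 < k^-1 by rewrite invr_gt0.
have F0 t x : 0 <= uval (h x) + k^-1 * `|uval (p x) - uval t|.
  by have [? _] := uval01 (h x); rewrite addr_ge0// mulr_ge0// ltW.
have Flb t : has_lbound (F t) by exists 0 => r [x ->]; exact: F0.
have [x0 hx0] := sh (uclamp 0); have [x1 hx1] := sh (uclamp 1).
have Fn t : F t !=set0 by eexists; exists x0.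
pose u t := inf (F t).
have uL s t : u s <= u t + k^-1 * `|uval s - uval t|.
  rewrite -lerBlDr; apply: lb_le_inf => // r [x ->]; rewrite lerBlDr.
  apply: (@le_trans _ _ (uval (h x) + k^-1 * `|uval (p x) - uval s|)).
    by apply: ge_inf => //; exists x.
  rewrite -addrA lerD2l -mulrDr ler_pM2l// (distrC (uval s)).
  exact: ler_distD.
have cu : continuous u.
  move=> s; apply/(@cvgrPdist_lt _ _ _ _ (nbhs_filter (s : I))) => d d0.
  have kd : 0 < d * k by rewrite mulr_gt0.
  apply: (@filterS _ _ (nbhs_filter (s : I)) _ _ _ (nbhsx_ballx (s : I) _ kd)) => t.
  move=> /unit_ballE st; have st' : k^-1 * `|uval s - uval t| < d.
    by rewrite ltr_pdivrMl// mulrC.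
  rewrite ltr_norml; have := uL s t; have := uL t s; rewrite (distrC (uval t)); lra.
have up x : uval (h x) - e <= u (p x) <= uval (h x).
  apply/andP; split; last first.
    apply: ge_inf => //; exists x; by rewrite subrr normr0 mulr0 addr0.
  apply: lb_le_inf => // r [y ->].
  (* If [p y] is within [k] of [p x], the values of [h] differ by less than [e]; otherwise the
     penalty is at least 1 and outweighs any difference of values in [[0, 1]]. *)
  have [yx|yx] := ltP `|uval (p y) - uval (p x)| k.
    have := kH y x yx; rewrite /= ltr_norml.
    have : 0 <= k^-1 * `|uval (p y) - uval (p x)| by rewrite mulr_ge0// ltW.
    lra.
  have : 1 <= k^-1 * `|uval (p y) - uval (p x)| by rewrite ler_pdivlMl// mulr1.
  have := uval01 (h x); have := uval01 (h y); lra.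
have [||v sv vH] := @near_surjective R I u e (p x0) (p x1) (@unit_connected R) cu e0.
- by have := up x0; rewrite hx0 uclampK ?lexx ?ler01//; lra.
- by have := up x1; rewrite hx1 uclampK ?lexx ?ler01//; lra.
exists v => // x; apply: vH; first by apply/andP; exact: uval01.
by have := up x; rewrite ler_norml; lra.
Qed.

Lemma csurj_refine (q : X -> I) d eta : chainable X -> (exists x y : X, x <> y) ->
  csurj q -> 0 < d -> 0 < eta ->
  exists q' k, [/\ csurj q', eta_map q' eta, csurj k &
    forall x, `|uval (k (q' x)) - uval (q x)| <= d].
Proof.
move=> chX X2 qs d0 eta0; pose e := Num.min (d / 4) (1 / 4).
have e0 : 0 < e by rewrite lt_min; lra.
have ed : 4 * e <= d by rewrite mulrC -ler_pdivlMr// ge_min lexx.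
have e4 : e <= 1/4 by rewrite ge_min lexx orbT.
have [k k0 kH] := mdist_unif (uval_comp_continuous qs.1) e0.
have [|q' q's q'e] := eta_map_exists (eta := Num.min eta k) chX X2.
  by rewrite lt_min eta0.
have q'd x y : q' x = q' y -> mdist x y < eta /\ mdist x y < k.
  by move=> /q'e; rewrite lt_min => /andP.
have [||u us uH] := csurj_factor (e := e) q's qs.
- by rewrite e0.
- by move=> x y /q'd[_ /kH].
exists q', u; split=> //; first by move=> x y /q'd[].
by move=> x; apply: le_trans ed; exact: uH.
Qed.

End EtaMaps.

(** * Towers of surjections *)

(** The intervals of radius [kappa n / 4] around [a n] are nested, because the step [kappa n / 8]
    plus the next radius, at most [kappa n / 8], is no more than the current radius. *)
Lemma nested_limit (R : realType) (a kappa : nat -> R) :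
  (forall n, 0 <= kappa n) -> (forall n, kappa n.+1 <= kappa n / 2) ->
  (forall n, `|a n.+1 - a n| <= kappa n / 8) ->
  exists p, forall n, `|p - a n| <= kappa n / 4.
Proof.
move=> k0 k2 ak.
have lo m n : (m <= n)%N -> a m - kappa m / 4 <= a n - kappa n / 4.
  elim: n => [|n IH]; first by rewrite leqn0 => /eqP->.
  rewrite leq_eqVlt => /predU1P[->//|/IH].
  by have := ak n; rewrite ler_norml; have := k2 n; lra.
have hi m n : (m <= n)%N -> a n + kappa n / 4 <= a m + kappa m / 4.
  elim: n => [|n IH]; first by rewrite leqn0 => /eqP->.
  rewrite leq_eqVlt => /predU1P[->//|/IH].
  by have := ak n; rewrite ler_norml; have := k2 n; lra.
pose A := [set a n - kappa n / 4 | n in [set: nat]].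
have ubA n : ubound A (a n + kappa n / 4).
  move=> _ [m _ <-]; have := lo m (maxn m n) (leq_maxl _ _).
  by have := hi n (maxn m n) (leq_maxr _ _); have := k0 (maxn m n); lra.
exists (sup A) => n; rewrite ler_norml.
have : a n - kappa n / 4 <= sup A.
  by apply: ub_le_sup; [exists (a 0%N + kappa 0%N / 4)|exists n].
have : sup A <= a n + kappa n / 4.
  by apply: ge_sup => //; exists (a 0%N - kappa 0%N / 4), 0%N.
lra.
Qed.

Section Tower.
Context {R : realType} (X : metricType R).
Hypothesis Xcpt : compact [set: X].
Local Notation I := (unit_interval R).
(** The states make the construction serve twice: with one state and all surjections admissible it
    produces the bonding maps of a new sequence, and with the indices of a given sequence as states
    it follows the bonding maps of that sequence. *)
Variables (St : Type) (adm : St -> St -> (I -> I) -> Prop).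
Hypothesis adm_csurj : forall s s' k, adm s s' k -> csurj k.
Hypothesis adm_step : forall s (q : X -> I) d eta, csurj q -> 0 < d -> 0 < eta ->
  exists s' k q', [/\ adm s s' k, csurj q', eta_map q' eta &
    forall x, `|uval (k (q' x)) - uval (q x)| <= d].

Definition equicontinuous_maps (C : set (I -> I)) := forall e, 0 < e ->
  exists2 d, 0 < d & forall c, C c -> forall s t,
    `|uval s - uval t| < d -> `|uval (c s) - uval (c t)| < e.

(* C collects the composites of the bonding maps so far: a correction of q is
   harmless if it is small after applying any of them. *)
Record stage := Stage {
  st_state : St; st_map : X -> I; st_tol : R; st_comps : set (I -> I);
  st_index : nat;
  st_csurj : csurj st_map;
  st_tol_gt0 : 0 < st_tol;
  st_equi : equicontinuous_maps st_comps
}.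

(** The last clause is built to survive the limit: the limit map stays within a quarter of the
    tolerance of the stage map, so points that it identifies are within half the tolerance under the
    stage map. *)
Definition next_stage (z z' : stage) := exists k, [/\
  [/\ adm (st_state z) (st_state z') k, st_tol z' <= st_tol z / 2 &
     st_index z' = (st_index z).+1],
  st_comps z' id, forall c, st_comps z c -> st_comps z' (c \o k),
  forall c x, st_comps z c ->
    `|uval (c (k (st_map z' x))) - uval (c (st_map z x))| <= st_tol z / 8 &
  forall x y, `|uval (st_map z' x) - uval (st_map z' y)| < st_tol z' ->
    mdist x y < (st_index z').+1%:R^-1].

Lemma next_stage_exists z : exists z', next_stage z z'.
Proof.
case: z => s q kap C n qs kap0 Cequi.
have kap8 : 0 < kap / 8 by lra.
have [d d0 dH] := Cequi _ kap8.
have d2 : 0 < d / 2 by lra.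
have n0 : 0 < n.+2%:R^-1 :> R by rewrite invr_gt0.
have [s' [k [q' [ssk q's q'e kq]]]] := adm_step s qs d2 n0.
have [k1 k10 k1H] := eta_map_unif Xcpt q's.1 q'e.
pose kap' := Num.min (kap / 2) k1.
have kap'0 : 0 < kap' by rewrite lt_min k10; lra.
pose C' := [set id] `|` [set c \o k | c in C].
have C'equi : equicontinuous_maps C'.
  move=> e e0; have [d1 d10 d1H] := Cequi e e0.
  have [d3 d30 d3H] := unit_unif_continuous (uval_comp_continuous (adm_csurj ssk).1) d10.
  exists (Num.min e d3); first by rewrite lt_min e0.
  move=> c [->|[c' Cc' <-]] a b; rewrite lt_min => /andP[ab1 ab2] //.
  by apply: (d1H _ Cc'); exact: (d3H a b ab2).
exists (Stage s' n.+1 q's kap'0 C'equi), k; split=> //=.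
- by split=> //; rewrite ge_min lexx.
- by left.
- by move=> c Cc; right; exists c.
- by move=> c x Cc; apply/ltW/dH => //; have := kq x; lra.
- by move=> x y xy; apply: k1H; apply: lt_le_trans xy _; rewrite ge_min lexx orbT.
Qed.

(** [p m] is the limit over [j] of the stage map at [m + j] followed by the [j] bonding maps down to
    [m]. Successive terms differ by an eighth of a tolerance that halves at each stage, so the
    convergence is uniform in the point. *)
Lemma tower s0 (q0 : X -> I) : csurj q0 ->
  exists (s : nat -> St) (k : nat -> I -> I) (p : nat -> X -> I),
  [/\ s 0%N = s0, forall n, adm (s n) (s n.+1) (k n), forall n, csurj (p n),
    forall n x, k n (p n.+1 x) = p n x &
    forall eta, 0 < eta -> exists N, forall n, (N <= n)%N -> eta_map (p n) eta].
Proof.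
move=> q0s.
have equi0 : equicontinuous_maps [set id].
  by move=> e e0; exists e => // c -> s t.
pose z0 := @Stage s0 q0 1 [set id] 0%N q0s ltr01 equi0.
have [z [z00 zS]] : exists z : nat -> stage, z 0%N = z0 /\ forall n, next_stage (z n) (z n.+1).
  have [f fP] := choice next_stage_exists.
  by exists (fun n => iter n f z0); split=> // n; exact: fP.
have [k kP] := choice zS.
pose q n := st_map (z n); pose kap n := st_tol (z n); pose C n := st_comps (z n).
have kap0 n : 0 < kap n by exact: st_tol_gt0.
have kap2 n : kap n.+1 <= kap n / 2 by have [[]] := kP n.
have idx n : st_index (z n) = n.
  by elim: n => [|n IH]; [rewrite z00|have [[_ _ ->]] := kP n; rewrite IH].
have Cid n : C n id.
  case: n => [|n]; first by rewrite /C z00.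
  by have [_ + _ _ _] := kP n.
have Ck n c : C n c -> C n.+1 (c \o k n) by have [_ _ + _ _] := kP n; exact.
have qstep n c x : C n c -> `|uval (c (k n (q n.+1 x))) - uval (c (q n x))| <= kap n / 8.
  by have [_ _ _ + _] := kP n; exact.
have qeta n x y : `|uval (q n.+1 x) - uval (q n.+1 y)| < kap n.+1 ->
    mdist x y < n.+2%:R^-1.
  by have [_ _ _ _] := kP n; rewrite idx; exact.
have kc n : csurj (k n) by have [[/adm_csurj]] := kP n.
have kap_small e : 0 < e -> exists j0, forall j, (j0 <= j)%N -> kap j < e.
  move=> e0; have [N Ne] := exists_nat_gt e^-1.
  have kapN j : kap j * j.+1%:R <= 1.
    elim: j => [|j IH]; first by rewrite /kap z00 mulr1.
    have j1 : 1 <= j.+1%:R :> R by rewrite ler1n.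
    rewrite -natr1; have := kap2 j; have := kap0 j.+1; have := kap0 j.
    by move: IH j1; move: (j.+1%:R : R) => a; nra.
  exists N => j Nj; have := kapN j.
  have : e^-1 < j.+1%:R by apply: lt_le_trans Ne _; rewrite ler_nat ltnW.
  have := kap0 j; rewrite -div1r ltr_pdivrMr//.
  by move: (kap j) (j.+1%:R : R) => a b; nra.
pose fix kk m j : I -> I := if j is j'.+1 then kk m j' \o k (m + j')%N else id.
have kkC m j : C (m + j)%N (kk m j).
  by elim: j => [|j IH] /=; [exact: Cid|rewrite addnS; exact: Ck].
have kkc m j : csurj (kk m j).
  elim: j => [|j IH] /=; first exact: csurj_id.
  exact: csurj_comp IH (kc _).
have kkS m j t : k m (kk m.+1 j t) = kk m j.+1 t.
  elim: j t => [|j IH] t /=; first by rewrite addn0.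
  by rewrite IH /= addSnnS.
pose a m j x := uval (kk m j (q (m + j)%N x)).
have aS m x j : `|a m j.+1 x - a m j x| <= kap (m + j)%N / 8.
  by rewrite /a addnS; exact: qstep.
have lim m x : exists l, forall j, `|l - a m j x| <= kap (m + j)%N / 4.
  apply: (nested_limit (kappa := fun j => kap (m + j)%N)).
  - by move=> j; exact/ltW.
  - by move=> j; rewrite addnS.
  - exact: aS.
have [l lP] := choice (fun mx : nat * X => lim mx.1 mx.2).
pose p m x := uclamp (l (m, x)).
have pP m j x : `|uval (p m x) - a m j x| <= kap (m + j)%N / 4.
  apply: le_trans (uclamp_dist _ _) (lP (m, x) j).
  by apply/andP; exact: uval01.
have ac m j : continuous (a m j).
  apply: uval_comp_continuous => x; apply: (continuous_comp (f := q (m + j)%N)).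
    exact: (st_csurj (z (m + j)%N)).1.
  exact: (kkc m j).1.
have pq n x : `|uval (p n x) - uval (q n x)| <= kap n / 4.
  by have := pP n 0%N x; rewrite /a /= addn0.
have pcont m : continuous (fun x => uval (p m x)).
  move=> x; apply/cvgrPdist_lt => e e0.
  have [j0 je] := kap_small e e0; have kj := je (m + j0)%N (leq_addl _ _).
  have e2 : 0 < e / 2 by lra.
  have /cvgrPdist_lt /(_ _ e2) := ac m j0 x; apply: filterS => y.
  have := pP m j0 x; have := pP m j0 y; rewrite !ler_norml !ltr_norml; lra.
exists (st_state \o z), k, p; split.
- by rewrite /= z00.
- by move=> n; have [[]] := kP n.
- move=> m; split; first exact: continuous_into_unit.
  move=> t; have [x0 _] := (st_csurj (z 0%N)).2 t.
  have cd : continuous (fun x => `|uval (p m x) - uval t|).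
    by apply: continuous_norm_sub => // x; exact: cvg_cst.
  (* The approximating maps are onto, so the distance from [p m] to [t] becomes arbitrarily small;
     as its minimum is attained, that minimum is 0. *)
  have [x [x' xmin]] := compact_attains x0 Xcpt cd.
  exists x; apply/uval_inj/eqP; rewrite -subr_eq0 -normr_eq0 eq_le normr_ge0 andbT leNgt.
  apply/negP => d0; have [j0 je] := kap_small _ d0.
  have kj := je (m + j0)%N (leq_addl _ _).
  have [s st] := (kkc m j0).2 t.
  have [y qy] := (st_csurj (z (m + j0)%N)).2 s.
  have := pP m j0 y; rewrite /a /q qy st => pt.
  have [+ _] := xmin y; have := kap0 (m + j0)%N; lra.
- move=> m x; apply/uval_inj/eqP; rewrite -subr_eq0 -normr_eq0 eq_le normr_ge0 andbT leNgt.
  apply/negP => d0.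
  have d2 : 0 < `|uval (k m (p m.+1 x)) - uval (p m x)| / 2 by lra.
  have [d dd dH] := unit_unif_continuous (uval_comp_continuous (kc m).1) d2.
  have [|j0 je] := kap_small (Num.min d (`|uval (k m (p m.+1 x)) - uval (p m x)|)).
    by rewrite lt_min dd.
  have := je (m.+1 + j0)%N (leq_addl _ _); rewrite lt_min => /andP[kj1 kj2].
  have h1 := pP m.+1 j0 x; have h2 := pP m j0.+1 x.
  have /dH : `|uval (p m.+1 x) - uval (kk m.+1 j0 (q (m.+1 + j0)%N x))| < d.
    by rewrite -/(a m.+1 j0 x); have := kap0 (m.+1 + j0)%N; lra.
  rewrite kkS addSnnS => h3.
  have := ler_distD (a m j0.+1 x) (uval (k m (p m.+1 x))) (uval (p m x)).
  rewrite -/(a m j0.+1 x) in h3; rewrite addSnnS in kj2 h1.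
  by rewrite (distrC (a m j0.+1 x)); have := kap0 (m + j0.+1)%N; lra.
- move=> eta eta0; have [N Ne] := exists_nat_gt eta^-1.
  exists N.+1 => -[|n] // Nn x y pxy.
  have xy : mdist x y < n.+2%:R^-1.
    apply: qeta; have := pq n.+1 x; have := pq n.+1 y; rewrite pxy.
    by have := kap0 n.+1; rewrite !ler_norml ltr_norml; lra.
  apply: lt_trans xy _; rewrite invf_plt ?posrE//.
  by apply: lt_trans Ne _; rewrite ltr_nat ltnS ltnW.
Qed.

End Tower.

(** * Unital Cu-morphisms and continuous maps *)

Local Open Scope ereal_scope.

Section ExtNatFacts.
Context {R : realType}.
Implicit Types v w : \bar R.

Lemma extnat_lt1 v : extnat v -> ~ 1%:R%:E <= v -> v = 0%:R%:E.
Proof.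
move=> [->|[[|n] ->]] //; first by rewrite leey.
by rewrite lee_fin ler_nat.
Qed.

Lemma extnat_add1 v w : extnat v -> extnat w -> 1%:R%:E <= v + w ->
  1%:R%:E <= v \/ 1%:R%:E <= w.
Proof.
move=> ev ew vw; apply: contrapT => /not_orP[nv nw]; move: vw.
by rewrite (extnat_lt1 ev nv) (extnat_lt1 ew nw) -EFinD -natrD lee_fin ler_nat.
Qed.

Lemma extnat_addr1 v N : extnat v -> N.+1%:R%:E <= v + 1%:R%:E -> N%:R%:E <= v.
Proof.
move=> [->|[n ->]]; first by move=> _; rewrite leey.
by rewrite -EFinD -natrD !lee_fin !ler_nat addn1.
Qed.

Lemma extnat_add_le1 v w : extnat v -> extnat w -> v + w <= 1%:R%:E ->
  1%:R%:E <= v -> ~ 1%:R%:E <= w.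
Proof.
move=> ev ew vw v1 w1; have : 1%:R%:E + 1%:R%:E <= v + w by exact: leeD.
by move=> /le_trans/(_ vw); rewrite -EFinD -natrD lee_fin ler_nat.
Qed.

End ExtNatFacts.

Section Pull.
Context {R : realType} {X Y : pseudoMetricType R}.
Variables (f : X -> Y) (cf : continuous f).

Let pull_near (u : lsc_fun Y) N x : N%:R%:E <= u (f x) ->
  \forall y \near x, N%:R%:E <= u (f y).
Proof. by move=> /lsc_near; exact: cf. Qed.

Definition lsc_pull (u : lsc_fun Y) : lsc_fun X :=
  lsc_make (fun x => lsc_extnat u (f x)) (@pull_near u).

Lemma lsc_pullE u x : lsc_pull u x = u (f x).
Proof. by []. Qed.

Variables (cX : compact [set: X]) (cY : compact [set: Y]).

Lemma lsc_pull_morphism : cu_morphism (lsc_pull : Lsc cY -> Lsc cX).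
Proof.
split.
- by split=> [|u v]; apply: lsc_eqP.
- by move=> u v /lsc_leP uv; apply/lsc_leP => x; exact: uv.
- move=> u v /way_below_lsc_local uv; apply: lsc_local_way_below => // x.
  have [N [uN Nv]] := uv (f x); exists N; split=> //.
  exact: cf uN.
- move=> z s zle zs; apply: isLub_lsc => [n|N x].
    by apply/lsc_leP => x; have /lsc_leP := zs.1 (z n) (ex_intro2 _ _ n I erefl); apply.
  by move=> /(lsc_lub_ge zs)[n]; exists n.
Qed.

Lemma lsc_pull_embedding : (forall y, exists x, f x = y) ->
  order_embedding (lsc_pull : Lsc cY -> Lsc cX).
Proof.
move=> sf; split; first exact: lsc_pull_morphism.
move=> u v /lsc_leP uv; apply/lsc_leP => y; have [x <-] := sf y; exact: uv.
Qed.

End Pull.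

Section Chi.
Context {R : realType} {X : pseudoMetricType R}.

Definition chi_fun (W : set X) (x : X) : \bar R := if `[< W x >] then 1%:R%:E else 0%:R%:E.

Let chi_ext W x : extnat (chi_fun W x).
Proof. by rewrite /chi_fun; case: ifP => _; exact: extnat_nat. Qed.

Let chi_near W (oW : open W) N x : N%:R%:E <= chi_fun W x ->
  \forall y \near x, N%:R%:E <= chi_fun W y.
Proof.
rewrite {1}/chi_fun; case: asboolP => Wx Nx.
  apply: filterS (open_nbhs_nbhs (conj oW Wx)) => y Wy.
  by rewrite /chi_fun asboolT.
apply: nearW => y; apply: le_trans Nx _.
by rewrite /chi_fun; case: ifP => _; rewrite lee_fin ler_nat.
Qed.

Definition lsc_chi W (oW : open W) : lsc_fun X := lsc_make (chi_ext W) (@chi_near W oW).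

Lemma lsc_chi_in W (oW : open W) x : W x -> lsc_chi oW x = 1%:R%:E.
Proof. by move=> Wx; rewrite /= /chi_fun asboolT. Qed.

Lemma lsc_chi_out W (oW : open W) x : ~ W x -> lsc_chi oW x = 0%:R%:E.
Proof. by move=> Wx; rewrite /= /chi_fun asboolF. Qed.

Lemma lsc_chi_ge1 W (oW : open W) x : 1%:R%:E <= lsc_chi oW x <-> W x.
Proof.
split=> [|Wx]; last by rewrite lsc_chi_in.
by rewrite /= /chi_fun; case: asboolP => // _; rewrite lee_fin ler_nat.
Qed.

End Chi.

Definition cu_muln (S : cuType) (x : S) (n : nat) : S := iter n (cu_add x) 0%Cu.

Lemma cu_morphism_muln (S T : cuType) (f : S -> T) x n : cu_morphism f ->
  f (cu_muln x n) = cu_muln (f x) n.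
Proof.
by move=> [[f0 fD] _ _ _]; elim: n => [//|n IH] /=; rewrite fD IH.
Qed.

Lemma lsc_mulnS (R : realType) (X : pseudoMetricType R) (cX : compact [set: X])
  (u : Lsc cX) n x : (cu_muln u n.+1 : lsc_fun X) x =
    (u : lsc_fun X) x + (cu_muln u n : lsc_fun X) x.
Proof. by []. Qed.

Lemma lsc_muln_ge (R : realType) (X : pseudoMetricType R) (cX : compact [set: X])
  (u : Lsc cX) n x : 1%:R%:E <= (u : lsc_fun X) x ->
  n%:R%:E <= (cu_muln u n : lsc_fun X) x.
Proof.
move=> u1; elim: n => [|n IH]; first exact: lexx.
by rewrite lsc_mulnS -add1n natrD EFinD; exact: leeD.
Qed.

Lemma lsc_muln0 (R : realType) (X : pseudoMetricType R) (cX : compact [set: X])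
  (u : Lsc cX) n x : (u : lsc_fun X) x = 0%:R%:E ->
  (cu_muln u n : lsc_fun X) x = 0%:R%:E.
Proof. by move=> u0; elim: n => [//|n IH]; rewrite lsc_mulnS u0 IH -EFinD -natrD. Qed.

Lemma lsc_muln1 (R : realType) (X : pseudoMetricType R) (cX : compact [set: X])
  (u : Lsc cX) n x : (u : lsc_fun X) x = 1%:R%:E ->
  (cu_muln u n : lsc_fun X) x = n%:R%:E.
Proof. by move=> u1; elim: n => [//|n IH]; rewrite lsc_mulnS u1 IH -EFinD -natrD add1n. Qed.

Lemma lsc_lub_natural (R : realType) (X : pseudoMetricType R) (cX : compact [set: X])
  (u v : Lsc cX) : u \ll v -> exists K : nat, forall x, (u : lsc_fun X) x <= K%:R%:E.
Proof.
move=> uv; have [n /lsc_leP un] : exists n, ((u : lsc_fun X) <= lsc_cst X n)%O.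
  have := uv (fun n => lsc_cst X n) _ (lsc_sup (fun n => lsc_cst X n))
    (lsc_sup_isLub _); apply.
    by move=> m n mn; apply/lsc_leP => x; rewrite lee_fin ler_nat.
  apply/lsc_leP => x; apply: extnat_leP; first exact: lsc_extnat.
  by move=> N _; apply: ereal_sup_ubound; exists N.
by exists n.
Qed.

Local Close Scope ereal_scope.

Lemma way_below_le d (S : porderType d) (x y : S) : x \ll y -> (x <= y)%O.
Proof.
move=> xy; have [||_ //] := xy (fun=> y) _ y _ (lexx y); first by [].
by split=> [_ [_ _ <-]//|z]; apply; exists 0%N.
Qed.

Section FunctionOfMorphism.
Context {R : realType} (X : pseudoMetricType R) (cX : compact [set: X]).
Local Notation UI := (unit_interval R).
Variable alpha : LscI R -> Lsc cX.
Hypothesis am : cu_morphism alpha.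
Hypothesis a1 : alpha (LscI1 R) = lsc_cst X 1.

Definition up_ray (t : R) : set UI := [set s | t < uval s].
Definition dn_ray (t : R) : set UI := [set s | uval s < t].

Lemma up_ray_open t : open (up_ray t).
Proof.
by apply: (@open_comp _ _ _ [set s | t < s]);
  [move=> x _; exact: uval_continuous|exact: open_gt].
Qed.

Lemma dn_ray_open t : open (dn_ray t).
Proof.
by apply: (@open_comp _ _ _ [set s | s < t]);
  [move=> x _; exact: uval_continuous|exact: open_lt].
Qed.

Definition chi_up t : LscI R := lsc_chi (@up_ray_open t).
Definition chi_dn t : LscI R := lsc_chi (@dn_ray_open t).

Let ev (u : LscI R) (x : X) : \bar R := (alpha u : lsc_fun X) x.

Let ev_extnat u x : extnat (ev u x).
Proof. exact: lsc_extnat. Qed.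

Let evD (u v : LscI R) x : ev (u + v)%Cu x = (ev u x + ev v x)%E.
Proof. by have [[_ fD] _ _ _] := am; rewrite /ev fD. Qed.

Let ev_le (u v : LscI R) x : (forall s, (u : lsc_fun UI) s <= (v : lsc_fun UI) s)%E ->
  (ev u x <= ev v x)%E.
Proof. by move=> /lsc_leP uv; have [_ fle _ _] := am; have /lsc_leP := fle _ _ uv; exact. Qed.

Let ev1 x : ev (LscI1 R) x = 1%:R%:E.
Proof. by rewrite /ev a1. Qed.

Let ev0 x : ev 0%Cu x = 0%:R%:E.
Proof. by have [[f0 _] _ _ _] := am; rewrite /ev f0. Qed.

Let ev_muln (u : LscI R) n x : ev (cu_muln u n) x = (cu_muln (alpha u) n : lsc_fun X) x.
Proof. by rewrite /ev cu_morphism_muln. Qed.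

Let ev_lub z s x N : nondecreasing_seq z -> isLub (range z) s ->
  (N%:R%:E <= ev s x)%E -> exists n, (N%:R%:E <= ev (z n) x)%E.
Proof.
move=> zle zs; have [_ _ _ fs] := am; have := fs _ _ zle zs.
by move=> /lsc_lub_ge h /h.
Qed.

Let E (x : X) : set R := [set t | 1%:R%:E <= ev (chi_up t) x]%E.

Let E_anti x s t : s <= t -> E x t -> E x s.
Proof.
move=> st /= Et; apply: le_trans Et _; apply: ev_le => r.
apply: extnat_leP; first exact: lsc_extnat.
case=> [_|[|N]]; first exact/extnat_ge0/lsc_extnat.
  by rewrite !lsc_chi_ge1; exact: le_lt_trans.
move=> /= h; exfalso; move: h.
by rewrite /chi_fun; case: ifP => _; rewrite lee_fin ler_nat.
Qed.

Let E_neg x t : t < 0 -> E x t.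
Proof.
move=> t0; rewrite /E /= -(ev1 x); apply: ev_le => s.
rewrite lsc_chi_in //; have [s0 _] := uval01 s.
exact: lt_le_trans s0.
Qed.

Let E_lt1 x t : E x t -> t < 1.
Proof.
move=> Et; rewrite ltNge; apply/negP => t1; move: Et; rewrite /E /= => /le_trans.
move=> /(_ (ev 0%Cu x)); rewrite ev0 lee_fin ler_nat => h.
suff : false by []; apply: h; rewrite -(ev0 x); apply: ev_le => s.
rewrite lsc_chi_out//= => ts; have [_ s1] := uval01 s.
by have := lt_le_trans ts (le_trans s1 t1); rewrite ltxx.
Qed.

Let f0 x := sup (E x).

Let E_ub x : has_ubound (E x).
Proof. by exists 1 => t /E_lt1/ltW. Qed.

Let f01 x : 0 <= f0 x <= 1.
Proof.
apply/andP; split.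
  rewrite leNgt; apply/negP => fx; have : E x (f0 x / 2) by apply: E_neg; lra.
  by move=> /(ub_le_sup (E_ub x)); rewrite -/(f0 x); lra.
by apply: ge_sup => [|t /E_lt1/ltW//]; exists (-1); apply: E_neg; lra.
Qed.

(** Evaluating [alpha] at [x] is additive and unital, so it should be evaluation at a point; that
    point is where its values on the indicators of the rays [(t, 1]] drop from 1 to 0. *)
Definition morphism_map x : UI := uclamp (f0 x).
Local Notation f := morphism_map.

Let fE x : uval (f x) = f0 x.
Proof. by rewrite uclampK. Qed.

Let chi_up_lub t : isLub (range (fun n => chi_up (t + n.+1%:R^-1))) (chi_up t).
Proof.
apply: isLub_lsc => [n|N s].
  apply/lsc_leP => s; apply: extnat_leP; first exact: lsc_extnat.
  case=> [_|[|N]]; first exact/extnat_ge0/lsc_extnat.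
    rewrite !lsc_chi_ge1 /up_ray /= => h; apply: lt_trans h.
    by rewrite ltrDl invr_gt0.
  move=> /= h; exfalso; move: h.
  by rewrite /chi_fun; case: ifP => _; rewrite lee_fin ler_nat.
have [ts|ts] := ltP t (uval s).
  rewrite lsc_chi_in// lee_fin ler_nat => N1.
  have st : 0 < uval s - t by rewrite subr_gt0.
  have [n nn] := exists_nat_gt (uval s - t)^-1; exists n; rewrite lsc_chi_in.
    by rewrite lee_fin ler_nat.
  rewrite /up_ray /= -ltrBrDl invf_plt ?posrE//; apply: lt_trans nn _.
  by rewrite ltr_nat.
rewrite lsc_chi_out; last by rewrite /up_ray /= ltNge ts.
rewrite lee_fin ler_nat leqn0 => /eqP ->.
by exists 0%N; exact/extnat_ge0/lsc_extnat.
Qed.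

Let chi_dn_lub t : isLub (range (fun n => chi_dn (t - n.+1%:R^-1))) (chi_dn t).
Proof.
apply: isLub_lsc => [n|N s].
  apply/lsc_leP => s; apply: extnat_leP; first exact: lsc_extnat.
  case=> [_|[|N]]; first exact/extnat_ge0/lsc_extnat.
    rewrite !lsc_chi_ge1 /dn_ray /= => h; apply: (lt_trans h).
    by rewrite ltrBlDr ltrDl invr_gt0.
  move=> /= h; exfalso; move: h.
  by rewrite /chi_fun; case: ifP => _; rewrite lee_fin ler_nat.
have [ts|ts] := ltP (uval s) t.
  rewrite lsc_chi_in// lee_fin ler_nat => N1.
  have st : 0 < t - uval s by rewrite subr_gt0.
  have [n nn] := exists_nat_gt (t - uval s)^-1; exists n; rewrite lsc_chi_in.
    by rewrite lee_fin ler_nat.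
  rewrite /dn_ray /= ltrBrDr -ltrBrDl invf_plt ?posrE//; apply: lt_trans nn _.
  by rewrite ltr_nat.
rewrite lsc_chi_out; last by rewrite /dn_ray /= ltNge ts.
rewrite lee_fin ler_nat leqn0 => /eqP ->.
by exists 0%N; exact/extnat_ge0/lsc_extnat.
Qed.

Let chi_le (W V : set UI) (oW : open W) (oV : open V) : W `<=` V ->
  (lsc_chi oW <= lsc_chi oV)%O.
Proof.
move=> WV; apply/lsc_leP => s; have [Ws|Ws] := pselect (W s).
  by rewrite !lsc_chi_in//; exact: WV.
by rewrite lsc_chi_out//; exact/extnat_ge0/lsc_extnat.
Qed.

Let inv_mono m n : (m <= n)%N -> n.+1%:R^-1 <= m.+1%:R^-1 :> R.
Proof. by move=> mn; rewrite lef_pV2 ?posrE// ler_nat. Qed.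

(** The inequality is strict because [chi_up t] is the supremum of rays with larger endpoints and
    [alpha] preserves it: the set of admissible [t] has no maximum. *)
Lemma lt_morphism_map t x : t < uval (f x) <-> (1%:R%:E <= ev (chi_up t) x)%E.
Proof.
rewrite fE; split=> [tf|Et].
  have [|t' Et' /ltW tt'] := sup_gt _ tf; first by exists (-1); apply: E_neg; lra.
  exact: E_anti tt' Et'.
have [|n] := ev_lub _ (chi_up_lub t) Et.
  move=> m n mn; apply: chi_le => s; rewrite /up_ray /=.
  by apply: le_lt_trans; rewrite lerD2l; exact: inv_mono.
move=> /(ub_le_sup (E_ub x)); apply: lt_le_trans.
by rewrite ltrDl invr_gt0.
Qed.

(** Additivity and unitality exchange the two kinds of rays: for [s < t] the rays below [t] and
    above [s] cover the interval, so their images sum to at least 1; the rays below and above one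
    level are disjoint, so theirs sum to at most 1. *)
Lemma morphism_map_lt t x : uval (f x) < t <-> (1%:R%:E <= ev (chi_dn t) x)%E.
Proof.
split=> [ft|Dt].
  pose s := (uval (f x) + t) / 2.
  have nE : ~ (1%:R%:E <= ev (chi_up s) x)%E.
    by move=> /lt_morphism_map; rewrite /s; lra.
  have : (1%:R%:E <= ev (chi_dn t) x + ev (chi_up s) x)%E.
    rewrite -evD -(ev1 x); apply: ev_le => r.
    have [rt|rt] := ltP (uval r) t.
      rewrite -[leLHS]adde0; apply: leeD; last exact/extnat_ge0/lsc_extnat.
      by rewrite lsc_chi_in.
    rewrite -[leLHS]add0e; apply: leeD; first exact/extnat_ge0/lsc_extnat.
    by rewrite lsc_chi_in// /up_ray /s /=; lra.
  by move=> /extnat_add1[] //; exact: ev_extnat.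
have [|n Dn] := ev_lub _ (chi_dn_lub t) Dt.
  move=> m n mn; apply: chi_le => s; rewrite /dn_ray /= => h; apply: (lt_le_trans h).
  by rewrite lerD2l lerN2; exact: inv_mono.
have n0 : 0 < n.+1%:R^-1 :> R by rewrite invr_gt0.
set s := t - n.+1%:R^-1 in Dn.
have st : s < t by rewrite /s ltrBlDr ltrDl.
apply: le_lt_trans st; rewrite leNgt; apply/negP => /lt_morphism_map Us.
apply: (extnat_add_le1 (ev_extnat _ _) (ev_extnat _ _) _ Dn Us).
rewrite -evD -(ev1 x); apply: ev_le => r.
have [rt|rt] := ltP (uval r) s.
  have -> : (chi_dn s + chi_up s : LscI R)%Cu r = (chi_dn s r + chi_up s r)%E by [].
  rewrite lsc_chi_in// lsc_chi_out; first by rewrite -EFinD -natrD.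
  by rewrite /up_ray /= => /(lt_trans rt); rewrite ltxx.
have -> : (chi_dn s + chi_up s : LscI R)%Cu r = (chi_dn s r + chi_up s r)%E by [].
rewrite (lsc_chi_out (W := dn_ray s)); last by rewrite /dn_ray /= ltNge rt.
have [rs|rs] := ltP s (uval r); first by rewrite lsc_chi_in// -EFinD -natrD.
rewrite lsc_chi_out; last by rewrite /up_ray /= ltNge rs.
by rewrite -EFinD -natrD lee_fin ler_nat.
Qed.

Lemma morphism_map_continuous : continuous f.
Proof.
apply: continuous_into_unit => x; apply/cvgrPdist_lt => e e0.
have : \forall y \near x, (1%:R%:E <= ev (chi_up (uval (f x) - e)) y)%E.
  by apply: lsc_near; apply/lt_morphism_map; lra.
have : \forall y \near x, (1%:R%:E <= ev (chi_dn (uval (f x) + e)) y)%E.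
  by apply: lsc_near; apply/morphism_map_lt; lra.
apply: filterS2 => y /morphism_map_lt h1 /lt_morphism_map h2.
by rewrite ltr_norml; lra.
Qed.

Lemma morphism_mapE (u : LscI R) x : ev u x = (u : lsc_fun UI) (f x).
Proof.
apply/eqP; rewrite eq_le; apply/andP; split; last first.
  apply: extnat_leP; first exact: lsc_extnat.
  move=> N /lsc_near/nbhs_ballP[e /= e0 eu].
  (* An interval around [f x] on which [u >= N]. Its indicator [w] satisfies
     [chi_up + chi_dn <= w + 1], so [alpha w] is at least 1 at [x], and [N] copies of [w] lie below
     [u]. *)
  have oB : open (up_ray (uval (f x) - e) `&` dn_ray (uval (f x) + e)).
    by apply: openI; [exact: up_ray_open|exact: dn_ray_open].
  pose w : LscI R := lsc_chi oB.
  have wx : (1%:R%:E <= ev w x)%E.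
    apply: extnat_addr1; first exact: ev_extnat.
    have h1 : (1%:R%:E <= ev (chi_up (uval (f x) - e)) x)%E by apply/lt_morphism_map; lra.
    have h2 : (1%:R%:E <= ev (chi_dn (uval (f x) + e)) x)%E by apply/morphism_map_lt; lra.
    have := leeD h1 h2; rewrite -EFinD -natrD => /le_trans; apply.
    rewrite -(ev1 x) -!evD; apply: ev_le => s.
    have [us|us] := pselect (up_ray (uval (f x) - e) s); last first.
      have -> : (chi_up (uval (f x) - e) + chi_dn (uval (f x) + e) : LscI R)%Cu s =
        (chi_up (uval (f x) - e) s + chi_dn (uval (f x) + e) s)%E by [].
      rewrite lsc_chi_out//; apply: leeD; first exact/extnat_ge0/lsc_extnat.
      have [ds|ds] := pselect (dn_ray (uval (f x) + e) s); first by rewrite lsc_chi_in.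
      by rewrite lsc_chi_out// lee_fin ler_nat.
    have -> : (chi_up (uval (f x) - e) + chi_dn (uval (f x) + e) : LscI R)%Cu s =
      (chi_up (uval (f x) - e) s + chi_dn (uval (f x) + e) s)%E by [].
    have -> : (w + LscI1 R)%Cu s = (w s + 1%:R%:E)%E by [].
    have [ds|ds] := pselect (dn_ray (uval (f x) + e) s).
      by rewrite !lsc_chi_in.
    rewrite addeC [(w s + _)%E]addeC (lsc_chi_in _ us) (lsc_chi_out _ ds).
    rewrite addeC; apply: leeD => //; exact/extnat_ge0/lsc_extnat.
  apply: (@le_trans _ _ (ev (cu_muln w N) x)); first by rewrite ev_muln; exact: lsc_muln_ge.
  apply: ev_le => s.
  have [ws|ws] := pselect ((up_ray (uval (f x) - e) `&` dn_ray (uval (f x) + e)) s).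
    rewrite (@lsc_muln1 _ _ _ w); last exact: lsc_chi_in.
    apply: eu; apply/unit_ballE; case: ws; rewrite /up_ray /dn_ray /= ltr_norml; lra.
  rewrite (@lsc_muln0 _ _ _ w); last exact: lsc_chi_out.
  exact/extnat_ge0/lsc_extnat.
apply: extnat_leP; first exact: lsc_extnat.
move=> N; have [z [zz zu]] := cu_O2 u.
have zle : nondecreasing_seq z.
  by apply/nondecreasing_seqP => n; apply: way_below_le; exact: zz.
move=> /(ev_lub zle zu)[n Nz].
have [K zK] := lsc_lub_natural (zz n).
have [M [zM Mz]] := way_below_lsc_local (zz n) (f x).
have {Mz}Mu : (M%:R%:E <= (u : lsc_fun UI) (f x))%E.
  by apply: le_trans Mz _; have /lsc_leP := zu.1 (z n.+1) (ex_intro2 _ _ n.+1 I erefl); exact.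
apply: le_trans Mu; apply: le_trans Nz _.
have /nbhs_ballP[e /= e0 ez] := zM.
(* [z n] is at most [M] near [f x] and at most [K] elsewhere, so it lies below [M] plus [K] copies
   of two rays that stay away from [f x]. The images of these rays vanish at [x]. *)
pose a := uval (f x) - e / 2; pose b := uval (f x) + e / 2.
apply: (@le_trans _ _ (ev (cu_muln (LscI1 R) M + cu_muln (chi_dn a + chi_up b) K)%Cu x)).
  apply: ev_le => s.
  have -> : (cu_muln (LscI1 R) M + cu_muln (chi_dn a + chi_up b) K)%Cu s =
    (lsc_val (cu_muln (LscI1 R) M) s + lsc_val (cu_muln (chi_dn a + chi_up b)%Cu K) s)%E by [].
  have [sab|sab] := pselect (`|uval (f x) - uval s| < e).
    rewrite -[leLHS]adde0; apply: leeD; last exact/extnat_ge0/lsc_extnat.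
    by rewrite lsc_muln1//; apply: ez; exact/unit_ballE.
  rewrite -[leLHS]add0e; apply: leeD; first exact/extnat_ge0/lsc_extnat.
  apply: le_trans (zK s) _; apply: lsc_muln_ge.
  have -> : (chi_dn a + chi_up b : LscI R)%Cu s = (chi_dn a s + chi_up b s)%E by [].
  have [sa|sa] := ltP (uval s) a.
    rewrite -[leLHS]adde0; apply: leeD; last exact/extnat_ge0/lsc_extnat.
    by rewrite lsc_chi_in.
  rewrite -[leLHS]add0e; apply: leeD; first exact/extnat_ge0/lsc_extnat.
  rewrite lsc_chi_in// /up_ray /= ltNge; apply/negP => sb; apply: sab.
  by move: sa sb; rewrite /a /b ltr_norml; lra.
rewrite evD !ev_muln lsc_muln1 ?a1// lsc_muln0; first by rewrite -EFinD -natrD addn0.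
have -> : ((alpha (chi_dn a + chi_up b)%Cu : lsc_fun X) x) = ev (chi_dn a + chi_up b)%Cu x by [].
have d0 : ev (chi_dn a) x = 0%:R%:E.
  by apply: extnat_lt1; [exact: ev_extnat|move/morphism_map_lt; rewrite /a; lra].
have u0 : ev (chi_up b) x = 0%:R%:E.
  by apply: extnat_lt1; [exact: ev_extnat|move/lt_morphism_map; rewrite /b; lra].
by rewrite evD d0 u0 -EFinD -natrD.
Qed.

End FunctionOfMorphism.

(** * Limits in Cu *)

Section CuOrder.
Implicit Types S T : cuType.

Lemma way_below_ler S (x y z : S) : x \ll y -> (y <= z)%O -> x \ll z.
Proof. by move=> xy yz w wle s ws zs; apply: (xy w wle s ws); exact: le_trans zs. Qed.

Lemma way_below_lel S (x y z : S) : (x <= y)%O -> y \ll z -> x \ll z.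
Proof.
by move=> xy yz w wle s ws zs; have [n yn] := yz w wle s ws zs; exists n; exact: le_trans yn.
Qed.

Lemma way_below_nondecreasing S (z : nat -> S) :
  (forall n, z n \ll z n.+1) -> nondecreasing_seq z.
Proof. by move=> zz; apply/nondecreasing_seqP => n; exact: way_below_le. Qed.

Lemma lub_ge S (z : nat -> S) s n : isLub (range z) s -> (z n <= s)%O.
Proof. by move=> [zs _]; apply: zs; exists n. Qed.

Lemma lub_le S (z : nat -> S) s t : isLub (range z) s ->
  (forall n, (z n <= t)%O) -> (s <= t)%O.
Proof. by move=> [_ zs] zt; apply: zs => _ [n _ <-]. Qed.

Lemma lub_unique S (z : nat -> S) s t : isLub (range z) s -> isLub (range z) t -> s = t.
Proof.
move=> zs zt; apply/le_anti; rewrite (lub_le zs) ?(lub_le zt)// => n; exact: lub_ge.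
Qed.

Lemma isLubP S (z : nat -> S) s : (forall n, (z n <= s)%O) ->
  (forall t, (forall n, (z n <= t)%O) -> (s <= t)%O) -> isLub (range z) s.
Proof.
move=> zs st; split; first by move=> _ [n _ <-].
by move=> t zt; apply: st => n; apply: zt; exists n.
Qed.

Lemma way_below_lub S (z : nat -> S) s n : (forall n, z n \ll z n.+1) ->
  isLub (range z) s -> z n \ll s.
Proof. by move=> zz zs; apply: way_below_ler (zz n) _; exact: lub_ge. Qed.

Lemma dense_sequence S (D : Type) (t : D -> S) :
  (forall x' x, x' \ll x -> exists d, (x' <= t d)%O /\ (t d <= x)%O) ->
  forall x, exists d : nat -> D,
    (forall n, t (d n) \ll t (d n.+1)) /\ isLub (range (t \o d)) x.
Proof.
move=> dense x; have [w [ww wx]] := cu_O2 x.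
(* Every second gap of [w] is filled; the skipped gaps provide the way-below relation between
   consecutive terms. *)
have [d dP] := choice (fun n => dense _ _ (ww n.*2)); exists d; split=> [n|].
  apply: way_below_lel (dP n).2 _; apply: way_below_ler (ww _) _.
  by have [+ _] := dP n.+1; rewrite doubleS.
apply: isLubP => [n|s ub]; first exact: le_trans (dP n).2 (lub_ge _ wx).
apply: (lub_le wx) => n; apply: le_trans (le_trans (dP n).1 (ub n)).
by apply: way_below_nondecreasing ww _ _ _; rewrite -addnn leq_addr.
Qed.

End CuOrder.

(* t embeds D as a dense part of L, on which g prescribes a morphism. *)
Section DenseExtension.
Variables (L T : cuType) (D : Type) (t : D -> L) (g : D -> T).
Hypothesis g_le : forall d e, (t d <= t e)%O -> (g d <= g e)%O.
Hypothesis g_ll : forall d e, t d \ll t e -> g d \ll g e.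
Hypothesis g_sup : forall d, exists e : nat -> D,
  (forall n, t (e n) \ll t d) /\ isLub (range (g \o e)) (g d).
Hypothesis g_add : forall d e, exists c, t c = (t d + t e)%Cu /\ g c = (g d + g e)%Cu.
Hypothesis g_zero : exists c, t c = 0%Cu /\ g c = 0%Cu.
Hypothesis t_dense : forall x, exists d : nat -> D,
  (forall n, t (d n) \ll t (d n.+1)) /\ isLub (range (t \o d)) x.

(** All approximating sequences are quantified over at once, so that each later argument can choose
    a convenient one; two of them interleave by the definition of way-below. *)
Let ext_spec x (y : T) := forall d : nat -> D, (forall n, t (d n) \ll t (d n.+1)) ->
  isLub (range (t \o d)) x -> isLub (range (g \o d)) y.

Let g_mono (d : nat -> D) : (forall n, t (d n) \ll t (d n.+1)) ->
  nondecreasing_seq (g \o d).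
Proof. by move=> dd; apply: way_below_nondecreasing => n; exact/g_ll/dd. Qed.

Let ext_exists x : exists y, ext_spec x y.
Proof.
have [d [dd dx]] := t_dense x; have [y gy] := cu_O1 _ (g_mono dd).
have cross (d1 d2 : nat -> D) : (forall n, t (d1 n) \ll t (d1 n.+1)) ->
    (forall n, t (d2 n) \ll t (d2 n.+1)) -> isLub (range (t \o d1)) x ->
    isLub (range (t \o d2)) x -> forall n, exists m, (g (d1 n) <= g (d2 m))%O.
  move=> dd1 dd2 l1 l2 n.
  have := way_below_lub n dd1 l1.
  move=> /(_ _ (way_below_nondecreasing (z := t \o d2) dd2) _ l2 (lexx x)) [m h].
  by exists m; exact: g_le.
exists y => d' dd' dx'; apply: isLubP => [n|s ub].
  by have [m h] := cross _ _ dd' dd dx' dx n; apply: le_trans h (lub_ge m gy).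
apply: (lub_le gy) => n; have [m h] := cross _ _ dd dd' dx dx' n.
exact: le_trans h (ub m).
Qed.

Let psi x := projT1 (cid (ext_exists x)).
Let psiP x : ext_spec x (psi x). Proof. exact: projT2 (cid (ext_exists x)). Qed.

Let psi_ge d x : t d \ll x -> (g d <= psi x)%O.
Proof.
move=> dx; have [e [ee ex]] := t_dense x.
have [n tn] := dx _ (way_below_nondecreasing (z := t \o e) ee) _ ex (lexx x).
exact: le_trans (g_le tn) (lub_ge n (psiP ee ex)).
Qed.

Let psi_le x y : (forall d, t d \ll x -> (g d <= y)%O) -> (psi x <= y)%O.
Proof.
move=> xy; have [e [ee ex]] := t_dense x; apply: (lub_le (psiP ee ex)) => n.
by apply: xy; exact: (way_below_lub (z := t \o e)).
Qed.

Let psi_t d : psi (t d) = g d.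
Proof.
apply/le_anti; rewrite psi_le/=; last by move=> e /way_below_le; exact: g_le.
have [e [ed gd]] := g_sup d; apply: (lub_le gd) => n; exact/psi_ge/ed.
Qed.

Let psi_homo : {homo psi : x y / (x <= y)%O}.
Proof. by move=> x y xy; apply: psi_le => d dx; apply: psi_ge; exact: way_below_ler xy. Qed.

Let psi_morphism : cu_morphism psi.
Proof.
split.
- split.
    by have [c [tc gc]] := g_zero; rewrite -tc psi_t gc.
  move=> x y; have [d [dd dx]] := t_dense x; have [e [ee ey]] := t_dense y.
  have [c cP] := choice (fun n => g_add (d n) (e n)).
  have tc : t \o c = fun n => (t (d n) + t (e n))%Cu.
    by apply/funext => n; exact: (cP n).1.
  have gc : g \o c = fun n => (g (d n) + g (e n))%Cu.
    by apply/funext => n; exact: (cP n).2.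
  have cc n : t (c n) \ll t (c n.+1).
    by rewrite !(cP _).1; exact: cu_O3.
  have cxy : isLub (range (t \o c)) (x + y)%Cu.
    rewrite tc; exact: (cu_O4 (t \o d) (t \o e) _ _ (way_below_nondecreasing (z := t \o d) dd)
      (way_below_nondecreasing (z := t \o e) ee) dx ey).
  apply: (lub_unique (psiP cc cxy)); rewrite gc.
  exact: (cu_O4 (g \o d) (g \o e) _ _ (g_mono dd) (g_mono ee) (psiP dd dx) (psiP ee ey)).
- exact: psi_homo.
- move=> x y xy; have [e [ee ey]] := t_dense y.
  have [n tn] := xy _ (way_below_nondecreasing (z := t \o e) ee) _ ey (lexx y).
  apply: (@way_below_lel _ _ (g (e n))); first by rewrite -psi_t; exact: psi_homo.
  apply: (way_below_ler (g_ll (ee n))).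
  exact: (lub_ge (z := g \o e) n.+1 (psiP ee ey)).
- move=> z s zle zs; apply: isLubP => [n|y ub].
    by apply: psi_homo; exact: lub_ge.
  have [e [ee ex]] := t_dense s; apply: (lub_le (psiP ee ex)) => n.
  have [m h] := way_below_lub (z := t \o e) n.+1 ee ex zle zs (lexx s).
  apply: le_trans (ub m); apply: psi_ge; exact: way_below_ler (ee n) h.
Qed.

Lemma dense_extension : exists! h : L -> T, cu_morphism h /\ forall d, h (t d) = g d.
Proof.
exists psi; split=> [//|h [[_ _ _ hsup] ht]]; apply/funext => x.
have [e [ee ex]] := t_dense x.
apply: (lub_unique (psiP ee ex)).
have -> : g \o e = h \o (t \o e) by apply/funext => n /=; rewrite ht.
exact: (hsup _ _ (way_below_nondecreasing (z := t \o e) ee) ex).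
Qed.

End DenseExtension.

(** The dense part is the disjoint union of the stages. Finitely many of its elements can be moved
    to a common stage, where [tau] reflects the order, and this makes [phi] monotone with respect to
    the order of [L]. *)
Lemma cu_limit_of_dense (C : subcategory) (S : ind_seq C) (L : cuType)
    (tau : forall i, ob_cu (seq_ob S i) -> L) :
  cocone tau -> (forall i, order_embedding (tau i)) ->
  (forall x' x, x' \ll x -> exists i y, (x' <= tau i y)%O /\ (tau i y <= x)%O) ->
  is_cu_limit S L.
Proof.
move=> tauC taue dense; exists tau; split=> // T phi phiC.
pose D := {i : nat & ob_cu (seq_ob S i)}.
pose t (d : D) := tau (tag d) (tagged d).
pose g (d : D) := phi (tag d) (tagged d).
have push (d : D) j : (tag d <= j)%N -> exists y, t d = tau j y /\ g d = phi j y.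
  by move=> ij; exists (seq_map ij (tagged d)); rewrite tauC.2 phiC.2.
have push2 (d e : D) : exists j y z,
    [/\ t d = tau j y, g d = phi j y, t e = tau j z & g e = phi j z].
  have [y [ty gy]] := push d (maxn (tag d) (tag e)) (leq_maxl _ _).
  have [z [tz gz]] := push e (maxn (tag d) (tag e)) (leq_maxr _ _).
  by exists (maxn (tag d) (tag e)), y, z.
have [] := @dense_extension L T D t g.
- move=> d e; have [j [y [z [-> -> -> ->]]]] := push2 d e.
  by move=> /(taue j).2; have [_ h _ _] := phiC.1 j; exact: h.
- move=> d e; have [j [y [z [-> -> -> ->]]]] := push2 d e => yz.
  (* Way-below descends to the stage: [tau j] carries a sequence way-below increasing to [z] to one
     with supremum [tau j z], so some [w n] already dominates [y]. *)
  have [w [ww wz]] := cu_O2 z; have [_ _ tll tsup] := tauC.1 j.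
  have wle := way_below_nondecreasing ww.
  have [|n h] := yz _ _ _ (tsup _ _ wle wz) (lexx _).
    by move=> m n mn; have [_ h _ _] := tauC.1 j; exact/h/wle.
  have [_ _ pll _] := phiC.1 j; apply: pll; apply: way_below_lel ((taue j).2 _ _ h) _.
  exact: way_below_lub.
- move=> [i y]; have [w [ww wy]] := cu_O2 y.
  exists (fun n => existT _ i (w n)); split=> [n|].
    have [_ _ tll _] := tauC.1 i; apply: tll; exact: way_below_lub.
  have [_ _ _ psup] := phiC.1 i; apply: (psup w y) => //.
  exact: way_below_nondecreasing.
- move=> d e; have [j [y [z [-> -> -> ->]]]] := push2 d e.
  exists (existT _ j (y + z)%Cu); rewrite /t /g /=.
  by have [[_ ->] _ _ _] := tauC.1 j; have [[_ ->] _ _ _] := phiC.1 j.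
- exists (existT _ 0%N 0%Cu); rewrite /t /g /=.
  by have [[-> _] _ _ _] := tauC.1 0%N; have [[-> _] _ _ _] := phiC.1 0%N.
- apply: dense_sequence => x' x /dense[i [y h]].
  by exists (existT _ i y).
move=> h [[hm ht] hu]; exists h; split.
  by split=> // i x; rewrite -[LHS]/(h (t (existT _ i x))) ht.
by move=> h' [h'm h't]; apply: hu; split=> // -[i x]; exact: h't.
Qed.

(** * Comparison of morphisms and of maps *)

Section UnitalMaps.
Variable R : realType.
Local Notation UI := (unit_interval R).

Lemma KP_hom_pull (f : UI -> UI) (cf : csurj f) :
  KP_hom (lsc_pull cf.1 : LscI R -> LscI R).
Proof. by split; [exact: lsc_pull_embedding cf.2|exact: lsc_eqP]. Qed.

Lemma KP_hom_mapE (a : LscI R -> LscI R) : KP_hom a ->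
  forall (u : LscI R) s, (a u : lsc_fun UI) s = (u : lsc_fun UI) (morphism_map a s).
Proof. by move=> [[am _] a1] u s; exact: morphism_mapE. Qed.

(** If the map stayed above some level [m > 0], the indicator of [[0, m)] would be sent to 0, which
    an order-embedding forbids. The same holds at the other end, and connectedness fills in the
    rest. *)
Lemma KP_hom_csurj (a : LscI R -> LscI R) : KP_hom a -> csurj (morphism_map a).
Proof.
move=> ha; have aE := KP_hom_mapE ha; have [[am ae] a1] := ha.
have cf : continuous (morphism_map a) by exact: morphism_map_continuous.
split=> //; have cv := uval_comp_continuous cf.
have [x [y xy]] := compact_attains (uclamp 0) (@unit_interval_compact R) cv.
have ax : uval (morphism_map a x) <= 0.
  rewrite leNgt; apply/negP => x0.
  have : (chi_dn (uval (morphism_map a x)) <= 0%Cu :> LscI R)%O.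
    apply: ae; have [[-> _] _ _ _] := am; apply/lsc_leP => s.
    rewrite aE lsc_chi_out// /dn_ray /= => sx; have := (xy s).1.
    by rewrite leNgt sx.
  move=> /lsc_leP /(_ (uclamp 0)); rewrite lsc_chi_in ?lee_fin ?ler_nat//.
  by rewrite /dn_ray /= uclampK// lexx ler01.
have ay : 1 <= uval (morphism_map a y).
  rewrite leNgt; apply/negP => y1.
  have : (chi_up (uval (morphism_map a y)) <= 0%Cu :> LscI R)%O.
    apply: ae; have [[-> _] _ _ _] := am; apply/lsc_leP => s.
    rewrite aE lsc_chi_out// /up_ray /= => sx; have := (xy s).2.
    by rewrite leNgt sx.
  move=> /lsc_leP /(_ (uclamp 1)); rewrite lsc_chi_in ?lee_fin ?ler_nat//.
  by rewrite /up_ray /= uclampK// lexx ler01.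
move=> t; have [t0 t1] := uval01 t.
have [||s st] := @connected_IVT R UI (fun s => uval (morphism_map a s)) x y (uval t)
  (@unit_connected R) cv; [lra|lra|].
by exists s; exact: uval_inj.
Qed.

Lemma lsc_separates (s t : UI) : (forall u : LscI R, (u : lsc_fun UI) s = (u : lsc_fun UI) t) ->
  s = t.
Proof.
move=> H; apply: uval_inj; apply/eqP; rewrite eq_le; apply/andP.
split; rewrite leNgt; apply/negP => st.
  have := H (chi_up (uval t)); rewrite lsc_chi_in// lsc_chi_out.
    by move=> /eqP; rewrite eqe eqr_nat.
  by rewrite /up_ray /= ltxx.
have := H (chi_up (uval s)); rewrite lsc_chi_out; last by rewrite /up_ray /= ltxx.
by rewrite lsc_chi_in// => /eqP; rewrite eqe eqr_nat.
Qed.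

Lemma chi_up_ll (a b : R) : a < b -> (chi_up b : LscI R) \ll chi_up a.
Proof.
move=> ab; apply: lsc_local_way_below; first exact: unit_interval_compact.
move=> s; have [sa|sa] := ltP a (uval s).
  exists 1%N; split; last by rewrite lsc_chi_in.
  have sT : [set: UI] s by [].
  apply: filterS (open_nbhs_nbhs (conj openT sT)) => r _.
  have [rb|rb] := pselect (up_ray b r).
    by rewrite lsc_chi_in.
  by rewrite lsc_chi_out// lee_fin ler_nat.
exists 0%N; split; last exact/extnat_ge0/lsc_extnat.
have sb : dn_ray b s by rewrite /dn_ray /=; lra.
apply: filterS (open_nbhs_nbhs (conj (@dn_ray_open R b) sb)) => r rb.
by rewrite lsc_chi_out// /up_ray /= => br; have := lt_trans rb br; rewrite ltxx.
Qed.

Definition ray_grid (n : nat) : set (LscI R) :=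
  [set chi_up (k%:R / n%:R) | k in [set k | (k < n.+1)%N]].

Lemma ray_grid_finite n : finite_set (ray_grid n).
Proof. by apply: finite_image; exact: finite_II. Qed.

(** Comparing consecutive rays says that [f s > (k + 1) / n] forces [g s > k / n], and conversely. A
    difference above [2 / n] is refuted at the least [k] with [g s <= k / n]. *)
Lemma ray_grid_close n (a b : LscI R -> LscI R) (f g : UI -> UI) : (0 < n)%N ->
  (forall (u : LscI R) s, (a u : lsc_fun UI) s = (u : lsc_fun UI) (f s)) ->
  (forall (u : LscI R) s, (b u : lsc_fun UI) s = (u : lsc_fun UI) (g s)) ->
  fin_compare (ray_grid n) a b -> forall s, `|uval (f s) - uval (g s)| <= 2 / n%:R.
Proof.
move=> n0 aE bE ab s.
have nR : 0 < n%:R :> R by rewrite ltr0n.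
have key (f' g' : UI) : (forall k, (k < n)%N -> k.+1%:R / n%:R < uval f' ->
    k%:R / n%:R < uval g') -> uval f' <= uval g' + 2 / n%:R.
  move=> H; rewrite leNgt; apply/negP => fg.
  have [f0 f1] := uval01 f'; have [g0 g1] := uval01 g'.
  have ex : exists k : nat, uval g' <= k%:R / n%:R.
    by exists n; rewrite mulfV// gt_eqF.
  case: (ex_minnP ex) => k gk kmin.
  have kg : k%:R / n%:R <= uval g' + n%:R^-1.
    case: k gk kmin => [|k] gk kmin; first by rewrite mul0r addr_ge0// invr_ge0 ltW.
    rewrite -natr1 mulrDl mul1r lerD2r leNgt; apply/negP => gk'.
    by have := kmin k (ltW gk'); rewrite ltnn.
  have kf : k.+1%:R / n%:R < uval f'.
    by apply: le_lt_trans fg; rewrite -natr1 mulrDl mul1r; lra.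
  have kn : (k < n)%N.
    have : k.+1%:R / n%:R < 1 :> R by exact: lt_le_trans kf f1.
    by rewrite ltr_pdivrMr// mul1r ltr_nat => /ltnW.
  by have := H k kn kf; rewrite ltNge gk.
have step (k : nat) : (k < n)%N -> (a (chi_up (k.+1%:R / n%:R)) <= b (chi_up (k%:R / n%:R)))%O /\
    (b (chi_up (k.+1%:R / n%:R)) <= a (chi_up (k%:R / n%:R)))%O.
  move=> kn; apply: ab.
  - by exists k.+1.
  - by exists k => //=; rewrite ltnW.
  - by apply: chi_up_ll; rewrite ltr_pM2r ?invr_gt0// ltr_nat.
have ge1 (t c : R) (u v : UI) : c < uval u -> 
    (lsc_val (chi_up c) u <= lsc_val (chi_up t) v)%E -> t < uval v.
  by move=> cu; rewrite lsc_chi_in// => /lsc_chi_ge1.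
have h1 : uval (f s) <= uval (g s) + 2 / n%:R.
  apply: key => k kn kf; have [/lsc_leP/(_ s) + _] := step k kn.
  by rewrite aE bE; exact: ge1.
have h2 : uval (g s) <= uval (f s) + 2 / n%:R.
  apply: key => k kn kf; have [_ /lsc_leP/(_ s)] := step k kn.
  by rewrite aE bE; exact: ge1.
by rewrite ler_norml; lra.
Qed.

End UnitalMaps.

Lemma finite_min_gt0 (R : realType) (T : choiceType) (A : set T) (d : T -> R) :
  finite_set A -> (forall a, 0 < d a) ->
  exists2 m, 0 < m & forall a, A a -> m <= d a.
Proof.
move=> /finite_seqP[s ->] d0; elim: s => [|a s [m m0 ms]]; first by exists 1.
exists (Num.min (d a) m); first by rewrite lt_min d0.
move=> b; rewrite /= inE => /predU1P[->|bs]; first by rewrite ge_min lexx.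
by rewrite ge_min (ms b)// orbT.
Qed.

Section LebesgueNumber.
Context {R : realType} (X : pseudoMetricType R) (cX : compact [set: X]).

(** Near each point some integer separates [u] from [v], and [d] is a Lebesgue number for these
    neighbourhoods. This is how uniform closeness of maps yields comparison of their pullbacks. *)
Lemma way_below_lebesgue (u v : Lsc cX) : u \ll v ->
  exists2 d, 0 < d & forall x y, ball x d y ->
    ((u : lsc_fun X) x <= (v : lsc_fun X) y)%E.
Proof.
move=> /way_below_lsc_local uv; have /compact_near_coveringP nc := cX.
have : \forall n \near \oo, [set: X] `<=` (fun x => forall y, ball x n.+1%:R^-1 y ->
    ((u : lsc_fun X) x <= (v : lsc_fun X) y)%E).
  apply: nc => x _; have [N [uN /lsc_near Nv]] := uv x.
  have /nbhs_ballP[e /= e0 eN] : \forall y \near x,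
      ((u : lsc_fun X) y <= N%:R%:E)%E /\ (N%:R%:E <= (v : lsc_fun X) y)%E.
    by apply: filterS2 uN Nv => y.
  have e2 : 0 < e / 2 by lra.
  have e2e : e / 2 <= e by lra.
  exists (ball x (e / 2), [set n | n.+1%:R^-1 < e / 2]) => /=.
    split; first exact: nbhsx_ballx.
    exact: (near_infty_natSinv_lt (PosNum e2)).
  move=> [z n] [/= xz nz] y zy.
  have [zN _] := eN z (le_ball e2e xz).
  apply: le_trans zN _; apply: (eN y _).2.
  rewrite (splitr e); apply: ball_triangle xz _.
  exact: (le_ball (ltW nz)) zy.
move=> [n _ /(_ n (leqnn n)) h]; exists n.+1%:R^-1; first by rewrite invr_gt0.
by move=> x y; apply: h.
Qed.

Lemma finite_lebesgue (F : set (Lsc cX)) : finite_set F ->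
  exists2 d, 0 < d & forall u v, F u -> F v -> u \ll v -> forall x y, ball x d y ->
    ((u : lsc_fun X) x <= (v : lsc_fun X) y)%E.
Proof.
move=> fF.
have ex (uv : Lsc cX * Lsc cX) : exists d, 0 < d /\ (uv.1 \ll uv.2 ->
    forall x y, ball x d y -> ((uv.1 : lsc_fun X) x <= (uv.2 : lsc_fun X) y)%E).
  have [/way_below_lebesgue[d d0 dP]|nuv] := pselect (uv.1 \ll uv.2).
    by exists d.
  by exists 1.
have [d dP] := choice ex.
have [m m0 mP] := finite_min_gt0 (finite_setX fF fF) (fun uv => (dP uv).1).
exists m => // u v Fu Fv uv x y xy; apply: (dP (u, v)).2 => //.
by apply: le_ball xy; apply: mP; split.
Qed.

End LebesgueNumber.

Section Levels.
Context {R : realType} (X : pseudoMetricType R).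

Lemma lsc_of_levels (P : nat -> X -> Prop) : (forall x, P 0%N x) ->
  (forall m n x, (m <= n)%N -> P n x -> P m x) ->
  (forall n x, P n x -> \forall y \near x, P n y) ->
  exists u : lsc_fun X, forall n x, (n%:R%:E <= u x)%E <-> P n x.
Proof.
move=> P0 Pdn Pop.
pose A x : set (\bar R) := [set n%:R%:E | n in [set n | P n x]].
have Aext x : A x `<=` extnat by move=> _ [n _ <-]; exact: extnat_nat.
have A0 x : A x !=set0 by exists 0%:R%:E, 0%N => //; exact: P0.
have AP n x : (n%:R%:E <= ereal_sup (A x))%E <-> P n x.
  split=> [/(extnat_sup_ge (@Aext x) (A0 x))[_ [k Pk <-]]|Pn].
    by rewrite lee_fin ler_nat => /Pdn; apply.
  by apply: ereal_sup_ubound; exists n.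
have Anear n x : (n%:R%:E <= ereal_sup (A x))%E ->
    \forall y \near x, (n%:R%:E <= ereal_sup (A y))%E.
  by move=> /AP/Pop; apply: filterS => y /AP.
by exists (lsc_make (fun x => extnat_sup (@Aext x) (A0 x)) Anear) => n x; exact: AP.
Qed.

End Levels.

(* The largest y with y o p <= v. *)
Lemma lsc_pushforward (R : realType) (X : pseudoMetricType R)
    (p : X -> unit_interval R) (u v : lsc_fun X) :
  compact [set: X] -> continuous p ->
  (forall x x', p x = p x' -> (u x <= v x')%E) ->
  exists y : lsc_fun (unit_interval R), forall x, (u x <= y (p x))%E /\ (y (p x) <= v x)%E.
Proof.
move=> /compact_near_coveringP nc cp uv.
have cv := uval_comp_continuous cp.
have [|||y yP] := @lsc_of_levels R (unit_interval R)
  (fun n t => forall x, p x = t -> (n%:R%:E <= v x)%E).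
- by move=> t x _; exact/extnat_ge0/lsc_extnat.
- by move=> m n t mn H x /H; apply: le_trans; rewrite lee_fin ler_nat.
- move=> n t H.
  (* The condition on fibres is open in [t]: a point over [t] keeps [v >= n] nearby, any other point
     stays away from the fibres near [t], and compactness makes this uniform. *)
  have : \forall t' \near t, [set: X] `<=` (fun x => p x = t' -> (n%:R%:E <= v x)%E).
    apply: (nc _ (nbhs t) _ (nbhs_filter (t : unit_interval R))) => x _.
    have [pxt|pxt] := pselect (p x = t).
      have := lsc_near (H x pxt) => vx.
      exists ([set x' | (n%:R%:E <= v x')%E], setT); first by split=> //; exact: filterT.
      by move=> [x' t'] [].
    have d0 : 0 < `|uval (p x) - uval t| / 2.
      by rewrite divr_gt0// normr_gt0 subr_eq0; apply/eqP => /uval_inj.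
    have /cvgrPdist_lt /(_ _ d0) nx := cv x.
    exists ([set x' | `|uval (p x) - uval (p x')| < `|uval (p x) - uval t| / 2],
      ball t (`|uval (p x) - uval t| / 2)); first by split=> //; exact: nbhsx_ballx.
    move=> [x' t'] [/= h1 /unit_ballE h2] pxt'; exfalso.
    have := ler_distD (uval t') (uval (p x)) (uval t).
    by move: h1; rewrite pxt' (distrC (uval t')); lra.
  by apply: filterS => t' H' x; exact: H'.
exists y => x; split.
  apply: extnat_leP (lsc_extnat u x) _ => N Nu; apply/yP => x' px.
  by apply: le_trans Nu (uv _ _ _).
by apply: extnat_leP (lsc_extnat y _) _ => N /yP; exact.
Qed.

(** * A countable basis of step functions on the interval *)

Section CountableBasis.
Variable R : realType.
Local Notation UI := (unit_interval R).

Definition grid_cell (N j : nat) (t : UI) : Prop :=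
  `|uval t - j%:R / N.+1%:R| < N.+1%:R^-1.

Lemma grid_cell_cover N t : exists2 j, (j <= N.+1)%N & grid_cell N j t.
Proof.
have [t0 t1] := uval01 t; have N0 : 0 < N.+1%:R :> R by [].
have ex : exists j : nat, uval t * N.+1%:R <= j%:R.
  by exists N.+1; rewrite ger_pMl.
case: (ex_minnP ex) => j tj jmin; exists j.
  by apply: jmin; rewrite ger_pMl.
rewrite /grid_cell -(ltr_pM2r N0) mulVf ?gt_eqF// -{2}(gtr0_norm N0) -normrM.
rewrite mulrBl mulfVK ?gt_eqF//.
have : j%:R < uval t * N.+1%:R + 1.
  case: j tj jmin => [|j] tj jmin; first by rewrite ltr_wpDl// mulr_ge0// ltW.
  rewrite -natr1 ltrD2r ltNge; apply/negP => h.
  by have := jmin j h; rewrite ltnn.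
by move: (uval t * N.+1%:R) tj => a tj h; rewrite ltr_norml; lra.
Qed.

(** The step function is the maximum over [j] of [c_j] times the indicator of the open cell [j];
    cells beyond the list get the default coefficient 0. Meshes paired with lists form a countable
    index set. *)
Lemma grid_step (Nc : nat * seq nat) : exists u : LscI R, forall m t,
  (m%:R%:E <= (u : lsc_fun UI) t)%E <->
  m = 0%N \/ exists2 j, grid_cell Nc.1 j t & (m <= nth 0%N Nc.2 j)%N.
Proof.
case: Nc => N c; apply: (@lsc_of_levels R UI (fun m t =>
  m = 0%N \/ exists2 j, grid_cell N j t & (m <= nth 0%N c j)%N)).
- by move=> t; left.
- move=> m n t mn [n0|[j jt nc]]; first by left; lia.
  by right; exists j => //; exact: leq_trans nc.
- move=> n t [n0|[j jt nc]].
    have tT : [set: UI] t by [].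
    by apply: filterS (open_nbhs_nbhs (conj openT tT)) => s _; left.
  have oj : open (grid_cell N j).
    have cg : continuous (fun s : UI => `|uval s - j%:R / N.+1%:R|).
      by apply: continuous_norm_sub; [exact: uval_continuous|exact: cst_continuous].
    rewrite (_ : grid_cell N j =
      (fun s : UI => `|uval s - j%:R / N.+1%:R|) @^-1` [set r | r < N.+1%:R^-1])//.
    by apply: open_comp => [s _|]; [exact: cg|exact: open_lt].
  by apply: filterS (open_nbhs_nbhs (conj oj jt)) => s js; right; exists j.
Qed.

(** The coefficient of a cell is the maximum of [u] there, which exists because [u] is bounded. Two
    points of a cell are less than [d] apart, so this maximum is at most [v] on the cell. *)
Lemma grid_step_between (step : nat * seq nat -> LscI R) (u v : LscI R) :
  (forall Nc m t, (m%:R%:E <= (step Nc : lsc_fun UI) t)%E <->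
     m = 0%N \/ exists2 j, grid_cell Nc.1 j t & (m <= nth 0%N Nc.2 j)%N) ->
  u \ll v -> exists Nc, (u <= step Nc)%O /\ (step Nc <= v)%O.
Proof.
move=> stepP uv; have [d d0 dP] := way_below_lebesgue uv.
have [K uK] := lsc_lub_natural uv.
have [N Nd] := exists_nat_gt (2 / d).
have N0 : 0 < N.+1%:R :> R by [].
have Nd' : 2 * N.+1%:R^-1 < d.
  rewrite -ltr_pdivlMl// invf_plt ?posrE ?mulr_gt0 ?invr_gt0//.
  rewrite invfM invrK; apply: lt_trans Nd _.
  by rewrite ltr_nat.
have cex j : exists c : nat, (forall s, grid_cell N j s -> ((u : lsc_fun UI) s <= c%:R%:E)%E) /\
    (c = 0%N \/ exists2 s, grid_cell N j s & (c%:R%:E <= (u : lsc_fun UI) s)%E).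
  pose Q k := `[< k = 0%N \/ exists2 s, grid_cell N j s & (k%:R%:E <= (u : lsc_fun UI) s)%E >].
  have Q0 : exists k, Q k by exists 0%N; apply/asboolP; left.
  have QK k : Q k -> (k <= K)%N.
    move=> /asboolP[->//|[s _ ks]]; have := le_trans ks (uK s).
    by rewrite lee_fin ler_nat.
  case: (ex_maxnP Q0 QK) => c /asboolP Qc cmax; exists c; split=> // s js.
  apply: extnat_leP; first exact: lsc_extnat.
  move=> n ns; rewrite lee_fin ler_nat; apply: cmax; apply/asboolP; right.
  by exists s.
have [c cP] := choice cex.
exists (N, mkseq c N.+2); split; apply/lsc_leP => t.
  apply: extnat_leP; first exact: lsc_extnat.
  move=> n nt; apply/stepP; right; have [j jN jt] := grid_cell_cover N t.
  exists j => //=; rewrite nth_mkseq ?ltnS//.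
  by have := le_trans nt ((cP j).1 t jt); rewrite lee_fin ler_nat.
apply: extnat_leP; first exact: lsc_extnat.
move=> n /stepP[->|[j /= jt]]; first exact/extnat_ge0/lsc_extnat.
have [jN|jN] := ltnP j N.+2; last first.
  by rewrite nth_default ?size_mkseq// leqn0 => /eqP->; exact/extnat_ge0/lsc_extnat.
rewrite nth_mkseq// => nc; apply: (@le_trans _ _ (c j)%:R%:E).
  by rewrite lee_fin ler_nat.
have [-> |[s js cs]] := (cP j).2; first exact/extnat_ge0/lsc_extnat.
apply: le_trans cs _; apply: dP; apply/unit_ballE.
have := ler_distD (j%:R / N.+1%:R) (uval s) (uval t).
move: jt js Nd'; rewrite /grid_cell (distrC (uval t)).
by move: (N.+1%:R^-1 : R) => r; lra.
Qed.

Lemma LscI_countably_based : countably_based (LscI R).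
Proof.
have [step stepP] := choice grid_step.
exists (step @` setT); split.
  by apply: sub_countable (countableP [set: nat * seq nat]); exact: card_image_le.
move=> u; have [d [dd du]] := dense_sequence (fun x' x => @grid_step_between step x' x stepP) u.
by exists (step \o d); split=> // n; exists (d n).
Qed.

End CountableBasis.

(** * The pseudo-arc as a Fraisse limit *)

Section PseudoArcLimit.
Variables (R : realType) (P : metricType R) (hP : pseudo_arc P).
Local Notation UI := (unit_interval R).
Let Pcpt := pseudo_arc_compact hP.
Let Pcon := pseudo_arc_connected hP.
Let P2 := pseudo_arc_nondegenerate hP.
Let PHI := pseudo_arc_indecomposable hP.
Let Pch := pseudo_arc_chainable hP.

(** Density of the pullbacks: if the fibres of [p i] are smaller than the Lebesgue number of
    [u \ll v], a function pushed forward along [p i] pulls back to one between [u] and [v]. *)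
Lemma cu_limit_of_maps (S : ind_seq (KP R)) (p : nat -> P -> UI) :
  (forall i, csurj (p i)) ->
  (forall i j (ij : (i <= j)%N) (u : LscI R) x,
    (@seq_map (KP R) S i j ij u : lsc_fun UI) (p j x) = (u : lsc_fun UI) (p i x)) ->
  (forall eta, 0 < eta -> exists i, eta_map (p i) eta) ->
  is_cu_limit S (Lsc Pcpt).
Proof.
move=> ps pc pe.
apply: (@cu_limit_of_dense _ S (Lsc Pcpt) (fun i => lsc_pull (ps i).1)).
- split=> [i|i j ij u]; first exact: lsc_pull_morphism.
  by apply: lsc_eqP => x; exact: pc.
- by move=> i; apply: lsc_pull_embedding; exact: (ps i).2.
- move=> u v uv; have [d d0 dP] := way_below_lebesgue uv.
  have [i pi] := pe d d0.
  have [|y yP] := lsc_pushforward (u := u) (v := v) Pcpt (ps i).1.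
    by move=> x x' /pi xx'; apply: dP; rewrite ballEmdist.
  by exists i, y; split; apply/lsc_leP => x; have [] := yP x.
Qed.

Section ExistenceOfFraisseSequence.
Variables (k : nat -> UI -> UI) (p : nat -> P -> UI).
Hypothesis ks : forall n, csurj (k n).
Hypothesis ps : forall n, csurj (p n).
Hypothesis kp : forall n x, k n (p n.+1 x) = p n x.
Hypothesis pe : forall eta, 0 < eta -> exists N, forall n, (N <= n)%N -> eta_map (p n) eta.

Fixpoint bonding (m j : nat) : UI -> UI :=
  if j is j'.+1 then bonding m j' \o k (m + j')%N else id.

Lemma bonding_csurj m j : csurj (bonding m j).
Proof.
by elim: j => [|j IH]; [exact: csurj_id|exact: csurj_comp IH (ks _)].
Qed.

Lemma bondingD m a b t : bonding m a (bonding (m + a)%N b t) = bonding m (a + b)%N t.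
Proof. by elim: b t => [|b IH] t; rewrite ?addn0// addnS /= -IH addnA. Qed.

Lemma bonding_p m j x : bonding m j (p (m + j)%N x) = p m x.
Proof. by elim: j => [|j IH] /=; rewrite ?addn0// addnS kp. Qed.

Lemma bonding_comp i j l t : (i <= j)%N -> (j <= l)%N ->
  bonding i (j - i) (bonding j (l - j) t) = bonding i (l - i) t.
Proof.
move=> ij jl; have {2}<- : (i + (j - i) = j)%N by exact: subnKC.
by rewrite bondingD; congr (bonding _ _ _); lia.
Qed.

Definition bonding_seq : ind_seq (KP R).
Proof.
refine (@IndSeq (KP R) (fun=> tt)
  (fun i j _ => lsc_pull (bonding_csurj i (j - i)).1 : LscI R -> LscI R) _ _ _).
- by move=> i j _; exact: KP_hom_pull.
- by move=> i ii u; apply: lsc_eqP => t; rewrite lsc_pullE subnn.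
- move=> i j l ij jl il u; apply: lsc_eqP => t.
  exact: (congr1 (fun s => lsc_val (u : lsc_fun UI) s) (bonding_comp t ij jl)).
Defined.

(** Let [s] be the interval map of the given morphism. Lifting [p i] through [s] gives [q] on the
    pseudo-arc, and factoring [q] through [p j] with small fibres gives [u]. Then [s o u] is close
    to the bonding map over [p j], hence everywhere, since [p j] is onto. *)
Lemma bonding_seq_fraisse : fraisse_seq bonding_seq.
Proof.
split=> [i|i F fF c a ha]; first exact: LscI_countably_based.
have ss := KP_hom_csurj ha; have aE := KP_hom_mapE ha.
set s := morphism_map a in ss aE.
have [d d0 dP] := finite_lebesgue fF.
have d4 : 0 < d / 4 by lra.
have [q qs qP] := csurj_lift Pcpt Pcon PHI (ps i) ss d4.
have [e1 e10 e1P] := unit_unif_continuous (uval_comp_continuous ss.1) d4.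
pose e := Num.min (e1 / 8) (1 / 4).
have e0 : 0 < e by rewrite lt_min; lra.
have e18 : e <= e1 / 8 by rewrite ge_min lexx.
have e4 : e <= 1 / 4 by rewrite ge_min lexx orbT.
have [eta eta0 etaP] := mdist_unif Pcpt (uval_comp_continuous qs.1) e0.
have [N NP] := pe eta0.
pose j := maxn i N; have ij : (i <= j)%N by exact: leq_maxl.
have [||u us uP] := csurj_factor (e := e) Pcpt (ps j) qs.
- by rewrite e0.
- by move=> x y /(NP j (leq_maxr _ _)) /etaP.
exists j, ij, (lsc_pull us.1 : LscI R -> LscI R); split; first exact: KP_hom_pull.
have close t : `|uval (s (u t)) - uval (bonding i (j - i) t)| < d.
  have [x <-] := (ps j).2 t.
  have -> : bonding i (j - i) (p j x) = p i x by rewrite -{2}(subnKC ij) bonding_p.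
  have : `|uval (s (u (p j x))) - uval (s (q x))| < d / 4.
    by apply: e1P; have := uP x; lra.
  have := qP x; have := ler_distD (uval (s (q x))) (uval (s (u (p j x)))) (uval (p i x)).
  lra.
move=> x' x Fx' Fx xx'; split; apply/lsc_leP => t; rewrite /= aE; apply: dP => //;
  apply/unit_ballE; first exact: close.
by rewrite distrC; exact: close.
Qed.

End ExistenceOfFraisseSequence.

Lemma fraisse_seq_exists : exists S : ind_seq (KP R), fraisse_seq S.
Proof.
have [q0 q0s _] := eta_map_exists Pcpt Pcon Pch P2 ltr01.
have [||s [k [p [_ ks ps kp pe]]]] :=
  @tower R P Pcpt unit (fun _ _ k => csurj k) _ _ tt q0 q0s.
- by [].
- move=> _ q d eta qs d0 eta0.
  have [q' [k [q's q'e ks kq]]] := csurj_refine Pcpt Pcon Pch P2 qs d0 eta0.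
  by exists tt, k, q'.
by exists (bonding_seq ks); exact: (bonding_seq_fraisse (p := p)).
Qed.

Section FraisseSequence.
Variable S : ind_seq (KP R).
Hypothesis SF : fraisse_seq S.

Let g i j (ij : (i <= j)%N) : UI -> UI :=
  morphism_map (@seq_map (KP R) S i j ij : LscI R -> LscI R).

Let gE i j (ij : (i <= j)%N) (u : LscI R) t :
  (@seq_map (KP R) S i j ij u : lsc_fun UI) t = (u : lsc_fun UI) (g ij t).
Proof. exact: (KP_hom_mapE (seq_hom S ij)). Qed.

Let gs i j (ij : (i <= j)%N) : csurj (g ij).
Proof. exact: (KP_hom_csurj (seq_hom S ij)). Qed.

Let g_comp i j l (ij : (i <= j)%N) (jl : (j <= l)%N) (il : (i <= l)%N) t :
  g ij (g jl t) = g il t.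
Proof. by apply: lsc_separates => u; rewrite -!gE (seq_comp ij jl il). Qed.

Let g_id i (ii : (i <= i)%N) t : g ii t = t.
Proof. by apply: lsc_separates => u; rewrite -gE seq_id. Qed.

(** Strict growth of the index makes the states of the tower cofinal in the sequence. *)
Let adm i j (k : UI -> UI) := exists ij : (i <= j)%N, (i < j)%N /\ k = g ij.

(** Approximate [q] by [s o r] with [r] of small fibres. The Fraisse property absorbs [s]: some
    [s o h] is close to a bonding map. A lift [q'] of [r] through [h], followed by one more bonding
    map, inherits the small fibres, and the bonding map after [q'] is close to [s o r], hence to
    [q]. *)
Let adm_step i (q : P -> UI) d eta : csurj q -> 0 < d -> 0 < eta ->
  exists j k q', [/\ adm i j k, csurj q', eta_map q' eta &
    forall x, `|uval (k (q' x)) - uval (q x)| <= d].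
Proof.
move=> qs d0 eta0; have d4 : 0 < d / 4 by lra.
have [r [s [rs re ss rsq]]] := csurj_refine Pcpt Pcon Pch P2 qs d4 eta0.
have [n nd] := exists_nat_gt (2 / (d / 4)).
have d8 : 0 < 2 / (d / 4) by rewrite divr_gt0.
have n0 : (0 < n)%N by rewrite -(ltr_nat R); lra.
have nd' : 2 / n%:R <= d / 4.
  by rewrite ler_pdivrMr ?ltr0n// mulrC -ler_pdivrMr// ltW.
have [j [ij [b [hb bF]]]] := SF.2 i _ (ray_grid_finite R n) tt _ (KP_hom_pull ss).
have hs := KP_hom_csurj hb; have bE := KP_hom_mapE hb.
set h := morphism_map b in hs bE.
have sh t : `|uval (s (h t)) - uval (g ij t)| <= d / 4.
  have aE (u : LscI R) t' : ((b \o (lsc_pull ss.1 : LscI R -> LscI R)) u : lsc_fun UI) t' =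
      (u : lsc_fun UI) ((s \o h) t') by rewrite /= bE.
  apply: le_trans nd'.
  exact: (@ray_grid_close R n _ _ (s \o h) (g ij) n0 aE (gE ij) bF t).
have jj1 : (j <= j.+1)%N by [].
have ij1 : (i <= j.+1)%N by exact: leqW.
pose h' := h \o g jj1.
have h's : csurj h' by exact: csurj_comp hs (gs _).
have [kap kap0 kapP] := eta_map_unif Pcpt rs.1 re.
have [e e0 eP] := unit_unif_continuous (uval_comp_continuous ss.1) d4.
pose e' := Num.min (kap / 4) (e / 2).
have e'0 : 0 < e' by rewrite lt_min; lra.
have e'1 : e' <= kap / 4 by rewrite ge_min lexx.
have e'2 : e' <= e / 2 by rewrite ge_min lexx orbT.
have [q' q's q'P] := csurj_lift Pcpt Pcon PHI rs h's e'0.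
exists j.+1, (g ij1), q'; split=> //.
- by exists ij1.
- move=> x y xy; apply: kapP.
  have := q'P x; have := q'P y; rewrite xy.
  have := ler_distD (uval (h' (q' y))) (uval (r x)) (uval (r y)).
  by rewrite (distrC (uval (r x)) (uval (h' _))); lra.
- move=> x; rewrite -(g_comp ij jj1 ij1).
  have h1 := sh (g jj1 (q' x)).
  have h2 : `|uval (s (h' (q' x))) - uval (s (r x))| < d / 4.
    by apply: eP; have := q'P x; lra.
  have h3 := rsq x.
  have := ler_distD (uval (s (h' (q' x)))) (uval (g ij (g jj1 (q' x)))) (uval (s (r x))).
  have := ler_distD (uval (s (r x))) (uval (g ij (g jj1 (q' x)))) (uval (q x)).
  rewrite (distrC (uval (g ij _)) (uval (s (h' _)))) -/h' in h1 *.
  by move: h1; rewrite /h' /=; lra.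
Qed.

(** The tower yields maps only along the subsequence of states [s n]; the map at index [i] is
    obtained by composing [p i] with the bonding map from [s i] down to [i]. *)
Lemma fraisse_seq_limit : is_cu_limit S (Lsc Pcpt).
Proof.
have [q0 q0s _] := eta_map_exists Pcpt Pcon Pch P2 ltr01.
have adm_csurj i j k : adm i j k -> csurj k by move=> [ij [_ ->]].
have [s [k [p [s0 sk ps kp pe]]]] := tower Pcpt adm_csurj adm_step 0%N q0s.
have slt n : (s n < s n.+1)%N by have [ij [h _]] := sk n.
have sle m n : (m <= n)%N -> (s m <= s n)%N.
  elim: n => [|n IH]; first by rewrite leqn0 => /eqP->.
  rewrite leq_eqVlt => /predU1P[->//|/IH h]; exact: leq_trans h (ltnW (slt n)).
have sge n : (n <= s n)%N.
  by elim: n => [//|n IH]; exact: leq_ltn_trans IH (slt n).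
have pg m n (mn : (s m <= s n)%N) x : (m <= n)%N -> g mn (p n x) = p m x.
  elim: n mn x => [|n IH] mn x.
    by rewrite leqn0 => /eqP m0; subst m; exact: g_id.
  rewrite leq_eqVlt => /predU1P[mE|mn']; first by subst m; exact: g_id.
  have [nn1 [_ kE]] := sk n.
  have mn2 : (m <= n)%N := mn'.
  by rewrite -(g_comp (sle _ _ mn2) nn1 mn) -kE kp IH.
pose p' i x := g (sge i) (p i x).
have p'E i n (isn : (i <= s n)%N) x : (i <= n)%N -> g isn (p n x) = p' i x.
  by move=> le_in; rewrite /p' -(pg _ _ (sle _ _ le_in))// g_comp.
apply: (@cu_limit_of_maps S p').
- by move=> i; exact: csurj_comp (gs _) (ps i).
- by move=> i j ij u x; rewrite gE (g_comp ij (sge j) (leq_trans ij (sge j))) p'E.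
- move=> eta eta0; have [N NP] := pe eta eta0; exists (s N) => x y.
  have pN z : p' (s N) z = p N z by apply: pg.
  by rewrite !pN; exact: NP.
Qed.

End FraisseSequence.

End PseudoArcLimit.

Theorem corollary4p36 (R : realType) (P : metricType R) (hP : pseudo_arc P) :
  is_fraisse_limit (KP R) (Lsc (pseudo_arc_compact hP)).
Proof.
split; first exact: fraisse_seq_exists hP.
by move=> S SF; exact: fraisse_seq_limit.
Qed.
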